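(* Let $p,s$ be real numbers with either $2\le s\le p<\infty$ or $1<p\le s\le 2$. Let $C_{s,p}$ denote the optimal (smallest) constant such that $$\big\|\,(|P_+f|^s+|P_-f|^s)^{1/s}\,\big\|_{L^p(\mathbf{T})}\le C_{s,p}\,\|f\|_{L^p(\mathbf{T})}\qquad\text{for all complex-valued } f\in L^p(\mathbf{T}).$$ Then for every sequence $(f_k)_{k\ge1}$ of complex-valued functions in $L^p(\mathbf{T})$, and for each of the two choices of sign $\pm$, $$\Big\|\Big(\sum_{k=1}^{\infty}|P_{\pm}f_k|^s\Big)^{1/s}\Big\|_{L^p(\mathbf{T})}\le C_{s,p}\,\Big\|\Big(\sum_{k=1}^{\infty}|f_k|^s\Big)^{1/s}\Big\|_{L^p(\mathbf{T})}.$$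
   Context: $\mathbf{T}=\{z\in\mathbf{C}:|z|=1\}$ is the unit circle with arc-length measure, and $L^p(\mathbf{T})$ is the complex Lebesgue space. For $f\in L^p(\mathbf{T})$, $\hat f(n)=\frac1{2\pi}\int_0^{2\pi}f(e^{it})e^{-int}\,dt$. For $1<p<\infty$ the Riesz projection $P_+$ on $L^p(\mathbf{T})$ is the bounded operator given by $P_+f(\zeta)=\sum_{n\ge 0}\hat f(n)\zeta^n$, and $P_-=I-P_+$ is the co-analytic projection, $P_-f(\zeta)=\sum_{n\le -1}\hat f(n)\zeta^n$. If the right-hand side norm is infinite the inequality is regarded as trivially true. *)

(* Defs.v *)
From HB Require Import structures.
From mathcomp Require Import all_boot all_order all_algebra.
From mathcomp Require Import complex.
From mathcomp Require Import all_classical all_reals all_analysis.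

Set Implicit Arguments.
Unset Strict Implicit.
Unset Printing Implicit Defensive.

Import Order.TTheory GRing.Theory Num.Theory.
Import numFieldNormedType.Exports.

Local Open Scope classical_set_scope.
Local Open Scope ring_scope.
Local Open Scope complex_scope.

(* The norm `|z| of z : R[i] lies in R[i]; cabs is its real value. *)
Notation cabs := ComplexField.Normc.normc.

Definition circle (R : realType) : Type := {z : R[i] | `|z| == 1}.

Definition expi_val (R : realType) (t : R) : R[i] := cos t +i* sin t.

Lemma expi_subproof (R : realType) (t : R) : `|expi_val t| == 1.
Proof. by rewrite normc_def /= cos2Dsin2 sqrtr1. Qed.

Definition expi (R : realType) (t : R) : circle R :=
  exist _ (expi_val t) (expi_subproof t).

(* The circle carries arc length through t in [0, 2 pi] |-> e^(it).  F takes
   extended real values because it may be an l^s norm of a sequence. *)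
Definition normT (R : realType) (p : R) (F : circle R -> \bar R) : \bar R :=
  ('N[@lebesgue_measure R]_(p%:E)[(F \o @expi R) \_ `[0%R, (2 * pi)%R]%classic])%E.

(* Measurability is asked of the 2 pi-periodic functions t |-> Re f (e^(it))
   and t |-> Im f (e^(it)).  Functions are not identified almost everywhere. *)
Definition LpT (R : realType) (p : R) (f : circle R -> R[i]) : Prop :=
  [/\ measurable_fun setT (fun t : R => complex.Re (f (expi t))),
      measurable_fun setT (fun t : R => complex.Im (f (expi t))) &
      (normT p (fun z => (cabs (f z))%:E) < +oo)%E].

Definition cintegral (R : realType) (D : set R) (h : R -> R[i]) : R[i] :=
  (\int[@lebesgue_measure R]_(t in D) complex.Re (h t))
  +i* (\int[@lebesgue_measure R]_(t in D) complex.Im (h t)).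

Definition fourier_coef (R : realType) (f : circle R -> R[i]) (n : int) : R[i] :=
  ((2 * pi)^-1)%:C *
  cintegral `[0, 2 * pi]%classic (fun t => f (expi t) * expi_val (- (n%:~R * t))).

Definition analytic_partial_sum (R : realType) (f : circle R -> R[i]) (N : nat)
    (z : circle R) : R[i] :=
  \sum_(0 <= n < N) fourier_coef f n%:Z * sval z ^+ n.

(* g is the sum of the series with terms \hat f(n) z^n, n >= 0, which
   converges in L^p norm when f is in L^p and 1 < p < oo. *)
Definition is_analytic_part (R : realType) (p : R) (f g : circle R -> R[i]) :
    Prop :=
  LpT p g /\
  normT p (fun z => (cabs (analytic_partial_sum f N z - g z))%:E)
    @[N --> \oo] --> 0%E.

(* A representative of the Riesz projection of f; the value 0 is used only
   when the series has no sum in L^p. *)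
Definition Pplus (R : realType) (p : R) (f : circle R -> R[i]) :
    circle R -> R[i] :=
  xget (fun=> 0) [set g | is_analytic_part p f g].

Definition Pminus (R : realType) (p : R) (f : circle R -> R[i]) :
    circle R -> R[i] :=
  fun z => f z - Pplus p f z.

(* The infimum of the admissible constants, which is the smallest one; it is
   +oo if there is none. *)
Definition opt_const (R : realType) (s p : R) : \bar R :=
  ereal_inf [set C%:E | C in [set C : R |
    forall f : circle R -> R[i], LpT p f ->
    (normT p (fun z => ((cabs (Pplus p f z) `^ s + cabs (Pminus p f z) `^ s)
                         `^ s^-1)%:E)
     <= C%:E * normT p (fun z => (cabs (f z))%:E))%E]].

Definition lsnorm (R : realType) (s : R) (f : nat -> circle R -> R[i])
    (z : circle R) : \bar R :=
  ((\sum_(0 <= k <oo) (cabs (f k z) `^ s)%:E) `^ s^-1)%E.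

(* Main.v *)
(* An admissible constant C bounds P_+ and P_- on scalar L^p.  A linear operator
   bounded by C on L^p is bounded by C on l^p-valued functions by Fubini, and on
   l^2-valued ones by Marcinkiewicz and Zygmund: for independent complex
   Gaussians g_k, E |sum a_k g_k|^p is a multiple of (sum |a_k|^2)^(p/2).  As s
   lies between 2 and p, Riesz-Thorin interpolation of the inner exponent alone,
   the outer one p being fixed, gives the bound C on l^s-valued functions.  This
   is done for weighted finite matrices, to which functions are reduced by
   rounding their values and those of their images.
   That the series defining P_+ f converges in L^p also follows from
   admissibility.  On trigonometric polynomials its partial sums are
   S_N = P_+ - e_N P_+ e_(-N), where e_n is multiplication by z^n, hence are
   bounded by 2C; trigonometric polynomials are dense and L^p is complete. *)

From HB Require Import structures.
Require Import Defs.
From mathcomp Require Import all_boot all_order all_algebra.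
From mathcomp Require Import complex.
From mathcomp Require Import ring lra.
From mathcomp Require Import all_classical all_reals all_analysis measurable_realfun.

Set Implicit Arguments.
Unset Strict Implicit.
Unset Printing Implicit Defensive.

Import Order.TTheory GRing.Theory Num.Theory.
Import numFieldNormedType.Exports.

Local Open Scope classical_set_scope.
Local Open Scope ring_scope.
Local Open Scope complex_scope.

(** * Complex moduli and Hoelder's inequality *)

(** [Pplus p f] is a representative picked by [xget], and the picks for different functions are
    unrelated. Linearity therefore holds only up to null functions, and the [l^s]-valued extension
    is proved for any map [P] that is bounded on L^p and linear in this weak sense; both signs are
    instances. Interpolation runs between the inner exponents p and 2 with the same C at both ends,
    so C survives unchanged. With the outer exponent fixed, only the inner vectors are deformed
    along the strip. On finite matrices the analytic family is a finite exponential sum, and for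
    such sums a discrete maximum principle suffices. Without an analytic part [Pplus] is the default
    0, so admissibility says something about the projection only where an analytic part is known.
    Trigonometric polynomials, with their explicit analytic part, therefore come before general
    functions. The constant function 1 forces C >= 1, which also settles the products with infinite
    norms. *)

Section cabs.
Variable R : realType.
Implicit Types (x y : R[i]).

Lemma cabs_ge0 x : 0 <= cabs x.
Proof. by case: x => a b; exact: sqrtr_ge0. Qed.

Lemma cabs_eq0 x : (cabs x == 0) = (x == 0).
Proof.
apply/eqP/eqP => [|->]; first exact: ComplexField.Normc.eq0_normc.
exact: ComplexField.Normc.normc0.
Qed.

Lemma cabs0 : cabs (0 : R[i]) = 0.
Proof. exact: ComplexField.Normc.normc0. Qed.

Lemma cabs1 : cabs (1 : R[i]) = 1.
Proof. exact: ComplexField.Normc.normc1. Qed.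

Lemma cabsM x y : cabs (x * y) = cabs x * cabs y.
Proof. exact: ComplexField.Normc.normcM. Qed.

Lemma cabsD x y : cabs (x + y) <= cabs x + cabs y.
Proof. exact: le_normcD. Qed.

Lemma cabsN x : cabs (- x) = cabs x.
Proof. exact: normcN. Qed.

Lemma cabsB x y : cabs (x - y) = cabs (y - x).
Proof. by rewrite -cabsN opprB. Qed.

Lemma cabs_sum (I : Type) (r : seq I) (P : pred I) (F : I -> R[i]) :
  cabs (\sum_(i <- r | P i) F i) <= \sum_(i <- r | P i) cabs (F i).
Proof.
elim/big_ind2 : _ => //; first by rewrite cabs0.
by move=> x a y b xa yb; apply: le_trans (cabsD _ _) _; exact: lerD.
Qed.

Lemma cabs_real (a : R) : cabs a%:C = `|a|.
Proof. by rewrite /= expr0n /= addr0 sqrtr_sqr. Qed.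

Lemma cabsE x : cabs x = Num.sqrt (complex.Re x ^+ 2 + complex.Im x ^+ 2).
Proof. by case: x. Qed.

Lemma sqr_cabs x : cabs x ^+ 2 = complex.Re x ^+ 2 + complex.Im x ^+ 2.
Proof. by rewrite cabsE sqr_sqrtr// addr_ge0 ?sqr_ge0. Qed.

Lemma cabs_expi (t : R) : cabs (expi_val t) = 1.
Proof. by rewrite /= cos2Dsin2 sqrtr1. Qed.

Lemma expi_valD (t u : R) : expi_val (t + u) = expi_val t * expi_val u.
Proof.
by rewrite /expi_val cosD sinD; apply/eqP; rewrite eq_complex /= eqxx/= [X in _ == X]addrC.
Qed.

Lemma expi_val0 : expi_val (0 : R) = 1.
Proof. by rewrite /expi_val cos0 sin0. Qed.

Lemma conjC_mul_cabs x : x * x^*%C = (cabs x ^+ 2)%:C.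
Proof.
case: x => a b; rewrite sqr_cabs /=; apply/eqP; rewrite eq_complex /=.
by rewrite mulrN opprK !expr2 eqxx /= mulrN addrC mulrC subrr.
Qed.

Lemma cabsJ x : cabs x^*%C = cabs x.
Proof. by case: x => a b /=; rewrite sqrrN. Qed.

End cabs.

Section finite_hoelder.
Variables (R : realType) (I : finType).
Implicit Types (w x y : I -> R).

(** Young's inequality is applied to each term after dividing [x] and [y] by their norms; if one of
    the norms vanishes, so does every term on the left. *)
Lemma hoelder_sum w x y (p q : R) : 0 < p -> 0 < q -> p^-1 + q^-1 = 1 ->
  (forall i, 0 <= w i) -> (forall i, 0 <= x i) -> (forall i, 0 <= y i) ->
  \sum_i w i * (x i * y i) <=
  (\sum_i w i * x i `^ p) `^ p^-1 * (\sum_i w i * y i `^ q) `^ q^-1.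
Proof.
move=> p0 q0 pq w0 x0 y0.
set X := \sum_i w i * x i `^ p; set Y := \sum_i w i * y i `^ q.
have X0 : 0 <= X by apply: sumr_ge0 => i _; rewrite mulr_ge0 ?powR_ge0.
have Y0 : 0 <= Y by apply: sumr_ge0 => i _; rewrite mulr_ge0 ?powR_ge0.
have zero (z : I -> R) (r : R) : 0 < r -> (forall i, 0 <= z i) ->
    \sum_i w i * z i `^ r = 0 -> forall i, w i * z i = 0.
  move=> r0 z0 s0 i.
  have /eqP := s0; rewrite psumr_eq0; last by move=> j _; rewrite mulr_ge0 ?powR_ge0.
  move=> /allP /(_ i); rewrite mem_index_enum => /(_ isT) /=.
  rewrite mulf_eq0 powR_eq0 => /orP[/eqP ->|/andP[/eqP -> _]]; first by rewrite mul0r.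
  by rewrite mulr0.
have [X_eq0|X_neq0] := eqVneq X 0.
  rewrite big1 ?mulr_ge0 ?powR_ge0// => i _.
  by rewrite mulrA (zero _ _ p0 x0 X_eq0) mul0r.
have [Y_eq0|Y_neq0] := eqVneq Y 0.
  rewrite big1 ?mulr_ge0 ?powR_ge0// => i _.
  by rewrite mulrCA (zero _ _ q0 y0 Y_eq0) mulr0.
have {X_neq0}Xgt0 : 0 < X by rewrite lt_neqAle eq_sym X_neq0.
have {Y_neq0}Ygt0 : 0 < Y by rewrite lt_neqAle eq_sym Y_neq0.
have XP : 0 < X `^ p^-1 by rewrite powR_gt0.
have YQ : 0 < Y `^ q^-1 by rewrite powR_gt0.
(* The right-hand sides of Young's inequality for the normalised terms add up to 1/p + 1/q, so
   inserting this sum as a factor 1 reduces the claim to single terms. *)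
have sum1 : \sum_i w i * (x i `^ p / X / p + y i `^ q / Y / q) = 1.
  under eq_bigr do rewrite mulrDr !mulrA.
  rewrite big_split /= -!mulr_suml -/X -/Y divff ?gt_eqF// divff ?gt_eqF//.
  by rewrite !mul1r.
move: X Y XP YQ sum1 X0 Y0 Xgt0 Ygt0 => X Y XP YQ sum1 X0 Y0 Xgt0 Ygt0.
rewrite -[leRHS]mulr1 -sum1 mulr_sumr; apply: ler_sum => i _.
rewrite [leRHS]mulrCA ler_wpM2l//.
have -> : x i * y i = (X `^ p^-1 * (x i / X `^ p^-1)) * (Y `^ q^-1 * (y i / Y `^ q^-1)).
  by rewrite !(mulrC (_ `^ _^-1)) !divfK// gt_eqF.
rewrite mulrACA ler_wpM2l ?mulr_ge0 ?powR_ge0//.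
apply: le_trans (conjugate_powR _ _ p0 q0 pq) _; rewrite ?divr_ge0// ?powR_ge0//.
have root (z u r : R) : 0 < r -> 0 <= z -> 0 <= u -> (u / z `^ r^-1) `^ r = u `^ r / z.
  move=> r0 z0 u0; rewrite powRM// ?invr_ge0 ?powR_ge0//.
  by rewrite -powRN -powRrM mulNr mulVf ?gt_eqF// powR_inv1.
by rewrite !root.
Qed.

End finite_hoelder.

(** * The three lines theorem for exponential sums *)

Section four_points.
Variable R : realType.
Implicit Types (t x : R).

(** The mean value theorem gains one power of t per derivative. The factor 1/(k+1) that integration
    would give is dropped, as only the order in t matters. *)
Lemma derive_bound (f df : R -> R) (B : R) (k : nat) (T : R) :
  f 0 = 0 -> (forall t, is_derive t 1 f (df t)) -> 0 <= B ->
  (forall t, 0 <= t <= T -> `|df t| <= B * t ^+ k) ->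
  forall t, 0 <= t <= T -> `|f t| <= B * t ^+ k.+1.
Proof.
move=> f0 fd B0 dfB t /andP[t0 tT].
have fc : {within `[0, t], continuous f}.
  by apply: derivable_within_continuous => x _; exact: ex_derive.
have [c] := @MVT_segment R f df 0 t t0 (fun x _ => fd x) fc.
rewrite in_itv/= => /andP[c0 ct]; rewrite f0 !subr0 => ->.
rewrite normrM (ger0_norm t0) exprSr mulrA ler_wpM2r//.
apply: le_trans (dfB _ _) _; first by rewrite c0 (le_trans ct).
by rewrite ler_wpM2l// lerXn2r// nnegrE.
Qed.

(** The expression inside is the four-point Laplacian of e^z with step t, divided by e^z; it is
    small because e^z is harmonic. It vanishes at 0 with its first two derivatives, and [expR 1 + 3]
    bounds the third one on [0, 1]. *)
Lemma cosh_cos_bound t : 0 <= t <= 1 ->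
  `|expR t + expR (- t) + 2 * cos t - 4| <= (expR 1 + 3) * t ^+ 3.
Proof.
move=> t01; pose B : R := expR 1 + 3.
have B0 : 0 <= B by rewrite addr_ge0 ?expR_ge0.
apply: (@derive_bound (fun t : R => expR t + expR (- t) + 2 * cos t - 4)
  (fun t => expR t - expR (- t) - 2 * sin t) B 2 1) t01 => //.
- by rewrite oppr0 expR0 cos0; lra.
- by move=> x; apply: is_derive_eq; rewrite /GRing.scale/=; ring.
apply: (@derive_bound (fun t => expR t - expR (- t) - 2 * sin t)
  (fun t => expR t + expR (- t) - 2 * cos t)) => //.
- by rewrite oppr0 expR0 sin0; lra.
- by move=> x; apply: is_derive_eq; rewrite /GRing.scale/=; ring.
apply: (@derive_bound (fun t => expR t + expR (- t) - 2 * cos t)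
  (fun t => expR t - expR (- t) + 2 * sin t)) => //.
- by rewrite oppr0 expR0 cos0; lra.
- by move=> x; apply: is_derive_eq; rewrite /GRing.scale/=; ring.
move=> x /andP[x0 x1]; rewrite expr0 mulr1.
have e1 : expR x <= expR 1 by rewrite ler_expR.
have e2 : expR (- x) <= 1 by rewrite expR_le1 oppr_le0.
have e0 := expR_gt0 x; have e0' := expR_gt0 (- x).
have s1 := sin_le1 x; have s2 := sin_geN1 x.
by rewrite ler_norml /B; apply/andP; split; lra.
Qed.

End four_points.

(** A maximum over the finite grid cannot sit at an interior point, where the value lies strictly
    below the mean of its four neighbours. *)
Lemma grid_max_principle (R : realType) (v : nat -> nat -> R) (N L : nat) (B : R) :
  (forall b, v 0 b <= B) -> (forall b, v N b <= B) ->
  (forall a, (a <= N)%N -> v a 0 <= B) -> (forall a, (a <= N)%N -> v a L <= B) ->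
  (forall a b, (a.+1 < N)%N -> (b.+1 < L)%N ->
    4 * v a.+1 b.+1 < v a.+2 b.+1 + v a b.+1 + v a.+1 b.+2 + v a.+1 b) ->
  forall a b, (a <= N)%N -> (b <= L)%N -> v a b <= B.
Proof.
move=> v0 vN w0 wL vlt a b aN bL.
pose w (ab : 'I_N.+1 * 'I_L.+1) := v ab.1 ab.2.
have [[i j] _ /= wij] := @arg_maxP _ _ _ (ord0, ord0) xpredT w isT.
have vmax a' b' : (a' <= N)%N -> (b' <= L)%N -> v a' b' <= v i j.
  by move=> aN' bL'; have := wij (Ordinal (aN' : (a' < N.+1)%N), Ordinal (bL' : (b' < L.+1)%N)) isT.
apply: le_trans (vmax _ _ aN bL) _ => {a b aN bL}.
case: i j {wij} vmax => [[|i] iN] [[|j] jL] /= vmax //; first exact: w0.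
have [->//|iNE] := eqVneq i.+1 N; have [->|jLE] := eqVneq j.+1 L; first exact: wL.
have i1 : (i.+1 < N)%N by rewrite ltn_neqAle iNE.
have j1 : (j.+1 < L)%N by rewrite ltn_neqAle jLE.
have := vlt _ _ i1 j1.
have := vmax i.+2 j.+1 i1 (ltnW j1); have := vmax i j.+1 (ltnW (ltnW i1)) (ltnW j1).
have := vmax i.+1 j.+2 (ltnW i1) j1; have := vmax i.+1 j (ltnW i1) (ltnW (ltnW j1)).
lra.
Qed.

Section three_lines.
Variables (R : realType) (I : finType) (c : I -> R[i]) (l : I -> R).
Implicit Types (x y h : R).

(** The value at x + i y of the entire function sum_j c_j e^(l_j z), whose frequencies are real. *)
Definition exp_sum x y : R[i] :=
  \sum_j c j * (expR (l j * x))%:C * expi_val (l j * y).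

Let S := \sum_j cabs (c j) * expR `|l j|.

Let S_ge0 : 0 <= S.
Proof. by apply: sumr_ge0 => j _; rewrite mulr_ge0 ?cabs_ge0 ?expR_ge0. Qed.

Let term_le j x y : 0 <= x <= 1 ->
  cabs (c j * (expR (l j * x))%:C * expi_val (l j * y)) <=
  cabs (c j) * expR `|l j|.
Proof.
move=> /andP[x0 x1]; rewrite !cabsM cabs_expi mulr1 ler_wpM2l ?cabs_ge0//.
rewrite cabs_real ger0_norm ?expR_ge0// ler_expR.
apply: le_trans (ler_norm _) _; rewrite normrM (ger0_norm x0).
by rewrite ler_piMr.
Qed.

Let exp_sum_le x y : 0 <= x <= 1 -> cabs (exp_sum x y) <= S.
Proof.
by move=> x01; apply: le_trans (cabs_sum _ _ _) _; apply: ler_sum => j _; exact: term_le.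
Qed.

Let K := \sum_j (cabs (c j) * expR `|l j|) * ((expR 1 + 3) * `|l j| ^+ 3).

Let K_ge0 : 0 <= K.
Proof.
apply: sumr_ge0 => j _.
by rewrite !mulr_ge0 ?cabs_ge0 ?expR_ge0 ?addr_ge0 ?expR_ge0 ?exprn_ge0.
Qed.

(** The Laplacian multiplies each term by the factor of [cosh_cos_bound] at |l_j| h. That factor is
    even, which allows |l_j| in place of l_j and so a nonnegative argument. *)
Let four_point x y h : 0 <= x <= 1 -> 0 <= h -> (forall j, `|l j| * h <= 1) ->
  cabs (exp_sum (x + h) y + exp_sum (x - h) y + exp_sum x (y + h) +
        exp_sum x (y - h) - 4%:R * exp_sum x y) <= K * h ^+ 3.
Proof.
move=> x01 h0 lh.
rewrite /exp_sum -!big_split/= mulr_sumr -sumrB mulr_suml.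
apply: le_trans (cabs_sum _ _ _) _; apply: ler_sum => j _.
have -> : c j * (expR (l j * (x + h)))%:C * expi_val (l j * y) +
   c j * (expR (l j * (x - h)))%:C * expi_val (l j * y) +
   c j * (expR (l j * x))%:C * expi_val (l j * (y + h)) +
   c j * (expR (l j * x))%:C * expi_val (l j * (y - h)) -
   4%:R * (c j * (expR (l j * x))%:C * expi_val (l j * y)) =
   (c j * (expR (l j * x))%:C * expi_val (l j * y)) *
   (expR (`|l j| * h) + expR (- (`|l j| * h)) + 2 * cos (`|l j| * h) - 4)%:C.
  have -> : expR (`|l j| * h) + expR (- (`|l j| * h)) = expR (l j * h) + expR (- (l j * h)).
    have [l0|l0] := leP 0 (l j); first by rewrite ger0_norm.
    by rewrite ltr0_norm// mulNr opprK addrC.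
  have -> : cos (`|l j| * h) = cos (l j * h).
    have [l0|l0] := leP 0 (l j); first by rewrite ger0_norm.
    by rewrite ltr0_norm// mulNr cosN.
  rewrite !mulrDr !mulrN !expRD !expi_valD !rmorphB !rmorphD/= !rmorphM/=.
  have -> : (2%:C * (cos (l j * h))%:C)%C = expi_val (l j * h) + expi_val (- (l j * h)) :> R[i].
    rewrite /expi_val cosN sinN; apply/eqP; rewrite eq_complex /=.
    by rewrite !mul0r !mulr0 subr0 addr0 subrr eqxx andbT mulr2n mulrDl !mul1r.
  by rewrite !rmorph1; ring.
rewrite cabsM cabs_real -[leRHS]mulrA; apply: ler_pM; rewrite ?cabs_ge0 ?normr_ge0//.
  exact: term_le.
rewrite -mulrA -exprMn; apply: cosh_cos_bound.
by rewrite mulr_ge0//=.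
Qed.

Let u x y := cabs (exp_sum x y) ^+ 2.

(** The four-point estimate gives 4|F| - K h^3 <= |F1| + |F2| + |F3| + |F4|. Squaring, with
    Cauchy-Schwarz on the right and |F| <= S in the cross term, passes to squares. If K h^3 exceeds
    4|F|, the left-hand side is already nonpositive. *)
Let subharmonic x y h : 0 <= x <= 1 -> 0 <= h -> (forall j, `|l j| * h <= 1) ->
  4 * u x y - 2 * S * K * h ^+ 3 <=
  u (x + h) y + u (x - h) y + u x (y + h) + u x (y - h).
Proof.
move=> x01 h0 lh; have := four_point y x01 h0 lh; have := exp_sum_le y x01.
rewrite /u; set F := exp_sum x y.
set F1 := exp_sum (x + h) y; set F2 := exp_sum (x - h) y.
set F3 := exp_sum x (y + h); set F4 := exp_sum x (y - h).
move=> FS FK.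
have : 4 * cabs F <= K * h ^+ 3 + (cabs F1 + cabs F2 + cabs F3 + cabs F4).
  have -> : 4 * cabs F = cabs (4%:R * F).
    by rewrite cabsM; congr (_ * _); rewrite -(rmorph_nat (real_complex R)) cabs_real ger0_norm.
  have {1}-> : 4%:R * F = (4%:R * F - (F1 + F2 + F3 + F4)) + (F1 + F2 + F3 + F4) by ring.
  apply: le_trans (cabsD _ _) _; apply: lerD; first by rewrite cabsB.
  by rewrite (le_trans (cabsD _ _))// lerD// (le_trans (cabsD _ _))// lerD// cabsD.
have := cabs_ge0 F; have := cabs_ge0 F1; have := cabs_ge0 F2; have := cabs_ge0 F3; have := cabs_ge0 F4.
have : 0 <= K * h ^+ 3 by rewrite mulr_ge0// exprn_ge0.
rewrite -mulrA; move: (K * h ^+ 3) (cabs F) (cabs F1) (cabs F2) (cabs F3) (cabs F4) FS => k f f1 f2 f3 f4.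
move=> fS k0 p4 p3 p2 p1 f0 le4.
have sq : (f1 + f2 + f3 + f4) ^+ 2 <= 4 * (f1 ^+ 2 + f2 ^+ 2 + f3 ^+ 2 + f4 ^+ 2).
  have := sqr_ge0 (f1 - f2); have := sqr_ge0 (f1 - f3); have := sqr_ge0 (f1 - f4).
  have := sqr_ge0 (f2 - f3); have := sqr_ge0 (f2 - f4); have := sqr_ge0 (f3 - f4).
  nra.
have fk : f * k <= S * k by rewrite ler_wpM2r.
have [kf|kf] := leP k (4 * f); last by nra.
have : (4 * f - k) ^+ 2 <= (f1 + f2 + f3 + f4) ^+ 2.
  by rewrite lerXn2r ?nnegrE; lra.
nra.
Qed.

(* A maximum principle on a grid of mesh h replaces complex analysis: the four
   point Laplacian of |exp_sum|^2 is at least - 2 S K h^3, so adding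
   e x^2 - (e / 2) y^2 makes it positive, and the y-term keeps the far ends of
   the strip below the bound. *)
Let grid_bound (M e h : R) (N : nat) : 0 <= M -> 0 < e -> (0 < N)%N -> h = N%:R^-1 ->
  (forall j, `|l j| * h <= 1) -> 2 * S * K * h < e ->
  (forall y, cabs (exp_sum 0 y) <= M) -> (forall y, cabs (exp_sum 1 y) <= M) ->
  forall a, (a <= N)%N -> u (a%:R * h) 0 <= M ^+ 2 + e.
Proof.
move=> M0 e0 N0 hE lh hsmall F0 F1 a aN.
have Nr : 0 < N%:R :> R by rewrite ltr0n.
have h0 : 0 < h by rewrite hE invr_gt0.
have hN : N%:R * h = 1 by rewrite hE divff// gt_eqF.
(* The grid is made so high that the y-term outweighs the a priori bound [S ^+ 2] at both far ends;
   the inequality (1 + 2/e)^2 >= 2/e spares a square root in the choice of [L]. *)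
have [L Lh] : exists L : nat, S ^+ 2 <= e / 2 * (L%:R * h) ^+ 2.
  have [L SL] : exists L : nat, S / h * (1 + 2 / e) <= L%:R.
    by exists (Num.truncn (S / h * (1 + 2 / e))).+1; rewrite ltW// truncnS_gt.
  exists L.
  have e2 : 0 < 2 / e by rewrite divr_gt0.
  have : S * (1 + 2 / e) <= L%:R * h.
    by move: SL; rewrite mulrAC ler_pdivrMr.
  move=> SLh.
  have : (S * (1 + 2 / e)) ^+ 2 <= (L%:R * h) ^+ 2.
    by rewrite lerXn2r ?nnegrE ?mulr_ge0 ?(ltW h0) ?ler0n// addr_ge0 ?ltW.
  have -> : S ^+ 2 = e / 2 * (S ^+ 2 * (2 / e)) by field; rewrite gt_eqF.
  move=> H; rewrite ler_pM2l ?divr_gt0//; apply: le_trans H.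
  rewrite exprMn ler_wpM2l ?sqr_ge0//; nra.
(* Rows are numbered from 0 to [2 * L], and row [L] is the line y = 0. *)
pose X (a : nat) : R := a%:R * h; pose Y (b : nat) : R := (b%:R - L%:R) * h.
pose v a b := u (X a) (Y b) + e * X a ^+ 2 - e / 2 * Y b ^+ 2.
have X01 a' : (a' <= N)%N -> 0 <= X a' <= 1.
  move=> a'N; rewrite /X mulr_ge0 ?(ltW h0)//= -[leRHS]hN ler_wpM2r ?(ltW h0)//.
  by rewrite ler_nat.
have u_bd x y : cabs (exp_sum x y) <= M -> u x y <= M ^+ 2.
  by move=> FM; rewrite /u lerXn2r// nnegrE ?cabs_ge0.
have u_S x y : 0 <= x <= 1 -> u x y <= S ^+ 2.
  by move=> x01; rewrite /u lerXn2r// ?nnegrE ?cabs_ge0//; exact: exp_sum_le.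
have sq1 a' : (a' <= N)%N -> e * X a' ^+ 2 <= e.
  by move=> /X01/andP[x0 x1]; rewrite ler_piMr ?(ltW e0)// exprn_ile1.
have Y0 b : 0 <= e / 2 * Y b ^+ 2 by rewrite mulr_ge0 ?sqr_ge0// divr_ge0 ?(ltW e0).
suff vle : v a L <= M ^+ 2 + e.
  move: vle; rewrite /v /Y subrr mul0r expr0n/= mulr0 subr0 => vle.
  apply: le_trans vle; rewrite lerDl mulr_ge0 ?sqr_ge0// ltW//.
apply: (@grid_max_principle _ v N (2 * L)%N) => //; last by rewrite leq_pmull.
- move=> b; rewrite /v /X mul0r expr0n/= mulr0 addr0.
  by have := u_bd _ _ (F0 (Y b)); have := Y0 b; lra.
- move=> b; rewrite /v /X hN expr1n mulr1.
  by have := u_bd _ _ (F1 (Y b)); have := Y0 b; lra.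
- move=> a' a'N; rewrite /v.
  have -> : Y 0%N ^+ 2 = (L%:R * h) ^+ 2 by rewrite /Y sub0r mulNr sqrrN.
  by have := u_S _ (Y 0%N) (X01 _ a'N); have := sq1 _ a'N; have := sqr_ge0 M; lra.
- move=> a' a'N; rewrite /v.
  have -> : Y (2 * L)%N ^+ 2 = (L%:R * h) ^+ 2.
    by rewrite /Y mul2n -addnn natrD addrK.
  by have := u_S _ (Y (2 * L)%N) (X01 _ a'N); have := sq1 _ a'N; have := sqr_ge0 M; lra.
move=> a' b a'N bL.
have := subharmonic (Y b.+1) (X01 _ (ltnW a'N)) (ltW h0) lh.
have -> : X a'.+1 + h = X a'.+2 by rewrite /X -[in RHS]addn1 natrD mulrDl mul1r.
have -> : X a'.+1 - h = X a' by rewrite /X -[in LHS]addn1 natrD mulrDl mul1r addrK.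
have -> : Y b.+1 + h = Y b.+2 by rewrite /Y -[b.+2]addn1 natrD; ring.
have -> : Y b.+1 - h = Y b by rewrite /Y -[b.+1]addn1 natrD; ring.
have -> : X a'.+1 = X a' + h by rewrite /X -[in LHS]addn1 natrD mulrDl mul1r.
have -> : X a'.+2 = X a' + 2 * h by rewrite /X -addn2 natrD mulrDl.
rewrite /v.
have -> : X a'.+1 = X a' + h by rewrite /X -[in LHS]addn1 natrD mulrDl mul1r.
have -> : X a'.+2 = X a' + 2 * h by rewrite /X -addn2 natrD mulrDl.
have YS : Y b.+1 = Y b + h by rewrite /Y -[b.+1]addn1 natrD; ring.
have YSS : Y b.+2 = Y b + 2 * h by rewrite /Y -addn2 natrD; ring.
(* The discrete Laplacian of e x^2 - (e/2) y^2 is 2 e h^2 - e h^2 = e h^2, and this exceeds the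
   defect of subharmonicity. *)
have : 2 * S * K * h ^+ 3 < e * h ^+ 2.
  by rewrite exprS mulrA ltr_pM2r ?exprn_gt0.
move: (u _ _) (u _ _) (u _ _) (u _ _) (u _ _) => u0 u1 u2 u3 u4.
rewrite YS YSS.
nra.
Qed.

Lemma three_lines (M : R) :
  (forall y, cabs (exp_sum 0 y) <= M) -> (forall y, cabs (exp_sum 1 y) <= M) ->
  forall x, 0 <= x <= 1 -> cabs (exp_sum x 0) <= M.
Proof.
move=> F0 F1 x /andP[x0 x1].
have M0 : 0 <= M by apply: le_trans (F0 0); exact: cabs_ge0.
suff uM : u x 0 <= M ^+ 2 by rewrite -ler_sqr ?nnegrE ?cabs_ge0.
apply/ler_addgt0Pr => e e0.
have nearSinv (d : R) : 0 < d -> \forall n \near \oo, (n.+1%:R : R)^-1 <= d.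
  move=> d0; near=> n; apply: ltW.
  by near: n; have := @near_infty_natSinv_lt R (PosNum d0).
pose L := 1 + \sum_j `|l j|.
have L0 : 0 < L by rewrite ltr_pwDl// sumr_ge0.
have SK0 : 0 <= 2 * S * K by rewrite !mulr_ge0.
have SK1 : 0 < 2 * S * K + 1 by rewrite ltr_wpDl.
(* [grid_bound] only sees multiples of the mesh. For the mesh 1/(n+1), [s n] is the largest multiple
   not exceeding [x], and continuity of [u] along y = 0 transfers the bound to [x]. *)
pose s (n : nat) : R := (Num.truncn (x * n.+1%:R))%:R / n.+1%:R.
have sx : s n @[n --> \oo] --> x.
  apply/cvgrPdist_le => d d0.
  near=> n.
  have n0 : 0 < n.+1%:R :> R by rewrite ltr0n.
  have xn0 : 0 <= x * n.+1%:R by rewrite mulr_ge0.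
  have /andP[t1 t2] := truncn_itv xn0.
  rewrite ger0_norm; last by rewrite subr_ge0 /s ler_pdivrMr.
  rewrite /s lerBlDr -(ler_pM2r n0) mulrDl divfK ?gt_eqF//.
  apply: le_trans (ltW t2) _; rewrite -addn1 natrD addrC lerD2r.
  rewrite -ler_pdivrMr// div1r.
  by near: n; exact: nearSinv.
have uc : continuous (fun x => u x 0).
  have -> : (fun x => u x 0) = (fun x =>
      (\sum_j complex.Re (c j) * expR (l j * x)) * (\sum_j complex.Re (c j) * expR (l j * x)) +
      (\sum_j complex.Im (c j) * expR (l j * x)) * (\sum_j complex.Im (c j) * expR (l j * x))).
    apply/funext => z; rewrite /u sqr_cabs /exp_sum !raddf_sum -!expr2.
    by congr (_ ^+ 2 + _ ^+ 2); apply: eq_bigr => j _;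
      rewrite mulr0 expi_val0 mulr1; case: (c j) => a b /=; rewrite ?mulr0 ?subr0 ?add0r.
  have sumc (d : I -> R) : continuous (fun x => \sum_j d j * expR (l j * x)).
    move=> z; apply: cvg_big => [|j _]; first exact: add_continuous.
    apply: cvgMl_tmp; apply: (@continuous_comp _ _ _ (fun x => l j * x) expR).
      exact: mulrl_continuous.
    exact: continuous_expR.
  by move=> z; apply: cvgD; apply: cvgM; exact: sumc.
have us : u (s n) 0 @[n --> \oo] --> u x 0 by exact: (cvg_comp _ _ sx (uc x)).
apply: (ler_cvg_to us (cvg_cst _)).
near=> n.
have n0 : 0 < n.+1%:R :> R by rewrite ltr0n.
apply: (@grid_bound M e (n.+1%:R^-1) n.+1) => //.
- move=> j; apply: (@le_trans _ _ (L * n.+1%:R^-1)).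
    by rewrite ler_wpM2r ?invr_ge0// /L (bigD1 j)//= addrCA lerDl addr_ge0// sumr_ge0.
  rewrite -ler_pdivlMl// mulr1.
  by near: n; apply: nearSinv; rewrite invr_gt0.
- apply: (@le_lt_trans _ _ ((2 * S * K) * (e / (2 * S * K + 1)))).
    rewrite ler_wpM2l//; near: n; apply: nearSinv.
    by rewrite divr_gt0.
  by rewrite mulrCA gtr_pMr// ltr_pdivrMr// mul1r ltrDl.
rewrite -(ler_nat R).
have xn0 : 0 <= x * n.+1%:R by rewrite mulr_ge0.
have /andP[t1 t2] := truncn_itv xn0.
by apply: le_trans t1 _; rewrite ler_piMl.
Unshelve. all: by end_near. Qed.

End three_lines.

Lemma cabs_twist (R : realType) (z : R[i]) (u v : R) :
  cabs (z * (expR u)%:C * expi_val v) = cabs z * expR u.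
Proof. by rewrite !cabsM cabs_expi mulr1 cabs_real ger0_norm ?expR_ge0. Qed.

Lemma cabs_conj_mul (R : realType) (z : R[i]) (u : R) : 0 <= u ->
  cabs (z^*%C * u%:C) = cabs z * u.
Proof. by move=> u0; rewrite cabsM cabsJ cabs_real ger0_norm. Qed.

(** * Riesz-Thorin interpolation of the inner exponent *)

Section power_weights.
Variables (R : realType) (K : finType) (v : K -> R) (s : R).
Hypotheses (s_gt0 : 0 < s) (v_ge0 : forall k, 0 <= v k).

Let lsn := (\sum_k v k `^ s) `^ s^-1.

Let sum_ge0 : 0 <= \sum_k v k `^ s.
Proof. by apply: sumr_ge0 => k _; exact: powR_ge0. Qed.

Lemma lsn_powR : lsn `^ s = \sum_k v k `^ s.
Proof. by rewrite -powRrM mulVf ?gt_eqF// powRr1. Qed.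

Lemma lsn_gt0 k : 0 < v k -> 0 < lsn.
Proof.
move=> vk; rewrite powR_gt0// (bigD1 k)//= ltr_pwDl ?powR_gt0//.
by apply: sumr_ge0 => i _; exact: powR_ge0.
Qed.

Lemma lsn_eq0 : lsn = 0 -> forall k, v k = 0.
Proof.
move=> l0 k; apply/eqP/negPn/negP => vk0.
have : 0 < v k by rewrite lt_neqAle eq_sym vk0 v_ge0.
by move=> /lsn_gt0; rewrite l0 ltxx.
Qed.

Let powRE (x a : R) : 0 < x -> x `^ a = expR (a * ln x).
Proof. by move=> x0; rewrite /powR gt_eqF. Qed.

(** The weight is (v_k / lsn)^(s/r - 1): it turns a vector of l^s norm [lsn] into one whose l^r norm
    is the same number. It is written with [expR] and [ln] so that its exponent can later move in
    the strip; the value of [ln] at 0 is multiplied by [v k = 0]. *)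
Lemma sum_power_weight (r : R) : 0 < r ->
  \sum_k (v k * expR ((s / r - 1) * ln (v k / lsn))) `^ r = lsn `^ r.
Proof.
move=> r0; have [l0|l0] := eqVneq lsn 0.
  rewrite l0 powR0 ?gt_eqF// big1// => k _.
  by rewrite (lsn_eq0 l0) mul0r powR0// gt_eqF.
have lp : 0 < lsn by rewrite lt_neqAle eq_sym l0 powR_ge0.
transitivity (\sum_k v k `^ s * lsn `^ (r - s)).
  apply: eq_bigr => k _.
  have [vk|vk] := leP (v k) 0.
    have -> : v k = 0 by apply/eqP; rewrite eq_le vk v_ge0.
    by rewrite mul0r !powR0 ?gt_eqF// mul0r.
  rewrite ln_div ?posrE// !powRE ?mulr_gt0 ?expR_gt0// -expRD.
  rewrite lnM ?posrE ?expR_gt0// expRK; congr expR; field.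
  by rewrite gt_eqF.
by rewrite -mulr_suml -lsn_powR -powRD ?l0 ?implybT// addrC subrK.
Qed.

(** The entries v_k^(s-1) lsn^(p-s) are the moduli of the functional that norms v. Under the weight
    opposite to that of [sum_power_weight] their l^r' norm is lsn^(p-1), because s (1 - 1/r) r' =
    s. *)
Lemma sum_dual_power_weight (p r r' : R) : 1 < p -> 0 < r -> 0 < r' ->
  r^-1 + r'^-1 = 1 ->
  \sum_k (v k * (v k `^ (s - 2) * lsn `^ (p - s)) *
          expR (- (s / r - 1) * ln (v k / lsn))) `^ r' =
  lsn `^ ((p - 1) * r').
Proof.
move=> p1 r0 r'0 rr'; have [l0|l0] := eqVneq lsn 0.
  rewrite l0 [RHS]powR0; last by rewrite gt_eqF// mulr_gt0// subr_gt0.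
  rewrite big1// => k _.
  by rewrite (lsn_eq0 l0) !mul0r powR0// gt_eqF.
have lp : 0 < lsn by rewrite lt_neqAle eq_sym l0 powR_ge0.
have rE : r^-1 = 1 - r'^-1 by rewrite -rr' addrK.
move: lp l0 lsn_powR; move: lsn => L lp l0 LE.
transitivity (\sum_k v k `^ s * L `^ ((p - 1) * r' - s)).
  apply: eq_bigr => k _.
  have [vk|vk] := leP (v k) 0.
    have -> : v k = 0 by apply/eqP; rewrite eq_le vk v_ge0.
    by rewrite !mul0r !powR0 ?gt_eqF// mul0r.
  rewrite ln_div ?posrE// [RHS]mulrC rE.
  rewrite [LHS]powRE; last by rewrite !mulr_gt0 ?expR_gt0 ?powR_gt0.
  rewrite !lnM ?posrE ?mulr_gt0 ?expR_gt0 ?powR_gt0// expRK !ln_powR.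
  rewrite !powRE// -expRD; congr expR; field.
  by rewrite gt_eqF.
rewrite -mulr_suml -LE -powRD; last by rewrite l0 implybT.
by rewrite addrC subrK.
Qed.

Lemma sum_dual_pairing (p : R) : 0 < p ->
  lsn `^ p = \sum_k v k ^+ 2 * (v k `^ (s - 2) * lsn `^ (p - s)).
Proof.
move=> p0; have [l0|l0] := eqVneq lsn 0.
  rewrite l0 [LHS]powR0 ?gt_eqF// big1// => k _.
  by rewrite (lsn_eq0 l0) expr0n mul0r.
have lp : 0 < lsn by rewrite lt_neqAle eq_sym l0 powR_ge0.
transitivity (\sum_k v k `^ s * lsn `^ (p - s)).
  by rewrite -mulr_suml -lsn_powR -powRD ?l0 ?implybT// addrC subrK.
apply: eq_bigr => k _; rewrite mulrA; congr (_ * _).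
have [vk|vk] := leP (v k) 0.
  have -> : v k = 0 by apply/eqP; rewrite eq_le vk v_ge0.
  by rewrite expr0n mul0r powR0// gt_eqF.
by rewrite -powR_mulrn// -powRD ?(gt_eqF vk) ?implybT// addrC subrK.
Qed.

End power_weights.

Section mixed_norm.
Variables (R : realType) (K : finType) (p : R).

(** The p-th power of the norm of L^p(w; l^s). The outer exponent stays fixed throughout the
    interpolation. *)
Definition mixed (J : finType) (s : R) (w : J -> R) (a : K -> J -> R[i]) : R :=
  \sum_j w j * (\sum_k cabs (a k j) `^ s) `^ (p / s).

Lemma mixed_ge0 (J : finType) s w a : (forall j : J, 0 <= w j) -> 0 <= mixed s w a.
Proof. by move=> w0; apply: sumr_ge0 => j _; rewrite mulr_ge0 ?powR_ge0. Qed.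

Lemma mixed_lsn (J : finType) s w (a : K -> J -> R[i]) :
  mixed s w a = \sum_j w j * ((\sum_k cabs (a k j) `^ s) `^ s^-1) `^ p.
Proof. by apply: eq_bigr => j _; rewrite -powRrM [_^-1 * _]mulrC. Qed.

(** Hoelder's inequality in k with exponents r, r' at each point j, then in j with exponents p,
    p'. *)
Lemma mixed_hoelder (J : finType) (w : J -> R) (a b : K -> J -> R[i]) (p' r r' : R) :
  1 < p -> p^-1 + p'^-1 = 1 -> 0 < p' -> 0 < r -> 0 < r' -> r^-1 + r'^-1 = 1 ->
  (forall j, 0 <= w j) ->
  cabs (\sum_j \sum_k (w j)%:C * (a k j * b k j)) <=
  mixed r w a `^ p^-1 *
  (\sum_j w j * (\sum_k cabs (b k j) `^ r') `^ (p' / r')) `^ p'^-1.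
Proof.
move=> p1 pp' p'0 r0 r'0 rr' w0.
have p0 : 0 < p by exact: lt_trans p1.
apply: le_trans (cabs_sum _ _ _) _.
apply: (@le_trans _ _ (\sum_j w j * ((\sum_k cabs (a k j) `^ r) `^ r^-1 *
   (\sum_k cabs (b k j) `^ r') `^ r'^-1))).
  apply: ler_sum => j _; apply: le_trans (cabs_sum _ _ _) _.
  under eq_bigr do rewrite !cabsM cabs_real (ger0_norm (w0 _)).
  rewrite -mulr_sumr ler_wpM2l//.
  have := @hoelder_sum R K (fun=> 1) (fun k => cabs (a k j)) (fun k => cabs (b k j)) r r'
    r0 r'0 rr' (fun=> ler01) (fun k => cabs_ge0 _) (fun k => cabs_ge0 _).
  by under eq_bigr do rewrite mul1r; under [X in _ <= X `^ _ * _]eq_bigr do rewrite mul1r;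
    under [X in _ <= _ * X `^ _]eq_bigr do rewrite mul1r.
apply: le_trans (hoelder_sum p0 p'0 pp' w0 _ _) _; try by move=> j; exact: powR_ge0.
rewrite mixed_lsn le_eqVlt; apply/orP; left; apply/eqP.
congr (_ * _ `^ _); apply: eq_bigr => j _.
by rewrite -powRrM [_^-1 * _]mulrC.
Qed.

End mixed_norm.

Section riesz_thorin.
Variables (R : realType) (I J K : finType) (p C : R) (w : I -> R) (w' : J -> R).
Variable A : J -> I -> R[i].
Hypothesis p_gt1 : 1 < p.
Hypotheses (w_ge0 : forall i, 0 <= w i) (w'_ge0 : forall j, 0 <= w' j).

Definition mx_act (a : K -> I -> R[i]) k j : R[i] := \sum_i A j i * a k i.

Definition mixed_bound (s : R) : Prop := forall a : K -> I -> R[i],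
  mixed p s w' (mx_act a) <= C `^ p * mixed p s w a.

(** This is the estimate on one edge of the strip: [a] and [g] stand for the deformed input and the
    deformed norming functional, whose inner norms there are [al] and be^(p-1). As (p-1) p' = p, the
    factor of [g] becomes a power of the sum of the be_j^p. *)
Lemma mixed_duality (p' r r' : R) (a : K -> I -> R[i]) (g : K -> J -> R[i]) al be :
  0 < r -> 0 < r' -> r^-1 + r'^-1 = 1 -> 0 < p' -> p^-1 + p'^-1 = 1 ->
  mixed_bound r ->
  (forall i, 0 <= al i) -> (forall j, 0 <= be j) ->
  (forall i, \sum_k cabs (a k i) `^ r = al i `^ r) ->
  (forall j, \sum_k cabs (g k j) `^ r' = be j `^ ((p - 1) * r')) ->
  cabs (\sum_j \sum_k (w' j)%:C * (mx_act a k j * g k j)) <=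
  (C `^ p * \sum_i w i * al i `^ p) `^ p^-1 * (\sum_j w' j * be j `^ p) `^ p'^-1.
Proof.
move=> r0 r'0 rr' p'0 pp' bound al0 be0 aE gE.
have p0 : 0 < p by exact: lt_trans p_gt1.
apply: le_trans (mixed_hoelder _ _ p_gt1 pp' p'0 r0 r'0 rr' w'_ge0) _.
apply: ler_pM; [exact: powR_ge0|exact: powR_ge0| |].
  apply: ge0_ler_powR.
  - by rewrite invr_ge0 ltW.
  - by rewrite nnegrE mixed_ge0.
  - rewrite nnegrE mulr_ge0 ?powR_ge0// sumr_ge0// => i _.
    by rewrite mulr_ge0 ?powR_ge0.
  apply: le_trans (bound _) _; rewrite ler_wpM2l ?powR_ge0//.
  rewrite /mixed; apply: ler_sum => i _; rewrite aE ler_wpM2l// -powRrM mulrC.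
  by rewrite divfK ?gt_eqF.
rewrite le_eqVlt; apply/orP; left; apply/eqP; congr (_ `^ _).
apply: eq_bigr => j _; rewrite gE -powRrM; congr (_ * _ `^ _).
have p'E : p' = p / (p - 1).
  by apply: invr_inj; rewrite invf_div -[LHS](addKr p^-1) pp'; field; rewrite gt_eqF.
by rewrite p'E; field; rewrite subr_eq0 !gt_eqF.
Qed.

(** The image of [a], paired with its norming functional, is one value of an analytic function on
    the strip. The input and the functional are deformed in opposite senses, by powers of their
    normalised entries, so that on the two edges the bounds for [r0] and [r1] apply. *)
Lemma riesz_thorin (r0 r1 s t : R) : 1 < r0 -> 1 < r1 -> 1 < s -> 0 <= t <= 1 ->
  s^-1 = (1 - t) * r0^-1 + t * r1^-1 ->
  mixed_bound r0 -> mixed_bound r1 -> mixed_bound s.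
Proof.
move=> r0_gt1 r1_gt1 s_gt1 t01 sE bound0 bound1 a.
have p0 : 0 < p by exact: lt_trans p_gt1.
have s0 : 0 < s by exact: lt_trans s_gt1.
pose p' := p / (p - 1).
have p'0 : 0 < p' by rewrite divr_gt0 ?subr_gt0.
have pp' : p^-1 + p'^-1 = 1.
  by rewrite invf_div; field; rewrite gt_eqF.
pose b := mx_act a.
pose al i := (\sum_k cabs (a k i) `^ s) `^ s^-1.
pose be j := (\sum_k cabs (b k j) `^ s) `^ s^-1.
pose g k j : R[i] := (b k j)^*%C * (cabs (b k j) `^ (s - 2) * be j `^ (p - s))%:C.
(* The slope that makes the exponent [D * (x - t)] equal to s/r0 - 1 at x = 0 and to s/r1 - 1 at x =
   1. *)
pose D := s * (r1^-1 - r0^-1).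
pose la k i := D * ln (cabs (a k i) / al i).
pose mu k j := - D * ln (cabs (b k j) / be j).
(* The shift by [t] is absorbed into the coefficients, which leaves an exponential sum with
   frequencies [l]. *)
pose c (x : J * (K * I)) : R[i] := (w' x.1)%:C * (A x.1 x.2.2 * a x.2.1 x.2.2 * g x.2.1 x.1) *
  (expR (- (la x.2.1 x.2.2 + mu x.2.1 x.1) * t))%:C.
pose l (x : J * (K * I)) := la x.2.1 x.2.2 + mu x.2.1 x.1.
pose W := mixed p s w a.
pose B := \sum_j w' j * be j `^ p.
have W0 : 0 <= W by exact: mixed_ge0.
have B0 : 0 <= B by apply: sumr_ge0 => j _; rewrite mulr_ge0 ?powR_ge0.
have BE : mixed p s w' b = B by rewrite mixed_lsn.
pose az x y k i : R[i] := a k i * (expR (la k i * (x - t)))%:C * expi_val (la k i * y).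
pose gz x y k j : R[i] := g k j * (expR (mu k j * (x - t)))%:C * expi_val (mu k j * y).
have Fz x y : exp_sum c l x y = \sum_j \sum_k (w' j)%:C * (mx_act (az x y) k j * gz x y k j).
  rewrite /exp_sum; transitivity (\sum_j \sum_(ki : K * I) c (j, ki) *
    (expR (l (j, ki) * x))%:C * expi_val (l (j, ki) * y)).
    by rewrite pair_big/=; apply: eq_bigr => -[].
  apply: eq_bigr => j _; transitivity (\sum_k \sum_i c (j, (k, i)) *
    (expR (l (j, (k, i)) * x))%:C * expi_val (l (j, (k, i)) * y)).
    by rewrite pair_big/=; apply: eq_bigr => -[].
  apply: eq_bigr => k _; rewrite /mx_act mulr_suml mulr_sumr; apply: eq_bigr => i _.
  rewrite /c /l /az /gz /=; move: (la k i) (mu k j) (g k j) (a k i) (A j i) => u v G a0 A0.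
  have -> : expi_val ((u + v) * y) = expi_val (u * y) * expi_val (v * y).
    by rewrite mulrDl expi_valD.
  have -> : expR (- (u + v) * t) = expR (- (u * t)) * expR (- (v * t)).
    by rewrite -expRD; congr expR; ring.
  have -> : expR ((u + v) * x) = expR (u * x) * expR (v * x).
    by rewrite -expRD mulrDl.
  have -> : expR (u * (x - t)) = expR (u * x) * expR (- (u * t)).
    by rewrite -expRD mulrBr.
  have -> : expR (v * (x - t)) = expR (v * x) * expR (- (v * t)).
    by rewrite -expRD mulrBr.
  rewrite !rmorphM/=.
  move: (expR (u * x)) (expR (v * x)) (expR (- (u * t))) (expR (- (v * t))) => e1 e2 e3 e4.
  move: (expi_val _) (expi_val _) => f1 f2.
  move: e1%:C e2%:C e3%:C e4%:C (w' j)%:C => {}e1 {}e2 {}e3 {}e4 w0.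
  ring.
(* At x = t, y = 0 both deformations are trivial, and [b] meets its own norming functional. *)
have Ft : exp_sum c l t 0 = B%:C.
  rewrite Fz rmorph_sum/=; apply: eq_bigr => j _.
  rewrite -mulr_sumr rmorphM/=; congr (_ * _).
  have -> : mx_act (az t 0) = b.
    apply/funext => k; apply/funext => j'; apply: eq_bigr => i _; congr (_ * _).
    by rewrite /az subrr !mulr0 expR0 expi_val0 !mulr1.
  rewrite (@sum_dual_pairing _ _ (fun k => cabs (b k j)) s s0 (fun k => cabs_ge0 _) p p0).
  rewrite rmorph_sum; apply: eq_bigr => k _.
  rewrite /gz subrr !mulr0 expR0 expi_val0 !mulr1 /g mulrA conjC_mul_cabs.
  by rewrite -rmorphM.
(* Along a vertical line the deformation changes only by phases, so one estimate serves for all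
   [y]. *)
have endpoint (r x y : R) : 1 < r -> D * (x - t) = s / r - 1 -> mixed_bound r ->
    cabs (exp_sum c l x y) <= (C `^ p * W) `^ p^-1 * B `^ p'^-1.
  move=> r_gt1 Dx bound; have rp : 0 < r by exact: lt_trans r_gt1.
  pose r' := r / (r - 1).
  have r'0 : 0 < r' by rewrite divr_gt0 ?subr_gt0.
  have rr' : r^-1 + r'^-1 = 1.
    by rewrite invf_div -[X in X + _]mul1r -mulrDl [1 + _]addrC subrK divff// gt_eqF.
  have WE : W = \sum_i w i * al i `^ p by exact: mixed_lsn.
  rewrite Fz WE; apply: (mixed_duality rp r'0 rr' p'0 pp' bound) => [i|j|i|j].
  - exact: powR_ge0.
  - exact: powR_ge0.
  - rewrite -(sum_power_weight s0 (fun k => cabs_ge0 (a k i)) rp); apply: eq_bigr => k _.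
    by rewrite /az cabs_twist -Dx /la mulrAC.
  - rewrite -(sum_dual_power_weight s0 (fun k => cabs_ge0 (b k j)) p_gt1 rp r'0 rr').
    apply: eq_bigr => k _.
    rewrite /gz cabs_twist /g cabs_conj_mul; last by rewrite mulr_ge0 ?powR_ge0.
    by rewrite -Dx -mulNr /mu [- D * _ * (x - t)]mulrAC.
have sE' : s / s = (1 - t) * (s / r0) + t * (s / r1).
  by rewrite sE mulrDr !mulrA [s * (1 - t)]mulrC [s * t]mulrC.
rewrite divff ?gt_eqF// in sE'.
have t0 : D * (0 - t) = s / r0 - 1 by rewrite [X in _ = _ - X]sE' /D; ring.
have t1 : D * (1 - t) = s / r1 - 1 by rewrite [X in _ = _ - X]sE' /D; ring.
have := @three_lines R _ c l _ (fun y => endpoint _ _ y r0_gt1 t0 bound0)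
  (fun y => endpoint _ _ y r1_gt1 t1 bound1) t t01.
rewrite Ft cabs_real ger0_norm// BE -/W.
(* What has been reached is B <= (C^p W)^(1/p) B^(1/p'). Division by B^(1/p'), for B nonzero, leaves
   B^(1/p) on the left. *)
move: B W B0 W0 {BE Ft endpoint} => B W B0 W0 BW.
have [->|B_neq0] := eqVneq B 0; first by rewrite mulr_ge0 ?powR_ge0.
have Bp : 0 < B by rewrite lt_neqAle eq_sym B_neq0.
have CW0 : 0 <= C `^ p * W by rewrite mulr_ge0 ?powR_ge0.
have : B `^ p^-1 <= (C `^ p * W) `^ p^-1.
  rewrite -(ler_pM2r (powR_gt0 p'^-1 Bp)) -powRD ?pp' ?powRr1//.
  by rewrite B_neq0 implybT.
move: (C `^ p * W) CW0 => {BW}X X0 BX.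
have := @ge0_ler_powR _ p (ltW p0) _ _ _ _ BX.
by rewrite -!powRrM mulVf ?gt_eqF// !powRr1//; apply; rewrite nnegrE powR_ge0.
Qed.

End riesz_thorin.

(** * Rotation invariance of Gaussian averages *)

Section lebesgue_shear.
Variable R : realType.
Local Notation RR := (measurableTypeR R).
Local Notation mu := (@lebesgue_measure R).
Implicit Types F : RR * RR -> \bar R.

Lemma lebesgue_measure_shift (a : R) (A : set R) : measurable A ->
  pushforward mu ((fun x => x + a) : RR -> RR) A = mu A.
Proof.
move=> mA.
have mf : measurable_fun setT ((fun x => x + a) : RR -> RR) by exact: measurable_funD.
pose f' : {mfun RR >-> RR} := HB.pack ((fun x => x + a) : RR -> RR)
   (isMeasurableFun.Build _ _ _ _ _ mf).
apply/esym/(@lebesgue_measure_unique R (pushforward mu f')) => //= _ [[b c]] _ <-.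
rewrite /pushforward.
have -> : (fun x : R => x + a) @^-1` `]b, c]%classic = `](b - a), (c - a)]%classic.
  by apply/seteqP; split => x /=; rewrite !in_itv/= ltrBlDr lerBrDr.
rewrite !lebesgue_measure_itv/= !lte_fin ltrD2r; case: ifPn => //.
by rewrite -!EFinD opprB addrA subrK.
Qed.

Lemma ge0_integral_shift (f : RR -> \bar R) (a : R) :
  measurable_fun setT f -> (forall x, 0 <= f x)%E ->
  (\int[mu]_x f (x + a)%R = \int[mu]_x f x)%E.
Proof.
move=> mf f0.
have ms : measurable_fun setT ((fun x => x + a) : RR -> RR) by exact: measurable_funD.
transitivity (\int[pushforward mu ((fun x => x + a)%R : RR -> RR)]_x f x)%E.
  by rewrite ge0_integral_pushforward.
apply: eq_measure_integral => A mA _; exact: lebesgue_measure_shift.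
Qed.

Definition iint F : \bar R := (\int[mu]_x \int[mu]_y F (x, y))%E.

Lemma iint_swap F : measurable_fun setT F -> (forall z, 0 <= F z)%E ->
  iint F = (\int[mu]_y \int[mu]_x F (x, y))%E.
Proof. by move=> mF F0; exact: (@fubini_tonelli _ _ _ _ _ mu mu F mF F0). Qed.

Let meas_shearl (t : R) : measurable_fun setT (fun z : RR * RR => (z.1 + t * z.2, z.2) : RR * RR).
Proof.
apply: measurable_fun_pair => //=; apply: measurable_funD => //.
by apply: measurable_funM.
Qed.

Let meas_shearr (t : R) : measurable_fun setT (fun z : RR * RR => (z.1, z.2 + t * z.1) : RR * RR).
Proof.
apply: measurable_fun_pair => //=; apply: measurable_funD => //.
by apply: measurable_funM.
Qed.

Lemma iint_shearl F (t : R) : measurable_fun setT F -> (forall z, 0 <= F z)%E ->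
  iint (fun z => F (z.1 + t * z.2, z.2)) = iint F.
Proof.
move=> mF F0; rewrite (iint_swap mF F0).
rewrite (iint_swap (measurableT_comp mF (meas_shearl t))); last by move=> z; exact: F0.
apply: eq_integral => y _; apply: (@ge0_integral_shift (fun x => F (x, y)) (t * y)) => //.
by apply: measurableT_comp mF _; exact: measurable_fun_pair.
Qed.

Lemma iint_shearr F (t : R) : measurable_fun setT F -> (forall z, 0 <= F z)%E ->
  iint (fun z => F (z.1, z.2 + t * z.1)) = iint F.
Proof.
move=> mF F0.
apply: eq_integral => x _; apply: (@ge0_integral_shift (fun y => F (x, y)) (t * x)) => //.
by apply: measurableT_comp mF _; exact: measurable_fun_pair.
Qed.

Definition rot (c s : R) (z : RR * RR) : RR * RR := (c * z.1 - s * z.2, s * z.1 + c * z.2).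

Lemma measurable_rot c s : measurable_fun setT (rot c s).
Proof.
by apply: measurable_fun_pair => //=; [apply: measurable_funB|apply: measurable_funD];
  apply: measurable_funM.
Qed.

(* A rotation of angle other than pi is a product of three shears. *)
Lemma iint_rot F c s : c ^+ 2 + s ^+ 2 = 1 ->
  measurable_fun setT F -> (forall z, 0 <= F z)%E -> iint (F \o rot c s) = iint F.
Proof.
have main F' c' s' : c' != -1 -> c' ^+ 2 + s' ^+ 2 = 1 ->
    measurable_fun setT F' -> (forall z, 0 <= F' z)%E ->
    iint (F' \o rot c' s') = iint F'.
  (* [t] is the tangent of half the angle; the three shears have parameters -t, s', -t. *)
  move=> cN1 cs mF F0; pose t := s' / (1 + c').
  have c1 : 1 + c' != 0 by rewrite addrC addr_eq0.
  have st : s' * t = 1 - c'.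
    apply: (mulIf c1); rewrite /t mulrA divfK// -expr2 -[s' ^+ 2](addKr (c' ^+ 2)) cs; ring.
  have tc : t * (1 + c') = s' by rewrite /t divfK.
  rewrite -(iint_shearl (- t) mF F0).
  have mF1 := measurableT_comp mF (meas_shearl (- t)).
  rewrite -(iint_shearr s' mF1); last by move=> z; exact: F0.
  have mF2 := measurableT_comp mF1 (meas_shearr s').
  rewrite -(iint_shearl (- t) mF2); last by move=> z; exact: F0.
  congr iint; apply/funext => -[x y] /=; congr F'; rewrite /rot/=.
  move: t st tc {mF1 mF2 c1} => t st tc.
  have cE : c' = 1 - s' * t by rewrite st; ring.
  congr pair; last by rewrite cE; ring.
  have -> : c' * x - s' * y = c' * x - (t * (1 + c')) * y by rewrite tc.
  by rewrite cE; ring.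
move=> cs mF F0; have [cN1|cN1] := eqVneq c (-1); last exact: main.
have s0 : s = 0.
  by apply/eqP; rewrite -sqrf_eq0 -(addKr (c ^+ 2) (s ^+ 2)) cs cN1 sqrrN expr1n addNr.
(* The remaining rotation is minus the identity, the square of a quarter turn. *)
have -> : F \o rot c s = (F \o rot 0 1) \o rot 0 1.
  by apply/funext => -[x y] /=; congr F; rewrite /rot/= cN1 s0; congr pair; ring.
have N01 : (0 : R) != -1 by rewrite eq_sym oppr_eq0 oner_eq0.
have cs01 : (0 : R) ^+ 2 + 1 ^+ 2 = 1 by rewrite expr0n expr1n add0r.
rewrite (main _ _ _ N01 cs01 (measurableT_comp mF (measurable_rot _ _))); last by move=> z; exact: F0.
exact: main.
Qed.

End lebesgue_shear.

(** * Averages over real and complex Gaussians *)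

Section gauss_smoothing.
Variable R : realType.
Local Notation RR := (measurableTypeR R).
Local Notation mu := (@lebesgue_measure R).
Local Notation phi := (@normal_pdf R 0 1).
Implicit Types (F G : RR * RR -> \bar R) (v w : RR * RR).

Let phi_ge0 x : 0 <= phi x. Proof. exact: normal_pdf_ge0. Qed.
Let mphi : measurable_fun setT (phi : RR -> R). Proof. exact: measurable_normal_pdf. Qed.

(** The expectation of F(w + x v) for a standard real Gaussian x. Averages are operators on
    functions of the plane, so that adding independent variables amounts to composing operators. *)
Definition gsmooth v F w : \bar R :=
  (\int[mu]_x (F ((w.1 + x * v.1)%R, (w.2 + x * v.2)%R) * (phi x)%:E))%E.

Lemma measurable_translate v w :
  measurable_fun setT (fun x : RR => (w.1 + x * v.1, w.2 + x * v.2) : RR * RR).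
Proof.
by apply: measurable_fun_pair => //=; apply: measurable_funD => //; apply: measurable_funM.
Qed.

Lemma gsmooth_ge0 v F w : (forall z, 0 <= F z)%E -> (0 <= gsmooth v F w)%E.
Proof. by move=> F0; apply: integral_ge0 => x _; rewrite mule_ge0// lee_fin phi_ge0. Qed.

Lemma measurable_gsmooth v F : measurable_fun setT F -> (forall z, 0 <= F z)%E ->
  measurable_fun setT (gsmooth v F).
Proof.
move=> mF F0.
apply: (@measurable_fun_fubini_tonelli_F _ _ _ _ _ mu (fun wx : (RR * RR) * RR =>
  (F ((wx.1.1 + wx.2 * v.1)%R, (wx.1.2 + wx.2 * v.2)%R) * (phi wx.2)%:E)%E)).
  apply: emeasurable_funM.
    apply: measurableT_comp mF _; apply: measurable_fun_pair => /=;
      apply: measurable_funD; try exact: measurable_funM;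
      exact: measurableT_comp.
  by apply/measurable_EFinP; exact: measurableT_comp.
by move=> x; rewrite mule_ge0// lee_fin phi_ge0.
Qed.

Lemma gsmooth2E v v' F w : measurable_fun setT F -> (forall z, 0 <= F z)%E ->
  gsmooth v (gsmooth v' F) w = iint (fun z : RR * RR =>
    (F ((w.1 + z.1 * v.1 + z.2 * v'.1)%R, (w.2 + z.1 * v.2 + z.2 * v'.2)%R) *
     (phi z.1 * phi z.2)%:E)%E).
Proof.
move=> mF F0; apply: eq_integral => x _; rewrite /gsmooth/= -ge0_integralZr//=.
- by apply: eq_integral => y _; rewrite -muleA -EFinM [phi y * _]mulrC.
- apply: emeasurable_funM; last exact/measurable_EFinP.
  exact: measurableT_comp mF (measurable_translate v' (w.1 + x * v.1, w.2 + x * v.2)).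
- by move=> y _; rewrite mule_ge0// lee_fin phi_ge0.
- by rewrite lee_fin phi_ge0.
Qed.

Lemma gsmooth2_measurable v v' F w : measurable_fun setT F ->
  measurable_fun setT (fun z : RR * RR =>
    (F ((w.1 + z.1 * v.1 + z.2 * v'.1)%R, (w.2 + z.1 * v.2 + z.2 * v'.2)%R) *
     (phi z.1 * phi z.2)%:E)%E).
Proof.
move=> mF; apply: emeasurable_funM; last first.
  by apply/measurable_EFinP; apply: measurable_funM; exact: measurableT_comp.
apply: measurableT_comp mF _; apply: measurable_fun_pair => /=;
  by apply: measurable_funD; [apply: measurable_funD => //|]; apply: measurable_funM.
Qed.

Lemma gsmoothC v v' F w : measurable_fun setT F -> (forall z, 0 <= F z)%E ->
  gsmooth v (gsmooth v' F) w = gsmooth v' (gsmooth v F) w.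
Proof.
move=> mF F0; rewrite (gsmooth2E _ _ _ mF F0) (gsmooth2E _ _ _ mF F0) iint_swap; last 2 first.
- exact: gsmooth2_measurable.
- by move=> z; rewrite mule_ge0// lee_fin mulr_ge0.
apply: eq_integral => y _; apply: eq_integral => x _ /=.
by rewrite [phi y * _]mulrC; congr (F (_, _) * _)%E; rewrite addrAC.
Qed.

Lemma normal_pdf01E x : phi x = normal_peak 1 * expR (- x ^+ 2 / 2).
Proof.
rewrite /normal_pdf oner_eq0; rewrite -[LHS]/(normal_peak 1 * normal_fun 0 1 x).
by rewrite /normal_fun subr0 expr1n.
Qed.

Lemma normal_pdf_rot c s (x y : R) : c ^+ 2 + s ^+ 2 = 1 ->
  phi (c * x - s * y) * phi (s * x + c * y) = phi x * phi y.
Proof.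
move=> cs; rewrite !normal_pdf01E [LHS]mulrACA [RHS]mulrACA -!expRD; congr (_ * expR _).
rewrite -!mulrDl; congr (_ / _).
transitivity (- (c ^+ 2 + s ^+ 2) * (x ^+ 2 + y ^+ 2)); first by ring.
by rewrite cs mulN1r opprD.
Qed.

(** The joint density of two independent standard Gaussians is rotation invariant. When [v] and [v']
    are parallel, a suitable rotation makes one of the two new directions 0. *)
Lemma gsmooth_rot c s v v' F w : c ^+ 2 + s ^+ 2 = 1 ->
  measurable_fun setT F -> (forall z, 0 <= F z)%E ->
  gsmooth (c * v.1 + s * v'.1, c * v.2 + s * v'.2)
    (gsmooth (- s * v.1 + c * v'.1, - s * v.2 + c * v'.2) F) w =
  gsmooth v (gsmooth v' F) w.
Proof.
move=> cs mF F0; rewrite (gsmooth2E _ _ _ mF F0) (gsmooth2E _ _ _ mF F0) -[RHS](iint_rot cs); last 2 first.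
- exact: gsmooth2_measurable.
- by move=> z; rewrite mule_ge0// lee_fin mulr_ge0.
congr iint; apply/funext => -[x y] /=; rewrite /rot/= normal_pdf_rot//.
by congr (F (_, _) * _)%E; ring.
Qed.

Lemma gsmooth_const v (r : \bar R) w : (0 <= r)%E -> gsmooth v (cst r) w = r.
Proof.
move=> r0; rewrite /gsmooth ge0_integralZl//=.
- by rewrite integral_normal_pdf mule1.
- exact/measurable_EFinP.
- by move=> x _; rewrite lee_fin.
Qed.

Lemma gsmooth0 F w : (forall z, 0 <= F z)%E -> gsmooth (0, 0) F w = F w.
Proof.
move=> F0; rewrite -[RHS](gsmooth_const (0, 0) w (F0 w)).
by apply: eq_integral => x _ /=; rewrite !mulr0 !addr0; case: w.
Qed.

Lemma eq_gsmooth v F G : F =1 G -> gsmooth v F =1 gsmooth v G.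
Proof. by move=> FG w; congr (gsmooth v _ w); apply/funext. Qed.

Definition toRR (a : R[i]) : RR * RR := (complex.Re a, complex.Im a).

(* The expectation of F (w + g a) for a standard complex Gaussian g = x + i y. *)
Definition cgsmooth (a : R[i]) F := gsmooth (toRR a) (gsmooth (toRR ('i * a)) F).

Lemma measurable_cgsmooth a F : measurable_fun setT F -> (forall z, 0 <= F z)%E ->
  measurable_fun setT (cgsmooth a F).
Proof.
move=> mF F0; apply: measurable_gsmooth; first exact: measurable_gsmooth.
by move=> z; exact: gsmooth_ge0.
Qed.

Lemma cgsmooth_ge0 a F w : (forall z, 0 <= F z)%E -> (0 <= cgsmooth a F w)%E.
Proof. by move=> F0; do 2 apply: gsmooth_ge0 => ?. Qed.

Lemma toRR_i a : toRR ('i * a) = (- complex.Im a, complex.Re a).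
Proof. by case: a => x y; rewrite /toRR/=; congr pair; ring. Qed.

Lemma cgsmooth_real (r : R) F w :
  cgsmooth r%:C F w = gsmooth (r, 0) (gsmooth (0, r) F) w.
Proof. by rewrite /cgsmooth toRR_i /= oppr0. Qed.

(** A complex Gaussian keeps its law when multiplied by a unimodular number: the rotation through
    the argument of a carries the directions |a|, i|a| to a, i a. *)
Lemma cgsmooth_cabs a F w : measurable_fun setT F -> (forall z, 0 <= F z)%E ->
  cgsmooth a F w = cgsmooth (cabs a)%:C F w.
Proof.
move=> mF F0; have [->|a0] := eqVneq a 0; first by rewrite cabs0.
have na0 : cabs a != 0 by rewrite cabs_eq0.
rewrite cgsmooth_real /cgsmooth toRR_i.
have cs : (complex.Re a / cabs a) ^+ 2 + (complex.Im a / cabs a) ^+ 2 = 1.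
  by rewrite !exprMn -mulrDl -sqr_cabs exprVn divff// expf_neq0.
rewrite -(gsmooth_rot (cabs a, 0) (0, cabs a) w cs mF F0)/=.
by rewrite !mulr0 !addr0 !add0r mulNr !divfK.
Qed.

(** Variances of independent Gaussians add. The real and the imaginary directions are merged
    separately. *)
Lemma cgsmooth_real_comp (r s : R) F w : measurable_fun setT F -> (forall z, 0 <= F z)%E ->
  cgsmooth r%:C (cgsmooth s%:C F) w = cgsmooth (Num.sqrt (r ^+ 2 + s ^+ 2))%:C F w.
Proof.
move=> mF F0; pose t := Num.sqrt (r ^+ 2 + s ^+ 2).
have t2 : t ^+ 2 = r ^+ 2 + s ^+ 2 by rewrite sqr_sqrtr// addr_ge0 ?sqr_ge0.
rewrite -/t; move: t t2 => t t2; have [t0|t0] := eqVneq t 0.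
  have : r ^+ 2 + s ^+ 2 == 0 by rewrite -t2 t0 expr0n.
  rewrite (paddr_eq0 (sqr_ge0 _) (sqr_ge0 _)) !sqrf_eq0 => /andP[/eqP -> /eqP ->].
  rewrite t0 {1}cgsmooth_real !gsmooth0// => z; first exact: cgsmooth_ge0.
  by rewrite gsmooth0 ?cgsmooth_ge0// => ?; exact: cgsmooth_ge0.
have merge (e e' : RR) G : measurable_fun setT G -> (forall z, 0 <= G z)%E ->
    gsmooth (r * e, r * e') (gsmooth (s * e, s * e') G) =1 gsmooth (t * e, t * e') G.
  move=> mG G0 z.
    have cs : (r / t) ^+ 2 + (s / t) ^+ 2 = 1.
      by rewrite !exprMn -mulrDl -t2 exprVn divff// expf_neq0.
    rewrite -(gsmooth_rot (r * e, r * e') (s * e, s * e') z cs mG G0)/=.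
  have -> : (r / t * (r * e) + s / t * (s * e), r / t * (r * e') + s / t * (s * e')) =
     (t * e, t * e') :> RR * RR.
    have tE : r / t * r + s / t * s = t.
      by rewrite -[RHS](mulfK t0) -expr2 t2; field.
    by congr pair; rewrite !mulrA -mulrDl tE.
  (* The second direction after the rotation is 0, and averaging along it does nothing. *)
  apply: eq_gsmooth => z'.
  have -> : (- (s / t) * (r * e) + r / t * (s * e), - (s / t) * (r * e') + r / t * (s * e'))
      = (0, 0) :> RR * RR by congr pair; ring.
  exact: gsmooth0.
have := merge 1 0; have := merge 0 1; rewrite !mulr1 !mulr0 => mer1 mer2.
transitivity (gsmooth (r, 0) (gsmooth (0, r) (gsmooth (s, 0) (gsmooth (0, s) F))) w).
  rewrite cgsmooth_real; apply: eq_gsmooth => z; apply: eq_gsmooth => {}z.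
  exact: cgsmooth_real.
have mg v : measurable_fun setT (gsmooth v F) by exact: measurable_gsmooth.
have g0 v z : (0 <= gsmooth v F z)%E by exact: gsmooth_ge0.
(* Exchanging the two middle averages brings parallel directions next to each other. *)
rewrite cgsmooth_real; transitivity (gsmooth (r, 0) (gsmooth (s, 0) (gsmooth (0, r) (gsmooth (0, s) F))) w).
  by apply: eq_gsmooth => z; exact: gsmoothC.
rewrite mer2; [|exact: measurable_gsmooth|by move=> z; exact: gsmooth_ge0].
by apply: eq_gsmooth => z; exact: mer1.
Qed.

End gauss_smoothing.

(** * The Marcinkiewicz-Zygmund extension *)

Section gauss_moment.
Variables (R : realType) (p : R).
Hypothesis p_gt0 : 0 < p.
Local Notation RR := (measurableTypeR R).
Local Notation mu := (@lebesgue_measure R).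
Local Notation phi := (@normal_pdf R 0 1).
Implicit Types (F : RR * RR -> \bar R) (w : RR * RR).

Definition gseq (l : seq R[i]) F := foldr (@cgsmooth R) F l.

Lemma gseq_ge0 l F : (forall z, 0 <= F z)%E -> forall z, (0 <= gseq l F z)%E.
Proof. by move=> F0; elim: l => //= a l IH z; exact: cgsmooth_ge0. Qed.

Lemma measurable_gseq l F : measurable_fun setT F -> (forall z, 0 <= F z)%E ->
  measurable_fun setT (gseq l F).
Proof.
move=> mF F0; elim: l => //= a l IH; apply: measurable_cgsmooth IH _.
exact: gseq_ge0.
Qed.

(* A sum of independent complex Gaussians a g_a is distributed as
   (sum |a|^2)^(1/2) g. *)
Lemma gseqE l F w : measurable_fun setT F -> (forall z, 0 <= F z)%E ->
  gseq l F w = cgsmooth (Num.sqrt (\sum_(a <- l) cabs a ^+ 2))%:C F w.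
Proof.
move=> mF F0; elim: l w => [|a l IH] w /=.
  by rewrite big_nil sqrtr0 cgsmooth_real !gsmooth0// => z; exact: gsmooth_ge0.
rewrite big_cons cgsmooth_cabs; [|exact: measurable_gseq|exact: gseq_ge0].
rewrite (_ : gseq l F = cgsmooth (Num.sqrt (\sum_(a <- l) cabs a ^+ 2))%:C F); last first.
  exact/funext.
rewrite (cgsmooth_real_comp _ _ _ mF F0) sqr_sqrtr//.
by apply: sumr_ge0 => b _; exact: sqr_ge0.
Qed.

Definition pow_modulus (z : RR * RR) : \bar R :=
  (Num.sqrt (z.1 ^+ 2 + z.2 ^+ 2) `^ p)%:E.

Lemma pow_modulus_toRR a : pow_modulus (toRR a) = (cabs a `^ p)%:E.
Proof. by rewrite /pow_modulus cabsE. Qed.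

Lemma pow_modulus_ge0 z : (0 <= pow_modulus z)%E.
Proof. by rewrite lee_fin powR_ge0. Qed.

Lemma measurable_pow_modulus : measurable_fun setT pow_modulus.
Proof.
apply/measurable_EFinP; apply: (@measurableT_comp _ _ _ _ _ _ (fun x : RR => x `^ p)).
  exact: measurable_powR.
apply: (@measurableT_comp _ _ _ _ _ _ (@Num.sqrt R : RR -> RR)).
  by apply: continuous_measurable_fun; exact: sqrt_continuous.
by apply: measurable_funD; apply: measurable_funX.
Qed.

Definition gauss_moment : \bar R := cgsmooth 1%:C pow_modulus (0, 0).

Lemma cgsmooth_pow_modulus (r : R) : 0 <= r ->
  cgsmooth r%:C pow_modulus (0, 0) = ((r `^ p)%:E * gauss_moment)%E.
Proof.
move=> r0; rewrite /gauss_moment !cgsmooth_real.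
rewrite !(gsmooth2E _ _ _ measurable_pow_modulus pow_modulus_ge0)/= /iint.
have mI := gsmooth2_measurable (1, 0) (0, 1) (0, 0) measurable_pow_modulus.
pose G := (fun z : RR * RR =>
   (pow_modulus ((0 + z.1 * 1 + z.2 * 0)%R, (0 + z.1 * 0 + z.2 * 1)%R) * (phi z.1 * phi z.2)%:E)%E).
have G0 z : (0 <= G z)%E by rewrite mule_ge0 ?pow_modulus_ge0// lee_fin mulr_ge0 ?normal_pdf_ge0.
have mG : measurable_fun setT G by exact: mI.
rewrite -[X in (_ * X)%E]/(\int[mu]_x \int[mu]_y G (x, y))%E.
rewrite -ge0_integralZl//=; last 3 first.
- exact: (@measurable_fun_fubini_tonelli_F _ _ _ _ _ mu G mG G0).
- by move=> x _; exact: integral_ge0.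
- by rewrite lee_fin powR_ge0.
apply: eq_integral => x _; rewrite -ge0_integralZl//=; last 2 first.
- by apply: measurableT_comp mG _; exact: measurable_fun_pair.
- by rewrite lee_fin powR_ge0.
apply: eq_integral => y _; rewrite /G /= muleA; congr (_ * _)%E.
rewrite /pow_modulus -EFinM -powRM ?sqrtr_ge0//=; congr (_ `^ _)%:E.
have -> : r * Num.sqrt ((0 + x * 1 + y * 0) ^+ 2 + (0 + x * 0 + y * 1) ^+ 2) =
    Num.sqrt (r ^+ 2 * ((0 + x * 1 + y * 0) ^+ 2 + (0 + x * 0 + y * 1) ^+ 2)).
  by rewrite sqrtrM ?sqr_ge0// sqrtr_sqr ger0_norm.
by congr Num.sqrt; ring.
Qed.

Let Gm := (fun z : RR * RR =>
  (pow_modulus ((0 + z.1 * 1 + z.2 * 0)%R, (0 + z.1 * 0 + z.2 * 1)%R) * (phi z.1 * phi z.2)%:E)%E).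

Let Gm0 z : (0 <= Gm z)%E.
Proof. by rewrite mule_ge0 ?pow_modulus_ge0// lee_fin mulr_ge0 ?normal_pdf_ge0. Qed.

Let mGm : measurable_fun setT Gm.
Proof. exact: (gsmooth2_measurable (1, 0) (0, 1) (0, 0) measurable_pow_modulus). Qed.

Let gauss_momentE : gauss_moment = (\int[mu]_x \int[mu]_y Gm (x, y))%E.
Proof.
rewrite /gauss_moment cgsmooth_real.
exact: (gsmooth2E _ _ _ measurable_pow_modulus pow_modulus_ge0).
Qed.

Let mphiE : measurable_fun setT (fun y : RR => (phi y)%:E).
Proof. by apply/measurable_EFinP; exact: measurable_normal_pdf. Qed.

(** The moment will be cancelled from both sides of an inequality, so it has to be nonzero and
    finite. For x in [1, 2] the modulus is at least 1 and the density at x is at least [phi 2]. *)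
Lemma gauss_moment_gt0 : (0 < gauss_moment)%E.
Proof.
rewrite gauss_momentE.
have mG1 : measurable_fun setT (fun x : RR => \int[mu]_y Gm (x, y))%E.
  exact: (@measurable_fun_fubini_tonelli_F _ _ _ _ _ mu Gm mGm Gm0).
have p2 : 0 < phi 2 by rewrite normal_pdf01E mulr_gt0 ?expR_gt0// normal_peak_gt0// oner_neq0.
apply: (@lt_le_trans _ _ (\int[mu]_(x in `[1%R, 2%R]) (phi 2)%:E)%E).
  rewrite integral_cst//= lebesgue_measure_itv/= lte_fin ltrDl ltr01.
  by rewrite -EFinB -EFinM lte_fin mulr_gt0//; lra.
apply: (@le_trans _ _ (\int[mu]_(x in `[1%R, 2%R]) \int[mu]_y Gm (x, y))%E); last first.
  apply: ge0_subset_integral; [exact: measurable_itv|exact: measurableT|exact: mG1| |by []].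
  by move=> x _; apply: integral_ge0 => y _; exact: Gm0.
apply: ge0_le_integral => //.
- by move=> x _; rewrite lee_fin ltW.
- exact: measurable_funTS.
move=> x /=; rewrite in_itv/= => /andP[x1 x2].
apply: (@le_trans _ _ (\int[mu]_y ((phi 2)%:E * (phi y)%:E))%E).
  by rewrite ge0_integralZl// ?integral_normal_pdf ?mule1// ?lee_fin ?normal_pdf_ge0//
     => y _; rewrite lee_fin normal_pdf_ge0.
apply: ge0_le_integral => //.
- by move=> y _; rewrite mule_ge0// lee_fin normal_pdf_ge0.
- exact: emeasurable_funM.
- by apply: measurableT_comp mGm _; exact: measurable_fun_pair.
move=> y _; rewrite /Gm /pow_modulus -!EFinM lee_fin/=.
rewrite [leRHS]mulrCA mulrA; apply: ler_wpM2r; first exact: normal_pdf_ge0.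
apply: (@le_trans _ _ (phi x)).
  rewrite !normal_pdf01E ler_wpM2l ?normal_peak_ge0// ler_expR ler_wpM2r ?invr_ge0// lerN2.
  by rewrite lerXn2r// nnegrE; lra.
rewrite ler_peMr ?normal_pdf_ge0//.
apply: (@le_trans _ _ (1 `^ p)); first by rewrite powR1.
rewrite ge0_ler_powR ?(ltW p_gt0) ?nnegrE ?sqrtr_ge0//.
rewrite -[leLHS]sqrtr1 ler_wsqrtr//.
rewrite !mulr0 !mulr1 !addr0 !add0r; apply: (@le_trans _ _ (x ^+ 2)).
  by rewrite exprn_ege1.
by rewrite lerDl sqr_ge0.
Qed.

Let s2 : R := Num.sqrt 2.

Let s2_neq0 : s2 != 0.
Proof. by rewrite gt_eqF// sqrtr_gt0. Qed.

(** Half of the Gaussian decay pays for the growth e^(x^2/4); what remains is a multiple of the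
    density of variance 2, with known integral. *)
Let normal_pdf_s2 x : expR (x ^+ 2 / 4) * phi x =
  (normal_peak 1 / normal_peak s2) * normal_pdf 0 s2 x.
Proof.
rewrite normal_pdf01E /normal_pdf (negbTE s2_neq0).
rewrite -[X in _ = _ * X]/(normal_peak s2 * normal_fun 0 s2 x).
rewrite [RHS]mulrA divfK; last by rewrite gt_eqF// normal_peak_gt0.
rewrite mulrCA -expRD; congr (_ * expR _).
rewrite /s2 subr0 sqr_sqrtr//; lra.
Qed.

(** For z > 1 the left-hand side is at most z^(n+1), which up to the factor 4^(n+1) (n+1)! is a term
    of the series of e^(z/4). For z <= 1 the left-hand side is at most 1 and both factors on the
    right are at least 1. *)
Let pow_le_exp : exists2 k : R, 0 <= k & forall z : R, 0 <= z ->
  Num.sqrt z `^ p <= k * expR (z / 4).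
Proof.
pose n := Num.truncn (p / 2); exists (4 ^+ n.+1 * n.+1`!%:R).
  by rewrite mulr_ge0// exprn_ge0.
move=> z z0; rewrite -powR12_sqrt// -powRrM mulrC.
have fact_ge1 : 1 <= n.+1`!%:R :> R by rewrite -[leLHS]/(1%:R) ler_nat fact_gt0.
have [z1|z1] := leP z 1.
  apply: (@le_trans _ _ 1).
    by apply: (@le_trans _ _ (1 `^ (p / 2)));
      [rewrite ge0_ler_powR ?nnegrE ?divr_ge0 ?(ltW p_gt0)|rewrite powR1].
  rewrite mulr_ege1//.
    by rewrite mulr_ege1// exprn_ege1//; lra.
  by rewrite -expR0 ler_expR divr_ge0.
apply: (@le_trans _ _ (z ^+ n.+1)).
  rewrite -powR_mulrn// ler_powR ?(ltW z1)//.
  by rewrite ltW// truncnS_gt.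
have := expR_ge1Dxn n (divr_ge0 z0 (ltW (ltr0Sn R 3))).
rewrite -(ler_pM2l (_ : 0 < 4 ^+ n.+1 * n.+1`!%:R)); last first.
  by rewrite mulr_gt0 ?exprn_gt0// ltr0n fact_gt0.
apply: le_trans; rewrite mulrDr mulr1 exprMn exprVn.
rewrite [X in _ <= _ + X](_ : _ = z ^+ n.+1); last first.
  rewrite mulrACA -[X in _ * X]mulrC; field.
  by rewrite !gt_eqF// ?exprn_gt0// ltr0n fact_gt0.
by rewrite lerDr mulr_ge0// exprn_ge0.
Qed.

Lemma gauss_moment_lty : (gauss_moment < +oo)%E.
Proof.
rewrite gauss_momentE; have [k k0 kP] := pow_le_exp.
pose D := normal_peak 1 / normal_peak s2.
have D0 : 0 <= D by rewrite divr_ge0 ?normal_peak_ge0.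
pose psi := @normal_pdf R 0 s2.
have psi0 y : 0 <= psi y by exact: normal_pdf_ge0.
have mpsi : measurable_fun setT (fun y : RR => (psi y)%:E).
  by apply/measurable_EFinP; exact: measurable_normal_pdf.
have ipsi (r : R) : 0 <= r -> (\int[mu]_y (r%:E * (psi y)%:E) = r%:E)%E.
  move=> r0; rewrite ge0_integralZl ?lee_fin//; last by move=> y _; rewrite lee_fin.
  by rewrite integral_normal_pdf mule1.
apply: (@le_lt_trans _ _ (\int[mu]_x ((k * D ^+ 2)%:E * (psi x)%:E))%E); last first.
  by rewrite ipsi ?ltry// mulr_ge0// exprn_ge0.
apply: ge0_le_integral => //.
- by move=> x _; apply: integral_ge0 => y _; exact: Gm0.
- exact: (@measurable_fun_fubini_tonelli_F _ _ _ _ _ mu Gm mGm Gm0).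
- exact: emeasurable_funM.
move=> x _; apply: (@le_trans _ _ (\int[mu]_y ((k * D ^+ 2 * psi x)%:E * (psi y)%:E))%E); last first.
  have kD : 0 <= k * D ^+ 2 * psi x by rewrite mulr_ge0// mulr_ge0// exprn_ge0.
  by rewrite (ipsi _ kD) EFinM.
apply: ge0_le_integral => //.
- by apply: measurableT_comp mGm _; exact: measurable_fun_pair.
- exact: emeasurable_funM.
move=> y _; rewrite /Gm /pow_modulus -!EFinM lee_fin/=.
apply: (@le_trans _ _ (k * expR ((x ^+ 2 + y ^+ 2) / 4) * (phi x * phi y))).
  rewrite ler_wpM2r ?mulr_ge0 ?normal_pdf_ge0//.
  by rewrite !mulr0 !mulr1 !addr0 !add0r kP// addr_ge0 ?sqr_ge0.
have -> : k * expR ((x ^+ 2 + y ^+ 2) / 4) * (phi x * phi y) =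
    k * (expR (x ^+ 2 / 4) * phi x) * (expR (y ^+ 2 / 4) * phi y).
  rewrite mulrDl expRD; move: (expR _) (expR _) (phi x) (phi y) => e1 e2 f1 f2; ring.
rewrite (normal_pdf_s2 x) (normal_pdf_s2 y) -/D -/(psi x) -/(psi y).
clear D0; move: (psi x) (psi y) D => f1 f2 d; rewrite le_eqVlt; apply/orP; left; apply/eqP; ring.
Qed.

End gauss_moment.

Section marcinkiewicz_zygmund.
Variables (R : realType) (I J K : finType) (p C : R) (w : I -> R) (w' : J -> R).
Variable A : J -> I -> R[i].
Hypothesis p_gt0 : 0 < p.
Hypotheses (w_ge0 : forall i, 0 <= w i) (w'_ge0 : forall j, 0 <= w' j).
Hypothesis A_bound : forall u : I -> R[i],
  \sum_j w' j * cabs (\sum_i A j i * u i) `^ p <= C `^ p * \sum_i w i * cabs (u i) `^ p.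
Local Notation RR := (measurableTypeR R).
Local Notation mu := (@lebesgue_measure R).
Local Notation phi := (@normal_pdf R 0 1).

Let act (u : I -> R[i]) j : R[i] := \sum_i A j i * u i.

(* Averaging over one Gaussian coefficient at a time keeps this inequality, which
   for the p-th power of the modulus is A_bound. *)
Let dominated (G : I -> RR * RR -> \bar R) (G' : J -> RR * RR -> \bar R) : Prop :=
  forall u : I -> R[i],
  (\sum_j (w' j)%:E * G' j (toRR (act u j)) <=
   (C `^ p)%:E * \sum_i (w i)%:E * G i (toRR (u i)))%E.

Let toRRD (a b : R[i]) (x : R) :
  toRR (a + x%:C * b) = ((toRR a).1 + x * (toRR b).1, (toRR a).2 + x * (toRR b).2).
Proof. by case: a b => [a1 a2] [b1 b2]; rewrite /toRR/=; congr pair; ring. Qed.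

Let sum_gsmooth (T : finType) (c : T -> R) (v z : T -> RR * RR) (G : T -> RR * RR -> \bar R) :
  (forall t, 0 <= c t) -> (forall t, measurable_fun setT (G t)) ->
  (forall t z, 0 <= G t z)%E ->
  (\sum_t (c t)%:E * gsmooth (v t) (G t) (z t) =
   \int[mu]_x ((\sum_t (c t)%:E * G t ((z t).1 + x * (v t).1, (z t).2 + x * (v t).2)%R) * (phi x)%:E))%E.
Proof.
move=> c0 mG G0.
have mGx t : measurable_fun setT (fun x : RR => G t ((z t).1 + x * (v t).1, (z t).2 + x * (v t).2)%R).
  exact: measurableT_comp (mG t) (measurable_translate _ _).
have mphi : measurable_fun setT (fun x : RR => (phi x)%:E).
  by apply/measurable_EFinP; exact: measurable_normal_pdf.
transitivity (\sum_t \int[mu]_x ((c t)%:E *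
    (G t ((z t).1 + x * (v t).1, (z t).2 + x * (v t).2)%R * (phi x)%:E)))%E.
  apply: eq_bigr => t _; rewrite ge0_integralZl//=.
  - exact: emeasurable_funM.
  - by move=> x _; rewrite mule_ge0// lee_fin normal_pdf_ge0.
  - by rewrite lee_fin.
rewrite -ge0_integral_sum//=; last 2 first.
- by move=> t; apply: emeasurable_funM => //; exact: emeasurable_funM.
- by move=> t x _; rewrite mule_ge0 ?lee_fin// mule_ge0// lee_fin normal_pdf_ge0.
apply: eq_integral => x _; rewrite ge0_sume_distrl; last first.
  by move=> t _; rewrite mule_ge0 ?lee_fin.
by apply: eq_bigr => t _; rewrite muleA.
Qed.

Let dominated_gsmooth (a : I -> R[i]) G G' :
  (forall i, measurable_fun setT (G i)) -> (forall i z, 0 <= G i z)%E ->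
  (forall j, measurable_fun setT (G' j)) -> (forall j z, 0 <= G' j z)%E ->
  dominated G G' ->
  dominated (fun i => gsmooth (toRR (a i)) (G i)) (fun j => gsmooth (toRR (act a j)) (G' j)).
Proof.
move=> mG G0 mG' G'0 dom u.
rewrite (@sum_gsmooth J w' (fun j => toRR (act a j)) (fun j => toRR (act u j)) G')//.
rewrite (@sum_gsmooth I w (fun i => toRR (a i)) (fun i => toRR (u i)) G)//.
have mphi : measurable_fun setT (fun x : RR => (phi x)%:E).
  by apply/measurable_EFinP; exact: measurable_normal_pdf.
have mS (T : finType) (c : T -> R) (v z : T -> RR * RR) (H : T -> RR * RR -> \bar R) :
    (forall t, measurable_fun setT (H t)) ->
    measurable_fun setT (fun x : RR =>
      ((\sum_t (c t)%:E * H t ((z t).1 + x * (v t).1, (z t).2 + x * (v t).2)%R) * (phi x)%:E)%E).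
  move=> mH; apply: emeasurable_funM => //; apply: emeasurable_sum => t.
  by apply: emeasurable_funM => //; exact: measurableT_comp (mH t) (measurable_translate _ _).
rewrite -ge0_integralZl//=; last 3 first.
- exact: (mS I w (fun i => toRR (a i)) (fun i => toRR (u i)) G mG).
- move=> x _; rewrite mule_ge0 ?lee_fin ?normal_pdf_ge0// sume_ge0// => i _.
  by rewrite mule_ge0 ?lee_fin.
- by rewrite lee_fin powR_ge0.
apply: ge0_le_integral => //.
- move=> x _; rewrite mule_ge0 ?lee_fin ?normal_pdf_ge0// sume_ge0// => j _.
  by rewrite mule_ge0 ?lee_fin.
- exact: (mS J w' (fun j => toRR (act a j)) (fun j => toRR (act u j)) G' mG').
- apply: emeasurable_funM => //.
  exact: (mS I w (fun i => toRR (a i)) (fun i => toRR (u i)) G mG).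
move=> x _; rewrite muleA; apply: lee_wpmul2r; first by rewrite lee_fin normal_pdf_ge0.
(* For each value x of the Gaussian the inequality is used at the input u + x a; linearity of [act]
   turns this into the integrand on both sides. *)
have := dom (fun i => u i + x%:C * a i).
under [X in (_ <= _ * X)%E -> _]eq_bigr do rewrite toRRD.
have actE j : act (fun i => u i + x%:C * a i) j = act u j + x%:C * act a j.
  rewrite /act mulr_sumr -big_split/=; apply: eq_bigr => i _; ring.
by under [X in (X <= _)%E -> _]eq_bigr do rewrite actE toRRD.
Qed.

Let dominated_gseq (l : seq (I -> R[i])) :
  dominated (fun i => gseq [seq a i | a <- l] (pow_modulus p))
            (fun j => gseq [seq act a j | a <- l] (pow_modulus p)).
Proof.
elim: l => [|a l IH] /=.
  move=> u; rewrite /gseq/=.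
  under eq_bigr do rewrite pow_modulus_toRR -EFinM.
  under [X in (_ <= _ * X)%E]eq_bigr do rewrite pow_modulus_toRR -EFinM.
  rewrite !sumEFin -EFinM lee_fin; exact: A_bound.
have mg (T : Type) (b : (I -> R[i]) -> T -> R[i]) t :
    measurable_fun setT (gseq [seq b a t | a <- l] (pow_modulus p)).
  by apply: measurable_gseq; [exact: measurable_pow_modulus|exact: pow_modulus_ge0].
have g0 (T : Type) (b : (I -> R[i]) -> T -> R[i]) t z :
    (0 <= gseq [seq b a t | a <- l] (pow_modulus p) z)%E.
  by apply: gseq_ge0; exact: pow_modulus_ge0.
(* The imaginary part of the Gaussian coefficient is a real average in the direction i a, and [act]
   commutes with multiplication by i. *)
have IHi : dominated
    (fun i => gsmooth (toRR ('i * a i)) (gseq [seq b i | b <- l] (pow_modulus p)))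
    (fun j => gsmooth (toRR ('i * act a j)) (gseq [seq act b j | b <- l] (pow_modulus p))).
  have -> : (fun j => gsmooth (toRR ('i * act a j)) (gseq [seq act b j | b <- l] (pow_modulus p))) =
     (fun j => gsmooth (toRR (act (fun i => 'i * a i) j)) (gseq [seq act b j | b <- l] (pow_modulus p))).
    apply/funext => j; have -> // : 'i * act a j = act (fun i => 'i * a i) j.
    by rewrite /act mulr_sumr; apply: eq_bigr => i _; rewrite mulrCA.
  apply: dominated_gsmooth IH.
  - by move=> i; exact: (mg _ (fun b => b)).
  - by move=> i; exact: (g0 _ (fun b => b)).
  - by move=> j; exact: mg.
  - by move=> j; exact: g0.
apply: dominated_gsmooth IHi.
- by move=> i; apply: measurable_gsmooth; [exact: (mg _ (fun b => b))|exact: (g0 _ (fun b => b))].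
- by move=> i z; apply: gsmooth_ge0; exact: (g0 _ (fun b => b)).
- by move=> j; apply: measurable_gsmooth; [exact: mg|exact: g0].
- by move=> j z; apply: gsmooth_ge0; exact: g0.
Qed.

(** With [u = 0] and one Gaussian for each [a k], both sides of the dominated inequality are a mixed
    norm of inner exponent 2 times the same moment. Cancelling it leaves C as it was. *)
Lemma marcinkiewicz_zygmund : mixed_bound K p C w w' A 2.
Proof.
move=> a.
have := dominated_gseq [seq a k | k <- enum K] (fun=> 0).
have gE (T : finType) (c : T -> R) (b : (I -> R[i]) -> T -> R[i]) (z : T -> R[i]) :
    (forall t, 0 <= c t) -> (forall t, z t = 0) ->
    (\sum_t (c t)%:E * gseq [seq b u t | u <- [seq a k | k <- enum K]] (pow_modulus p) (toRR (z t)) =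
     (mixed p 2 c (fun k => b (a k)))%:E * gauss_moment p)%E.
  move=> c0 z0; rewrite /mixed -sumEFin ge0_sume_distrl; last first.
    by move=> t _; rewrite lee_fin mulr_ge0// powR_ge0.
  apply: eq_bigr => t _; rewrite z0.
  rewrite (gseqE _ _ (measurable_pow_modulus p) (@pow_modulus_ge0 _ p)).
  rewrite cgsmooth_pow_modulus ?sqrtr_ge0// EFinM muleA; congr (_ * _%:E * _)%E.
  rewrite 2!big_map big_enum /= -powR12_sqrt; last by apply: sumr_ge0 => k _; exact: sqr_ge0.
  rewrite -powRrM [2^-1 * _]mulrC; congr (_ `^ _); apply: eq_bigr => k _.
  by rewrite powR_mulrn// cabs_ge0.
rewrite (gE J w' act (act (fun=> 0)))//; last first.
  by move=> j; rewrite /act big1// => i _; rewrite mulr0.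
rewrite (gE I w (fun u => u) (fun=> 0))// muleA -EFinM.
have c0 := gauss_moment_gt0 p_gt0; have cy := gauss_moment_lty p_gt0.
have -> : gauss_moment p = (fine (gauss_moment p))%:E.
  by rewrite fineK// ge0_fin_numE// ltW.
rewrite -!EFinM lee_fin ler_pM2r//.
by rewrite fine_gt0// c0.
Qed.

End marcinkiewicz_zygmund.

Lemma exponents_gt1 (R : realType) (p s : R) :
  (2 <= s /\ s <= p) \/ (1 < p /\ p <= s /\ s <= 2) -> 1 < p /\ 1 < s.
Proof. by case=> [[s2 sp]|[p1 [ps _]]]; split; lra. Qed.

Section matrix_extension.
Variables (R : realType) (I J K : finType) (p s C : R) (w : I -> R) (w' : J -> R).
Variable A : J -> I -> R[i].
Hypothesis hps : (2 <= s /\ s <= p) \/ (1 < p /\ p <= s /\ s <= 2).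
Hypotheses (w_ge0 : forall i, 0 <= w i) (w'_ge0 : forall j, 0 <= w' j).
Hypothesis A_bound : forall u : I -> R[i],
  \sum_j w' j * cabs (\sum_i A j i * u i) `^ p <= C `^ p * \sum_i w i * cabs (u i) `^ p.

Lemma mixed_bound_diag : p != 0 -> mixed_bound K p C w w' A p.
Proof.
move=> p0 a.
have mixedE (T : finType) (c : T -> R) (b : K -> T -> R[i]) :
    mixed p p c b = \sum_k \sum_t c t * cabs (b k t) `^ p.
  rewrite exchange_big/=; apply: eq_bigr => t _; rewrite divff// powRr1 ?mulr_sumr//.
  by apply: sumr_ge0 => k _; exact: powR_ge0.
by rewrite !mixedE mulr_sumr; apply: ler_sum => k _; exact: A_bound.
Qed.

Lemma matrix_extension : mixed_bound K p C w w' A s.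
Proof.
have [p1 s1] := exponents_gt1 hps.
have p0 : 0 < p by lra.
have s0 : 0 < s by lra.
have MZ := @marcinkiewicz_zygmund R I J K p C w w' A p0 w_ge0 w'_ge0 A_bound.
have Dg := mixed_bound_diag (lt0r_neq0 p0).
(* For p = 2 the formula for [t] below degenerates, but then s = 2 and [MZ] is the claim. *)
have [p2|p2] := eqVneq p 2.
  have -> // : s = 2 by case: hps => [[]|[_ []]]; rewrite p2 => ? ?; apply: le_anti; apply/andP.
(* The solution of 1/s = (1 - t)/p + t/2. *)
pose t := (p^-1 - s^-1) / (p^-1 - 2^-1).
have d0 : p^-1 - 2^-1 != 0.
  by rewrite subr_eq0; apply: contra_neq p2 => /invr_inj.
apply: (@riesz_thorin R I J K p C w w' A p1 w_ge0 w'_ge0 p 2 s t p1 _ s1 _ _ Dg MZ).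
- by lra.
- rewrite /t; case: hps => [[s2 sp]|[_ [ps s2]]].
    have xy : p^-1 <= s^-1 by rewrite lef_pV2.
    have yz : s^-1 <= 2^-1 by rewrite lef_pV2// posrE.
    have zx : 0 < 2^-1 - p^-1.
      by rewrite lt_neqAle eq_sym -oppr_eq0 opprB d0/= subr_ge0 (le_trans xy).
    have -> : (p^-1 - s^-1) / (p^-1 - 2^-1) = (s^-1 - p^-1) / (2^-1 - p^-1).
      by rewrite -[LHS]mulrNN -[X in _ * X = _]invrN !opprB.
    by rewrite ler_pdivrMr ?divr_ge0 ?subr_ge0 ?(ltW zx) ?mul1r ?lerD2r// (le_trans xy).
  have xy : s^-1 <= p^-1 by rewrite lef_pV2.
  have yz : 2^-1 <= s^-1 by rewrite lef_pV2// posrE.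
  have zx : 0 < p^-1 - 2^-1.
    by rewrite lt_neqAle eq_sym d0/= subr_ge0 (le_trans yz).
  by rewrite ler_pdivrMr ?divr_ge0 ?subr_ge0 ?(ltW zx) ?mul1r ?lerD2l ?lerN2// (le_trans yz).
- have -> : (1 - t) / p + t / 2 = p^-1 - t * (p^-1 - 2^-1) by ring.
  by rewrite /t divfK// opprB addrC subrK.
Qed.

End matrix_extension.

(** * L^p norms on the circle *)

Lemma cvge0P (R : realType) (u : (\bar R)^nat) : (forall n, 0 <= u n)%E ->
  u n @[n --> \oo] --> 0%E <->
  forall e : R, 0 < e -> \forall n \near \oo, (u n <= e%:E)%E.
Proof.
move=> u0; split => [/fine_cvgP[ufin /cvgrPdist_le uc] e e0|H].
  near=> n; have un : u n \is a fin_num by near: n.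
  rewrite -(fineK un) lee_fin -[leLHS]ger0_norm ?fine_ge0// -normrN -sub0r.
  by near: n; exact: uc.
apply/fine_cvgP; split.
  near=> n; rewrite ge0_fin_numE//; apply: (@le_lt_trans _ _ 1%:E); last exact: ltry.
  by near: n; exact: H.
apply/cvgrPdist_le => e e0; near=> n.
rewrite sub0r normrN ger0_norm ?fine_ge0// -lee_fin fineK; last first.
  rewrite ge0_fin_numE//; apply: (@le_lt_trans _ _ e%:E); last exact: ltry.
  by near: n; exact: H.
by near: n; exact: H.
Unshelve. all: by end_near. Qed.

Lemma poweR_le (R : realType) (x y : \bar R) (r : R) : 0 <= r -> (0 <= x)%E -> (x <= y)%E ->
  (x `^ r <= y `^ r)%E.
Proof.
move=> r0 x0 xy; apply: gt0_ler_poweR => //; rewrite in_itv/= ?leey ?andbT//.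
exact: le_trans xy.
Qed.

Section circle_norm.
Variables (R : realType) (p : R).
Hypothesis p_ge1 : 1 <= p.
Local Notation mu := (@lebesgue_measure R).
Local Notation arc := (`[0, 2 * pi]%classic : set R).
Implicit Types (F G : circle R -> \bar R) (f g : circle R -> R).

Let p_gt0 : 0 < p. Proof. exact: lt_le_trans p_ge1. Qed.
Let p_neq0 : p != 0. Proof. by rewrite gt_eqF. Qed.

Lemma arc_meas : measurable arc. Proof. exact: measurable_itv. Qed.

(** The type [circle] is given no sigma-algebra; measurability is that of the lift to the real line,
    as in [LpT]. *)
Definition emeas F := measurable_fun (setT : set R) (fun t => F (expi t)).
Definition rmeas f := measurable_fun (setT : set R) (fun t => f (expi t)).

Lemma normTE F : normT p F = ((\int[mu]_(t in arc) (`|F (expi t)| `^ p)) `^ p^-1)%E.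
Proof.
rewrite /normT unlock; congr (_ `^ _)%E; rewrite [RHS]integral_mkcond.
apply: eq_integral => t _; rewrite /patch /=; case: ifP => // _.
by rewrite abse0 poweR0r.
Qed.

Lemma measurable_epow F : emeas F ->
  measurable_fun arc (fun t => `|F (expi t)| `^ p)%E.
Proof.
move=> mF; apply: measurable_funTS.
by apply: (@measurableT_comp _ _ _ _ _ _ (fun x : \bar R => x `^ p)%E);
  [exact: measurable_poweR|exact: measurableT_comp].
Qed.

Lemma normT_le F G : emeas F -> emeas G -> (forall z, `|F z| <= `|G z|)%E ->
  (normT p F <= normT p G)%E.
Proof.
move=> mF mG FG; rewrite !normTE; apply: gt0_ler_poweR.
- by rewrite invr_ge0 ltW.
- by rewrite in_itv/= integral_ge0 ?leey// => t _; exact: poweR_ge0.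
- by rewrite in_itv/= integral_ge0 ?leey// => t _; exact: poweR_ge0.
apply: ge0_le_integral => //.
- by move=> t _; exact: poweR_ge0.
- exact: measurable_epow.
- exact: measurable_epow.
move=> t _; apply: gt0_ler_poweR; [exact: ltW| | |exact: FG];
  by rewrite in_itv/= abse_ge0 leey.
Qed.

Definition rnorm f : \bar R := normT p (fun z => (f z)%:E).

Lemma rmeas_emeas f : rmeas f -> emeas (fun z => (f z)%:E).
Proof. by move=> mf; apply/measurable_EFinP. Qed.

Lemma rnorm_ge0 f : (0 <= rnorm f)%E.
Proof. exact: Lnorm_ge0. Qed.

Lemma rnorm_le f g : rmeas f -> rmeas g -> (forall z, `|f z| <= `|g z|) ->
  (rnorm f <= rnorm g)%E.
Proof.
by move=> mf mg fg; apply: normT_le => [||z];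
  [exact: rmeas_emeas|exact: rmeas_emeas|rewrite lee_fin].
Qed.

Lemma rnormE f : rnorm f = 'N[mu]_p%:E[EFin \o ((f \o @expi R) \_ arc)]%E.
Proof.
rewrite /rnorm /normT; congr (Lnorm _ _ _); apply/funext => t /=.
by rewrite /patch; case: ifP.
Qed.

Lemma measurable_arc f : rmeas f -> measurable_fun (setT : set R) ((f \o @expi R) \_ arc).
Proof. by move=> mf; apply/(measurable_restrictT _ arc_meas); exact: measurable_funTS. Qed.

Lemma rnormD f g : rmeas f -> rmeas g -> (rnorm (fun z => f z + g z)%R <= rnorm f + rnorm g)%E.
Proof.
move=> mf mg; rewrite !rnormE.
have -> : ((fun z => f z + g z) \o @expi R) \_ arc = ((f \o @expi R) \_ arc \+ (g \o @expi R) \_ arc)%R.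
  by apply/funext => t /=; rewrite /patch; case: ifP => //; rewrite addr0.
by apply: minkowski_EFin => //; exact: measurable_arc.
Qed.

Lemma rnorm_powE f : (rnorm f `^ p = \int[mu]_(t in arc) (`|f (expi t)| `^ p)%:E)%E.
Proof.
rewrite /rnorm normTE -poweRrM mulVf// poweRe1 //.
by apply: integral_ge0 => t _; exact: poweR_ge0.
Qed.

Lemma rnorm_root f : (rnorm f = (\int[mu]_(t in arc) (`|f (expi t)| `^ p)%:E) `^ p^-1)%E.
Proof. by rewrite /rnorm normTE. Qed.

Lemma rnormZ (c : R) f : rmeas f -> rnorm (fun z => c * f z) = (`|c|%:E * rnorm f)%E.
Proof.
move=> mf; rewrite !rnorm_root.
under eq_integral => t _ do rewrite normrM powRM// EFinM.
rewrite ge0_integralZl//=.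
- rewrite poweRM ?lee_fin ?powR_ge0//; last first.
    by apply: integral_ge0 => t _; rewrite lee_fin powR_ge0.
  by rewrite poweR_EFin -powRrM divff// powRr1.
- by move: (measurable_epow (rmeas_emeas mf)).
Qed.

Lemma rnorm_pow_integrable f : rmeas f -> (rnorm f < +oo)%E ->
  mu.-integrable arc (fun t => (`|f (expi t)| `^ p)%:E).
Proof.
move=> mf foo; apply/integrableP; split.
  by move: (measurable_epow (rmeas_emeas mf)).
under eq_integral => t _ do rewrite gee0_abs ?lee_fin ?powR_ge0//.
rewrite -rnorm_powE; exact: poweR_lty.
Qed.

(** Dominated convergence for the powers |f_n|^p, with |g|^p as dominating function. *)
Lemma rnorm_cvg0 (f : (circle R -> R)^nat) g :
  (forall n, rmeas (f n)) -> rmeas g -> (rnorm g < +oo)%E ->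
  (forall n z, `|f n z| <= `|g z|) ->
  {ae mu, forall t, arc t -> f n (expi t) @[n --> \oo] --> 0} ->
  rnorm (f n) @[n --> \oo] --> 0%E.
Proof.
move=> mf mg goo fg f0.
have pow0 (u : R^nat) : u n @[n --> \oo] --> 0 -> `|u n| `^ p @[n --> \oo] --> 0.
  move=> u0; have nu0 : `|u n| @[n --> \oo] --> 0 by rewrite -(normr0 R); exact: cvg_norm.
  apply: (squeeze_cvgr _ (cvg_cst 0) nu0); near=> n.
  rewrite powR_ge0/=; have [->|un0] := eqVneq (u n) 0.
    by rewrite normr0 powR0.
  rewrite ge1r_powR// normr_gt0 un0/=.
  by near: n; apply: (cvgr_le _ nu0).
have fn0 : {ae mu, forall t, arc t -> (`|f n (expi t)| `^ p)%:E @[n --> \oo] --> 0%E}.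
  apply: (@filterS _ _ (ae_filter_ringOfSetsType mu) _ _ _ f0) => t H at_.
  by apply: cvg_EFin; [exact: nearW|exact/pow0/H].
have fgp : {ae mu, forall t n, arc t -> (`|(`|f n (expi t)| `^ p)%:E| <= (`|g (expi t)| `^ p)%:E)%E}.
  apply: aeW => t n _; rewrite lee_fin ger0_norm ?powR_ge0//.
  by rewrite ge0_ler_powR ?(ltW p_gt0) ?nnegrE.
have [_ _] := @dominated_convergence _ _ _ mu arc arc_meas
  (fun n t => (`|f n (expi t)| `^ p)%:E) (cst 0%E) (fun t => (`|g (expi t)| `^ p)%:E)
  (fun n => measurable_epow (rmeas_emeas (mf n))) (measurable_cst _)
  fn0 (rnorm_pow_integrable mg goo) fgp.
rewrite integral0.
have I0 n : (0 <= \int[mu]_(t in arc) (`|f n (expi t)| `^ p)%:E)%E.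
  by apply: integral_ge0 => t _; rewrite lee_fin powR_ge0.
move=> Ic0; have Ic := (cvge0P I0).1 Ic0.
apply/cvge0P => [n|e e0]; first exact: rnorm_ge0.
have := Ic _ (powR_gt0 p e0); apply: filterS => n In.
rewrite rnorm_root; apply: (@le_trans _ _ ((e `^ p)%:E `^ p^-1)%E).
  apply: gt0_ler_poweR In; first by rewrite invr_ge0 ltW.
  - by rewrite in_itv/= I0 leey.
  - by rewrite in_itv/= leey lee_fin powR_ge0.
by rewrite poweR_EFin -powRrM divff// powRr1// ltW.
Unshelve. all: by end_near. Qed.

End circle_norm.

Section complex_circle_norm.
Variables (R : realType) (p : R).
Hypothesis p_ge1 : 1 <= p.
Local Notation mu := (@lebesgue_measure R).
Local Notation arc := (`[0, 2 * pi]%classic : set R).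
Implicit Types (f g h : circle R -> R[i]) (c : R[i]).

Definition cmeas h := rmeas (fun z => complex.Re (h z)) /\ rmeas (fun z => complex.Im (h z)).

Lemma cmeas_cst c : cmeas (fun=> c).
Proof. by split; exact: measurable_cst. Qed.

Lemma cmeasD f g : cmeas f -> cmeas g -> cmeas (fun z => f z + g z).
Proof.
move=> [f1 f2] [g1 g2]; split; rewrite /rmeas.
  by under eq_fun do rewrite raddfD; exact: measurable_funD.
by under eq_fun do rewrite raddfD; exact: measurable_funD.
Qed.

Lemma cmeasM f g : cmeas f -> cmeas g -> cmeas (fun z => f z * g z).
Proof.
move=> [f1 f2] [g1 g2]; split; rewrite /rmeas.
  have -> : (fun t => complex.Re (f (expi t) * g (expi t))) =
     (fun t => complex.Re (f (expi t)) * complex.Re (g (expi t)) -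
               complex.Im (f (expi t)) * complex.Im (g (expi t))).
    by apply/funext => t; case: (f _) (g _) => [a b] [a' b'].
  by apply: measurable_funB; exact: measurable_funM.
have -> : (fun t => complex.Im (f (expi t) * g (expi t))) =
   (fun t => complex.Re (f (expi t)) * complex.Im (g (expi t)) +
             complex.Im (f (expi t)) * complex.Re (g (expi t))).
  by apply/funext => t; case: (f _) (g _) => [a b] [a' b'].
by apply: measurable_funD; exact: measurable_funM.
Qed.

Lemma cmeasZ c f : cmeas f -> cmeas (fun z => c * f z).
Proof. by apply: cmeasM; exact: cmeas_cst. Qed.

Lemma cmeasN f : cmeas f -> cmeas (fun z => - f z).
Proof.
move=> /(cmeasZ (-1)); congr cmeas.
by apply/funext => z; rewrite mulN1r.
Qed.

Lemma cmeasB f g : cmeas f -> cmeas g -> cmeas (fun z => f z - g z).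
Proof. by move=> mf mg; apply: cmeasD => //; exact: cmeasN. Qed.

Lemma cmeas_sum (I : Type) (s : seq I) (P : pred I) (f : I -> circle R -> R[i]) :
  (forall i, cmeas (f i)) -> cmeas (fun z => \sum_(i <- s | P i) f i z).
Proof.
move=> mf; elim: s => [|i s IH].
  have -> : (fun z => \sum_(i <- [::] | P i) f i z) = fun=> 0.
    by apply/funext => z; rewrite big_nil.
  exact: cmeas_cst.
have [Pi|nPi] := boolP (P i); last first.
  have -> // : (fun z => \sum_(j <- i :: s | P j) f j z) = fun z => \sum_(j <- s | P j) f j z.
  by apply/funext => z; rewrite big_cons (negbTE nPi).
have -> : (fun z => \sum_(j <- i :: s | P j) f j z) =
    fun z => f i z + \sum_(j <- s | P j) f j z.
  by apply/funext => z; rewrite big_cons Pi.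
exact: cmeasD.
Qed.

Lemma rmeas_cabs f : cmeas f -> rmeas (fun z => cabs (f z)).
Proof.
move=> [f1 f2]; rewrite /rmeas; under eq_fun do rewrite cabsE.
apply: (@measurableT_comp _ _ _ _ _ _ (@Num.sqrt R)).
  by apply: continuous_measurable_fun; exact: sqrt_continuous.
by apply: measurable_funD; exact: measurable_funX.
Qed.

Lemma rmeas_powR (u : circle R -> R) (r : R) : rmeas u -> rmeas (fun z => u z `^ r).
Proof. by move=> mu; exact: (measurableT_comp (measurable_powR r) mu). Qed.

Lemma rmeas_cabs_powR f (r : R) : cmeas f -> rmeas (fun z => cabs (f z) `^ r).
Proof. by move=> mf; exact: (rmeas_powR r (rmeas_cabs mf)). Qed.

(** Only a seminorm, as null functions are kept; almost everywhere equality is expressed below by a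
    difference of [cnorm] zero. *)
Definition cnorm f : \bar R := rnorm p (fun z => cabs (f z)).

Lemma LpTE f : LpT p f <-> cmeas f /\ (cnorm f < +oo)%E.
Proof. by split=> [[]|[[]]]. Qed.

Lemma LpT_cmeas f : LpT p f -> cmeas f. Proof. by case/LpTE. Qed.
Lemma LpT_lty f : LpT p f -> (cnorm f < +oo)%E. Proof. by case/LpTE. Qed.

Lemma cnorm_ge0 f : (0 <= cnorm f)%E. Proof. exact: rnorm_ge0. Qed.

Lemma LpT_fin f : LpT p f -> cnorm f \is a fin_num.
Proof. by move=> /LpT_lty; rewrite ge0_fin_numE// cnorm_ge0. Qed.

Lemma cnorm_le f (g : circle R -> R) : cmeas f -> rmeas g ->
  (forall z, cabs (f z) <= `|g z|) -> (cnorm f <= rnorm p g)%E.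
Proof.
move=> mf mg fg; apply: rnorm_le => //; first exact: rmeas_cabs.
by move=> z; rewrite ger0_norm ?cabs_ge0.
Qed.

Lemma le_cnorm f g : cmeas f -> cmeas g ->
  (forall z, cabs (f z) <= cabs (g z)) -> (cnorm f <= cnorm g)%E.
Proof.
move=> mf mg fg; apply: cnorm_le => //; first exact: rmeas_cabs.
by move=> z; rewrite ger0_norm ?cabs_ge0.
Qed.

Lemma cnormD f g : cmeas f -> cmeas g ->
  (cnorm (fun z => f z + g z)%R <= cnorm f + cnorm g)%E.
Proof.
move=> mf mg; have mf' := rmeas_cabs mf; have mg' := rmeas_cabs mg.
apply: le_trans (rnormD p_ge1 mf' mg'); apply: cnorm_le.
- exact: cmeasD.
- exact: measurable_funD.
- by move=> z; rewrite ger0_norm ?addr_ge0 ?cabs_ge0// cabsD.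
Qed.

Lemma cnormZ c f : cmeas f -> cnorm (fun z => c * f z) = ((cabs c)%:E * cnorm f)%E.
Proof.
move=> mf; rewrite /cnorm -[in RHS](ger0_norm (cabs_ge0 c)).
rewrite -(rnormZ p_ge1 _ (rmeas_cabs mf)); congr rnorm; apply/funext => z.
by rewrite cabsM.
Qed.

Lemma cnormN f : cnorm (fun z => - f z) = cnorm f.
Proof. by congr rnorm; apply/funext => z; rewrite cabsN. Qed.

Lemma cnormBC f g : cnorm (fun z => f z - g z) = cnorm (fun z => g z - f z).
Proof. by congr rnorm; apply/funext => z; rewrite cabsB. Qed.

Lemma cnormB f g : cmeas f -> cmeas g ->
  (cnorm (fun z => f z - g z)%R <= cnorm f + cnorm g)%E.
Proof.
move=> mf mg; apply: le_trans (cnormD mf (cmeasN mg)) _.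
by rewrite cnormN.
Qed.

Lemma cnorm_triangle f g h : cmeas f -> cmeas g -> cmeas h ->
  (cnorm (fun z => f z - h z)%R <=
   cnorm (fun z => f z - g z)%R + cnorm (fun z => g z - h z)%R)%E.
Proof.
move=> mf mg mh; apply: le_trans (cnormD (cmeasB mf mg) (cmeasB mg mh)).
apply: le_cnorm; [exact: cmeasB|by apply: cmeasD; exact: cmeasB|].
by move=> z; rewrite addrA subrK.
Qed.

Lemma cnorm0 : cnorm (fun=> 0) = 0%E.
Proof.
rewrite /cnorm (_ : (fun=> cabs 0) = fun=> 0 * 0); last first.
  by apply/funext => z; rewrite cabs0 mul0r.
have m0 : rmeas (fun=> 0 : R) by exact: measurable_cst.
by rewrite (rnormZ p_ge1 0 m0) normr0 mul0e.
Qed.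

Lemma cnorm_sum (I : Type) (s : seq I) (f : I -> circle R -> R[i]) :
  (forall i, cmeas (f i)) ->
  (cnorm (fun z => \sum_(i <- s) f i z)%R <= \sum_(i <- s) cnorm (f i))%E.
Proof.
move=> mf; elim: s => [|i s IH].
  rewrite big_nil (_ : (fun z => \sum_(i <- [::]) f i z) = fun=> 0) ?cnorm0//.
  by apply/funext => z; rewrite big_nil.
rewrite big_cons (_ : (fun z => \sum_(j <- i :: s) f j z) =
    fun z => f i z + \sum_(j <- s) f j z); last first.
  by apply/funext => z; rewrite big_cons.
apply: le_trans (cnormD (mf i) (cmeas_sum _ _ mf)) _.
by rewrite leeD2l.
Qed.

Lemma LpT0 : LpT p (fun=> 0 : R[i]).
Proof. by apply/LpTE; rewrite cnorm0; split => //; exact: cmeas_cst. Qed.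

Lemma LpTD f g : LpT p f -> LpT p g -> LpT p (fun z => f z + g z).
Proof.
move=> /LpTE[mf fo] /LpTE[mg go]; apply/LpTE; split; first exact: cmeasD.
by apply: le_lt_trans (cnormD mf mg) _; rewrite lte_add_pinfty.
Qed.

Lemma LpTZ c f : LpT p f -> LpT p (fun z => c * f z).
Proof.
move=> /LpTE[mf fo]; apply/LpTE; split; first exact: cmeasZ.
by rewrite cnormZ// lte_mul_pinfty// lee_fin cabs_ge0.
Qed.

Lemma LpTN f : LpT p f -> LpT p (fun z => - f z).
Proof. move=> /(LpTZ (-1)); congr (LpT _ _).
by apply/funext => z; rewrite mulN1r. Qed.

Lemma LpTB f g : LpT p f -> LpT p g -> LpT p (fun z => f z - g z).
Proof. by move=> Lf Lg; apply: LpTD => //; exact: LpTN. Qed.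

Lemma LpT_sum (I : Type) (s : seq I) (f : I -> circle R -> R[i]) :
  (forall i, LpT p (f i)) -> LpT p (fun z => \sum_(i <- s) f i z).
Proof.
move=> Lf; elim: s => [|i s IH].
  rewrite (_ : (fun z => \sum_(i <- [::]) f i z) = fun=> 0); first exact: LpT0.
  by apply/funext => z; rewrite big_nil.
rewrite (_ : (fun z => \sum_(j <- i :: s) f j z) =
    fun z => f i z + \sum_(j <- s) f j z); first exact: LpTD.
by apply/funext => z; rewrite big_cons.
Qed.

Lemma LpT_le f g : cmeas f -> LpT p g -> (forall z, cabs (f z) <= cabs (g z)) -> LpT p f.
Proof.
move=> mf /LpTE[mg go] fg; apply/LpTE; split => //.
exact: le_lt_trans (le_cnorm mf mg fg) go.
Qed.

Lemma mu_arc : mu arc = (2 * pi)%:E.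
Proof.
rewrite lebesgue_measure_itv/= lte_fin mulr_gt0 ?pi_gt0//.
by rewrite -EFinB subr0.
Qed.

Lemma rnorm_cst (M : R) : (rnorm p (fun=> M) < +oo)%E.
Proof.
rewrite rnorm_root//; apply: poweR_lty.
rewrite integral_cst; last exact: arc_meas.
by rewrite [X in (_ * X)%E]mu_arc -EFinM ltry.
Qed.

Lemma LpT_bounded f (M : R) : cmeas f -> (forall z, cabs (f z) <= M) -> LpT p f.
Proof.
move=> mf fM; apply/LpTE; split => //; apply: le_lt_trans (rnorm_cst M).
apply: cnorm_le => //; first exact: measurable_cst.
by move=> z; apply: le_trans (fM z) (ler_norm _).
Qed.

End complex_circle_norm.

(** * Rounding to finitely many values *)

Section quantization.
Variable R : realType.
Implicit Types (x : R) (z : R[i]) (m : nat).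

(* Rounding towards 0 to a multiple of 1 / m.+1, with cut-off at m.+1; the second
   component is the sign. *)
Definition qcodeR m x : 'I_(m.+1 * m.+1).+1 * bool :=
  (inord (minn (Num.truncn (m.+1%:R * `|x|)) (m.+1 * m.+1)), x < 0).

Definition qdecR m (c : 'I_(m.+1 * m.+1).+1 * bool) : R :=
  (-1) ^+ c.2 * (c.1%:R / m.+1%:R).

Lemma qdecRE m x : qdecR (qcodeR m x) =
  (-1) ^+ (x < 0)%R * ((minn (Num.truncn (m.+1%:R * `|x|)) (m.+1 * m.+1))%:R / m.+1%:R).
Proof. by rewrite /qdecR/= inordK// ltnS geq_minr. Qed.

Lemma qdecR_le m x : `|qdecR (qcodeR m x)| <= `|x|.
Proof.
have m0 : 0 < m.+1%:R :> R by rewrite ltr0n.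
have mx0 : 0 <= m.+1%:R * `|x| by rewrite mulr_ge0.
rewrite qdecRE normrM normrX normrN1 expr1n mul1r ger0_norm ?divr_ge0//.
have /andP[t1 _] := truncn_itv mx0.
rewrite ler_pdivrMr// [leRHS]mulrC; apply: le_trans t1.
by rewrite ler_nat geq_minl.
Qed.

Lemma qdecR_near m x : `|x| <= m.+1%:R -> `|qdecR (qcodeR m x) - x| <= m.+1%:R^-1.
Proof.
move=> xm; have m0 : 0 < m.+1%:R :> R by rewrite ltr0n.
have mx0 : 0 <= m.+1%:R * `|x| by rewrite mulr_ge0.
have /andP[t1 t2] := truncn_itv mx0.
rewrite qdecRE (minn_idPl _); last first.
  rewrite -(ler_nat R) (le_trans t1)// natrM ler_wpM2l// ltW//.
have xE : x = (-1) ^+ (x < 0)%R * `|x|.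
  by exact: realEsign (num_real x).
rewrite {3}xE -mulrBr normrM normrX normrN1 expr1n mul1r distrC ger0_norm; last first.
  by rewrite subr_ge0 ler_pdivrMr// [leRHS]mulrC.
rewrite lerBlDl -(ler_pM2l m0) mulrDr mulrCA divff ?gt_eqF// mulr1.
by rewrite natr1 ltW.
Qed.

Lemma measurable_qcodeR m c : measurable [set x : R | qcodeR m x = c].
Proof.
case: c => i b.
have m0 : 0 < m.+1%:R :> R by rewrite ltr0n.
(* The last cell collects everything beyond the cut-off, hence the half-line in place of a bounded
   interval. *)
have -> : [set x | qcodeR m x = (i, b)] =
   ((fun x : R => x < 0) @^-1` [set b]) `&`
   ((fun x : R => m.+1%:R * `|x|) @^-1`
     ((if (i < m.+1 * m.+1)%N then `[i%:R, i.+1%:R[%classic else `[i%:R, +oo[%classic) : set R)).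
  apply/seteqP; split => x /=; rewrite /qcodeR.
  - move=> [/(congr1 val)/= + <-].
    rewrite inordK ?ltnS ?geq_minr// => iE; split => //.
    have mx0 : 0 <= m.+1%:R * `|x| by rewrite mulr_ge0.
    have /andP[t1 t2] := truncn_itv mx0.
    case: ifPn => iL /=; rewrite in_itv/= ?andbT.
      move: iE; rewrite /minn; case: ifP => _ iE; first by rewrite -iE t1 t2.
      by move: iL; rewrite -iE ltnn.
    by apply: le_trans t1; rewrite ler_nat -iE geq_minl.
  move=> [-> H]; congr pair; apply/val_inj => /=; rewrite inordK ?ltnS ?geq_minr//.
  have mx0 : 0 <= m.+1%:R * `|x| by rewrite mulr_ge0.
  move: H; case: ifPn => iL /=; rewrite in_itv/= ?andbT.
    move=> H; have /eqP -> : Num.truncn (m.+1%:R * `|x|) == i by rewrite truncn_eq.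
    by apply/minn_idPl; exact: ltnW.
  move=> H; have iE : i = (m.+1 * m.+1)%N :> nat.
    by apply/eqP; rewrite eqn_leq -ltnS ltn_ord/= leqNgt.
  by rewrite iE; apply/minn_idPr; rewrite truncn_ge_nat// -iE.
apply: measurableI.
  rewrite -[X in measurable X]setTI.
  have : measurable_fun setT (fun x : R => x < 0) by exact: measurable_fun_ltr.
  by apply.
rewrite -[X in measurable X]setTI.
have : measurable_fun setT (fun x : R => m.+1%:R * `|x|).
  by apply: measurable_funM => //; exact: measurableT_comp.
apply => //; case: ifP => _; exact: measurable_itv.
Qed.

Definition qidx m : finType :=
  (('I_(m.+1 * m.+1).+1 * bool) * ('I_(m.+1 * m.+1).+1 * bool))%type.

Definition qcode m z : qidx m := (qcodeR m (complex.Re z), qcodeR m (complex.Im z)).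

Definition qdec m (c : qidx m) : R[i] := qdecR c.1 +i* qdecR c.2.

(** Rounding towards 0 is chosen for this property: it supplies the dominating function for
    convergence, keeps null functions null and does not increase the norm of an input. *)
Lemma qdec_le m z : cabs (qdec (qcode m z)) <= cabs z.
Proof.
rewrite !cabsE ler_wsqrtr// lerD// -real_normK ?num_real// -[leRHS]real_normK ?num_real//;
  by rewrite lerXn2r ?nnegrE//; exact: qdecR_le.
Qed.

Lemma cabs_le_ReIm z : cabs z <= `|complex.Re z| + `|complex.Im z|.
Proof.
rewrite -(@ler_pXn2r _ 2)// ?nnegrE ?addr_ge0 ?cabs_ge0//.
rewrite sqr_cabs sqrrD !real_normK ?num_real// addrAC lerDl.
by rewrite mulrn_wge0// mulr_ge0.
Qed.

Lemma Re_le_cabs z : `|complex.Re z| <= cabs z.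
Proof. by rewrite cabsE -sqrtr_sqr ler_wsqrtr// lerDl sqr_ge0. Qed.

Lemma Im_le_cabs z : `|complex.Im z| <= cabs z.
Proof. by rewrite cabsE -sqrtr_sqr ler_wsqrtr// lerDr sqr_ge0. Qed.

Lemma qdec_cvg z : cabs (qdec (qcode m z) - z) @[m --> \oo] --> 0.
Proof.
apply/cvgrPdist_le => e e0; near=> m.
rewrite sub0r normrN ger0_norm ?cabs_ge0//.
apply: le_trans (cabs_le_ReIm _) _; rewrite !raddfB/=.
have zm : cabs z <= m.+1%:R.
  apply: (@le_trans _ _ m%:R); last by rewrite ler_nat.
  by near: m; exact: nbhs_infty_ger.
apply: (@le_trans _ _ (m.+1%:R^-1 + m.+1%:R^-1)).
  by rewrite lerD// qdecR_near// (le_trans _ zm)// ?Re_le_cabs ?Im_le_cabs.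
rewrite [leRHS]splitr.
by rewrite lerD// ltW//; near: m;
  have := @near_infty_natSinv_lt R (PosNum (divr_gt0 e0 (@ltr0Sn R 1))).
Unshelve. all: by end_near. Qed.

End quantization.

(** * Functions that depend on a finite measurable index *)

Section finite_index.
Variables (R : realType) (p : R).
Hypothesis p_ge1 : 1 <= p.
Local Notation mu := (@lebesgue_measure R).
Local Notation arc := (`[0, 2 * pi]%classic : set R).

Definition imeas (I : finType) (idx : circle R -> I) :=
  forall i, measurable ([set t | idx (expi t) = i] : set R).

Lemma imeas_qcode m (h : circle R -> R[i]) : cmeas h -> imeas (fun z => qcode m (h z)).
Proof.
move=> [h1 h2] [c1 c2].
have -> : [set t | qcode m (h (expi t)) = (c1, c2)] =
   ((fun t => complex.Re (h (expi t))) @^-1` [set x | qcodeR m x = c1]) `&`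
   ((fun t => complex.Im (h (expi t))) @^-1` [set x | qcodeR m x = c2]).
  by apply/seteqP; split => t /=; rewrite /qcode; [case|case=> -> ->].
apply: measurableI; rewrite -[X in measurable X]setTI.
  by apply: h1 => //; exact: measurable_qcodeR.
by apply: h2 => //; exact: measurable_qcodeR.
Qed.

(** Finitely many rounded functions become functions of one common index. *)
Lemma imeas_ffun (K I : finType) (idx : K -> circle R -> I) :
  (forall k, imeas (idx k)) -> imeas (fun z => [ffun k => idx k z]).
Proof.
move=> mi c.
have -> : [set t | [ffun k => idx k (expi t)] = c] =
    \big[setI/setT]_(k : K) [set t | idx k (expi t) = c k].
  rewrite -bigcap_seq; apply/seteqP; split => t /= H.
    by move=> k _ /=; rewrite -H ffunE.
  by apply/ffunP => k; rewrite ffunE; apply: (H k); rewrite /= mem_index_enum.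
by apply: bigsetI_measurable => k _; exact: mi.
Qed.

Variables (I : finType) (idx : circle R -> I).
Hypothesis midx : imeas idx.

Lemma rmeas_index (phi : I -> R) : rmeas (fun z => phi (idx z)).
Proof.
rewrite /rmeas (_ : (fun t => phi (idx (expi t))) =
    fun t => \sum_i phi i * \1_[set t | idx (expi t) = i] t); last first.
  apply/funext => t; rewrite (bigD1 (idx (expi t)))//= indicE mem_set// mulr1.
  rewrite big1 ?addr0// => i it; rewrite indicE memNset ?mulr0//= => ti.
  by move: it; rewrite ti eqxx.
apply: measurable_sum => i; apply: measurable_funM => //.
Qed.

Lemma cmeas_index (phi : I -> R[i]) : cmeas (fun z => phi (idx z)).
Proof.
by split; [exact: (rmeas_index (fun i => complex.Re (phi i)))|
  exact: (rmeas_index (fun i => complex.Im (phi i)))].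
Qed.

Definition weight (i : I) : R := fine (mu (arc `&` [set t | idx (expi t) = i])).

Lemma weight_ge0 i : 0 <= weight i.
Proof. by rewrite fine_ge0. Qed.

Lemma weightE i : mu (arc `&` [set t | idx (expi t) = i]) = (weight i)%:E.
Proof.
rewrite fineK// ge0_fin_numE//; apply: (@le_lt_trans _ _ (mu arc)).
  apply: le_measure; rewrite ?inE; [|exact: arc_meas|exact: subIsetl].
  by apply: measurableI => //; exact: midx.
by rewrite mu_arc ltry.
Qed.

Lemma integral_index (phi : I -> R) : (forall i, 0 <= phi i) ->
  (\int[mu]_(t in arc) (phi (idx (expi t)))%:E = (\sum_i weight i * phi i)%:E)%E.
Proof.
move=> phi0; transitivity (\int[mu]_(t in arc)
    (\sum_i (phi i)%:E * (\1_([set t | idx (expi t) = i] : set R) t)%:E))%E.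
  apply: eq_integral => t _; rewrite (bigD1 (idx (expi t)))//= indicE mem_set// mule1.
  rewrite big1 ?adde0// => i it; rewrite indicE memNset ?mule0//= => ti.
  by move: it; rewrite ti eqxx.
have mI i : measurable_fun arc (fun t => (\1_[set t | idx (expi t) = i] t)%:E : \bar R).
  by apply/measurable_EFinP; apply: measurable_indic; exact: midx.
rewrite ge0_integral_sum//=.
- rewrite -sumEFin; apply: eq_bigr => i _.
  rewrite ge0_integralZl_EFin//; last exact: mI.
  rewrite integral_indic//; last exact: midx.
  by rewrite setIC [X in (_ * X)%E]weightE -EFinM mulrC.
- by move=> i; apply: emeasurable_funM; [exact: measurable_cst|exact: mI].
- by move=> i t _; rewrite mule_ge0// lee_fin.
Qed.

(** This is the passage between functions on the circle and weighted finite sums: the level sets of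
    the index carry their lengths as weights. *)
Lemma rnorm_index (phi : I -> R) : (forall i, 0 <= phi i) ->
  rnorm p (fun z => phi (idx z)) = ((\sum_i weight i * phi i `^ p) `^ p^-1)%:E.
Proof.
move=> phi0; rewrite rnorm_root//.
under eq_integral do rewrite ger0_norm//.
by rewrite (integral_index (phi := fun i => phi i `^ p))// => i; exact: powR_ge0.
Qed.

End finite_index.

Lemma cnorm_qdec_cvg (R : realType) (p : R) (f : circle R -> R[i]) : 1 <= p -> LpT p f ->
  cnorm p (fun z => qdec R (qcode m (f z)) - f z) @[m --> \oo] --> 0%E.
Proof.
move=> p_ge1 Lf; have mf := LpT_cmeas Lf.
have mq m : cmeas (fun z => qdec R (qcode m (f z))).
  exact: (cmeas_index (imeas_qcode (m := m) mf) (@qdec R m)).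
apply: (@rnorm_cvg0 R p p_ge1 (fun m z => cabs (qdec R (qcode m (f z)) - f z))
  (fun z => 2 * cabs (f z))).
- by move=> m; apply: rmeas_cabs; exact: cmeasB.
- by apply: measurable_funM => //; exact: (rmeas_cabs mf).
- rewrite (rnormZ p_ge1 _ (rmeas_cabs mf)) lte_mul_pinfty ?lee_fin//.
  exact: LpT_lty Lf.
- move=> m z; rewrite ger0_norm ?cabs_ge0// ger0_norm ?mulr_ge0 ?cabs_ge0//.
  apply: le_trans (cabsD _ _) _; rewrite cabsN mulrDl mul1r lerD2r.
  exact: qdec_le.
- by apply: aeW => t _; exact: qdec_cvg.
Qed.

Lemma ler_norm2 (R : realDomainType) (a b : R) : 0 <= a -> a <= b -> `|a| <= `|b|.
Proof. by move=> a0 ab; rewrite !ger0_norm// (le_trans a0). Qed.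

(** * Finite l^s norms and their triangle inequality *)

Section finite_lsnorm.
Variables (R : realType) (s : R) (K : finType).
Hypothesis s_gt1 : 1 < s.

Let s_gt0 : 0 < s. Proof. exact: lt_trans s_gt1. Qed.

Definition fls (x : K -> R[i]) : R := (\sum_k cabs (x k) `^ s) `^ s^-1.

Lemma fls_ge0 x : 0 <= fls x. Proof. exact: powR_ge0. Qed.

Lemma norm_fls x : `|fls x| = fls x.
Proof. exact: ger0_norm (fls_ge0 x). Qed.

Let powR_le (a b r : R) : 0 <= r -> 0 <= a -> a <= b -> a `^ r <= b `^ r.
Proof. by move=> r0 a0 ab; rewrite ge0_ler_powR ?nnegrE// (le_trans a0). Qed.

Let sum_pow_ge0 (a : K -> R) : 0 <= \sum_k a k `^ s.
Proof. by apply: sumr_ge0 => k _; exact: powR_ge0. Qed.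

Lemma le_fls x k : cabs (x k) <= fls x.
Proof.
rewrite -[leLHS]powRr1 ?cabs_ge0// -(divff (lt0r_neq0 s_gt0)) powRrM.
apply: powR_le; rewrite ?invr_ge0 ?(ltW s_gt0) ?powR_ge0//.
by rewrite (bigD1 k)//= lerDl sumr_ge0// => i _; exact: powR_ge0.
Qed.

Lemma fls_le x y : (forall k, cabs (x k) <= cabs (y k)) -> fls x <= fls y.
Proof.
move=> xy; apply: powR_le; rewrite ?invr_ge0 ?(ltW s_gt0)//.
by apply: ler_sum => k _; rewrite powR_le ?cabs_ge0// ltW.
Qed.

Let pow_split (a : R) : 0 <= a -> a `^ s = a * a `^ (s - 1).
Proof. by move=> a0; rewrite mulr_powRB1. Qed.

(** The power (a + b)^s is split as a (a + b)^(s-1) + b (a + b)^(s-1). Hoelder's inequality with (s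
    - 1) s' = s bounds both sums, and S^(1/s') is divided out. *)
Lemma minkowski_sum (a b : K -> R) : (forall k, 0 <= a k) -> (forall k, 0 <= b k) ->
  (\sum_k (a k + b k) `^ s) `^ s^-1 <=
  (\sum_k a k `^ s) `^ s^-1 + (\sum_k b k `^ s) `^ s^-1.
Proof.
move=> a0 b0.
pose s' := s / (s - 1).
have s'0 : 0 < s' by rewrite divr_gt0 ?subr_gt0.
have ss' : s^-1 + s'^-1 = 1.
  by rewrite invf_div -[X in X + _]mul1r -mulrDl [1 + _]addrC subrK divff// gt_eqF.
have s1s' : (s - 1) * s' = s by rewrite mulrC divfK// subr_eq0 gt_eqF.
move: s' s'0 ss' s1s' => s' s'0 ss' s1s'.
have hol (c : K -> R) : (forall k, 0 <= c k) ->
    \sum_k c k * (a k + b k) `^ (s - 1) <=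
    (\sum_k c k `^ s) `^ s^-1 * (\sum_k (a k + b k) `^ s) `^ s'^-1.
  move=> c0.
  have := @hoelder_sum R K (fun=> 1) c (fun k => (a k + b k) `^ (s - 1)) s s'
    s_gt0 s'0 ss' (fun=> ler01) c0 (fun k => powR_ge0 _ _).
  under eq_bigr do rewrite mul1r.
  under [X in _ <= X `^ _ * _ -> _]eq_bigr do rewrite mul1r.
  by under [X in _ <= _ * X `^ _ -> _]eq_bigr do rewrite mul1r -powRrM s1s'.
set S := \sum_k (a k + b k) `^ s.
have S0 : 0 <= S by exact: sum_pow_ge0.
have [S_eq0|S_neq0] := eqVneq S 0.
  by rewrite S_eq0 powR0 ?invr_eq0 ?gt_eqF// addr_ge0 ?powR_ge0.
have Sgt0 : 0 < S by rewrite lt_neqAle eq_sym S_neq0.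
have : S <= ((\sum_k a k `^ s) `^ s^-1 + (\sum_k b k `^ s) `^ s^-1) * S `^ s'^-1.
  rewrite mulrDl; apply: le_trans (lerD (hol a a0) (hol b b0)).
  rewrite -big_split/= /S; apply: ler_sum => k _.
  by rewrite pow_split ?addr_ge0// mulrDl.
move: (_ + _) S Sgt0 S_neq0 {S0} => T S Sgt0 S_neq0.
rewrite -[X in X <= _](powRr1 (ltW Sgt0)) -[X in S `^ X <= _]ss' powRD; last by rewrite S_neq0 implybT.
by rewrite ler_pM2r// powR_gt0.
Qed.

(** Each [b k] is at most the whole sum T, so b_k^s <= b_k T^(s-1). *)
Lemma pow_sum_le (b : K -> R) : (forall k, 0 <= b k) ->
  (\sum_k b k `^ s) `^ s^-1 <= \sum_k b k.
Proof.
move=> b0; have S0 : 0 <= \sum_k b k by exact: sumr_ge0.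
apply: (@le_trans _ _ (((\sum_k b k) `^ s) `^ s^-1)); last first.
  by rewrite -powRrM divff ?powRr1// gt_eqF.
apply: powR_le; rewrite ?invr_ge0 ?(ltW s_gt0)//.
rewrite (pow_split S0) mulr_suml; apply: ler_sum => k _.
rewrite pow_split// ler_wpM2l// powR_le ?subr_ge0 ?(ltW s_gt1)//.
by rewrite (bigD1 k)//= lerDl sumr_ge0.
Qed.

(** The error is measured in l^1, which is affordable for finite [K]: its L^p norm then splits into
    the scalar norms of the single differences. *)
Lemma fls_triangle x y : fls x <= fls y + \sum_k cabs (x k - y k).
Proof.
apply: (@le_trans _ _ (fls y + (\sum_k cabs (x k - y k) `^ s) `^ s^-1)); last first.
  by rewrite lerD2l pow_sum_le// => k; exact: cabs_ge0.
apply: le_trans (minkowski_sum (fun k => cabs_ge0 _) (fun k => cabs_ge0 _)).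
apply: powR_le; rewrite ?invr_ge0 ?(ltW s_gt0)//.
apply: ler_sum => k _; apply: powR_le; rewrite ?cabs_ge0 ?(ltW s_gt0)//.
by apply: le_trans (cabsD _ _); rewrite addrC subrK.
Qed.

End finite_lsnorm.

Section fls_norm.
Variables (R : realType) (p s : R) (K : finType).
Hypotheses (p_ge1 : 1 <= p) (s_gt1 : 1 < s).
Implicit Types (x y : K -> circle R -> R[i]).

Lemma rmeas_fls x : (forall k, cmeas (x k)) -> rmeas (fun z => fls s (x ^~ z)).
Proof.
by move=> mx; apply: rmeas_powR; apply: measurable_sum => k; exact: rmeas_cabs_powR.
Qed.

Lemma rmeas_sum_cabs x : (forall k, cmeas (x k)) -> rmeas (fun z => \sum_k cabs (x k z)).
Proof. by move=> mx; apply: measurable_sum => k; exact: rmeas_cabs. Qed.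

Lemma rnorm_sum_cabs x : (forall k, cmeas (x k)) ->
  (rnorm p (fun z => \sum_k cabs (x k z))%R <= \sum_k cnorm p (x k))%E.
Proof.
move=> mx; elim: (index_enum K) => [|k l IH].
  rewrite big_nil (_ : (fun z => _) = fun z => cabs (0 : R[i])); first by rewrite [leLHS](cnorm0 p_ge1).
  by apply/funext => z; rewrite big_nil cabs0.
rewrite big_cons (_ : (fun z => _) = fun z => cabs (x k z) + \sum_(j <- l) cabs (x j z)); last first.
  by apply/funext => z; rewrite big_cons.
apply: le_trans (rnormD p_ge1 (rmeas_cabs (mx k)) _) _; last by rewrite leeD2l.
by apply: measurable_sum => j; exact: rmeas_cabs.
Qed.

Lemma rnorm_fls_triangle x y : (forall k, cmeas (x k)) -> (forall k, cmeas (y k)) ->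
  (rnorm p (fun z => fls s (x ^~ z)) <=
   rnorm p (fun z => fls s (y ^~ z)) + \sum_k cnorm p (fun z => x k z - y k z)%R)%E.
Proof.
move=> mx my; have mxy k : cmeas (fun z => x k z - y k z) by exact: cmeasB.
apply: le_trans (leeD2l _ (rnorm_sum_cabs mxy)).
apply: le_trans (rnormD p_ge1 (rmeas_fls my) (rmeas_sum_cabs mxy)).
apply: (rnorm_le p_ge1 (rmeas_fls mx)).
  by apply: measurable_funD; [exact: (rmeas_fls my)|exact: (rmeas_sum_cabs mxy)].
move=> z; rewrite norm_fls ger0_norm; first exact: fls_triangle.
by apply: addr_ge0; [exact: fls_ge0|apply: sumr_ge0 => k _; exact: cabs_ge0].
Qed.

Lemma rnorm_fls_le x y : (forall k, cmeas (x k)) -> (forall k, cmeas (y k)) ->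
  (forall k z, cabs (x k z) <= cabs (y k z)) ->
  (rnorm p (fun z => fls s (x ^~ z)) <= rnorm p (fun z => fls s (y ^~ z)))%E.
Proof.
move=> mx my xy; apply: (rnorm_le p_ge1 (rmeas_fls mx) (rmeas_fls my)) => z.
exact: (ler_norm2 (fls_ge0 s (x ^~ z)) (fls_le s_gt1 (xy ^~ z))).
Qed.

Lemma rnorm_fls_le_sum x : (forall k, cmeas (x k)) ->
  (rnorm p (fun z => fls s (x ^~ z)) <= \sum_k cnorm p (x k))%E.
Proof.
move=> mx; apply: le_trans (rnorm_sum_cabs mx).
apply: (rnorm_le p_ge1 (rmeas_fls mx) (rmeas_sum_cabs mx)) => z.
rewrite norm_fls ger0_norm; last by apply: sumr_ge0 => k _; exact: cabs_ge0.
by apply: pow_sum_le => // k; exact: cabs_ge0.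
Qed.

End fls_norm.

Lemma cnorm_approx (R : realType) (p : R) (f g : circle R -> R[i]) : 1 <= p ->
  cmeas f -> cmeas g ->
  (cnorm p f <= cnorm p g + cnorm p (fun z => g z - f z)%R)%E.
Proof.
move=> p1 mf mg; rewrite [X in (_ <= _ + X)%E]cnormBC.
apply: le_trans (cnormD p1 mg (cmeasB mf mg)); apply: le_cnorm => //.
  by apply: cmeasD => //; exact: cmeasB.
by move=> z; rewrite addrC subrK.
Qed.

Lemma le_weight_root (R : realType) (p w c B : R) : 0 < p -> 0 < w -> 0 <= c ->
  w * c `^ p <= B -> c <= w `^ (- p^-1) * B `^ p^-1.
Proof.
move=> p0 w0 c0 wcB; rewrite powRN ler_pdivlMl ?powR_gt0//.
have {1}-> : c = (c `^ p) `^ p^-1 by rewrite -powRrM divff ?gt_eqF// powRr1.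
have wc0 : 0 <= w * c `^ p by rewrite mulr_ge0 ?powR_ge0// ltW.
rewrite -powRM ?powR_ge0 ?(ltW w0)//.
by rewrite ge0_ler_powR ?invr_ge0 ?(ltW p0) ?nnegrE// (le_trans wc0).
Qed.

(** * Extension to l^s-valued functions *)

Section vector_extension.
Variables (R : realType) (p s C : R).
Hypothesis hps : (2 <= s /\ s <= p) \/ (1 < p /\ p <= s /\ s <= 2).
Hypothesis C_ge0 : 0 <= C.
Variable P : (circle R -> R[i]) -> circle R -> R[i].
Hypothesis P_Lp : forall f, LpT p f -> LpT p (P f).
Hypothesis P_bd : forall f, LpT p f -> (cnorm p (P f) <= C%:E * cnorm p f)%E.
(** Additivity and homogeneity in seminorm only, since [P] stands for a map that picks
    representatives. *)
Hypothesis P_lin : forall a f g, LpT p f -> LpT p g ->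
  cnorm p (fun z => P (fun z => a * f z + g z) z - (a * P f z + P g z)) = 0%E.

Let p_gt1 : 1 < p. Proof. by have [] := exponents_gt1 hps. Qed.
Let s_gt1 : 1 < s. Proof. by have [] := exponents_gt1 hps. Qed.
Let p_ge1 : 1 <= p. Proof. exact: ltW. Qed.
Let p_gt0 : 0 < p. Proof. exact: lt_trans p_gt1. Qed.

Let P_meas f : LpT p f -> cmeas (P f).
Proof. by move=> Lf; apply: LpT_cmeas; exact: P_Lp Lf. Qed.

Lemma P_sub f g : LpT p f -> LpT p g ->
  (cnorm p (fun z => P f z - P g z)%R <= C%:E * cnorm p (fun z => f z - g z)%R)%E.
Proof.
move=> Lf Lg; have := P_lin (-1) Lg Lf.
set h := fun z => -1 * g z + f z.
have Lh : LpT p h by apply: LpTD => //; exact: LpTZ.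
have hE : cnorm p h = cnorm p (fun z => f z - g z).
  by congr cnorm; apply/funext => z; rewrite /h mulN1r addrC.
rewrite -hE => P0; apply: le_trans (P_bd Lh).
have mPf := P_meas Lf; have mPg := P_meas Lg; have mPh := P_meas Lh.
rewrite -[leRHS]adde0 -[X in (_ <= _ + X)%E]P0 [X in (_ <= _ + X)%E]cnormBC.
have m1 : cmeas (fun z => -1 * P g z + P f z) by apply: cmeasD => //; exact: cmeasZ.
apply: le_trans (cnormD p_ge1 mPh (cmeasB m1 mPh)).
apply: le_cnorm => //; first exact: cmeasB.
  by apply: cmeasD => //; exact: cmeasB.
by move=> z; rewrite [X in _ <= cabs X]addrC subrK mulN1r [X in _ <= cabs X]addrC.
Qed.

Lemma P_sum (I : Type) (l : seq I) (u : I -> R[i]) (e : I -> circle R -> R[i]) :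
  (forall i, LpT p (e i)) ->
  cnorm p (fun z => P (fun z => \sum_(i <- l) u i * e i z) z - \sum_(i <- l) u i * P (e i) z) = 0%E.
Proof.
move=> Le; elim: l => [|i l IH].
  have -> : (fun z : circle R => \sum_(i <- [::]) u i * e i z) = (fun=> 0).
    by apply/funext => z; rewrite big_nil.
  have -> : (fun z => P (fun=> 0) z - \sum_(i <- [::]) u i * P (e i) z) = P (fun=> 0).
    by apply/funext => z; rewrite big_nil subr0.
  (* That [P] sends the zero function to a null function comes from boundedness. *)
  apply/eqP; rewrite eq_le cnorm_ge0 andbT.
  by have := P_bd (LpT0 p_ge1); rewrite cnorm0// mule0.
set S := fun z => \sum_(i <- l) u i * e i z in IH.
have LS : LpT p S by apply: LpT_sum => // j; exact: LpTZ.
have -> : (fun z : circle R => \sum_(j <- i :: l) u j * e j z) = (fun z => u i * e i z + S z).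
  by apply/funext => z; rewrite big_cons.
have Lie : LpT p (fun z => u i * e i z + S z) by apply: LpTD => //; exact: LpTZ.
have mPe j : cmeas (P (e j)) by exact: P_meas.
have mPS := P_meas LS.
have mT : cmeas (fun z => \sum_(i <- l) u i * P (e i) z).
  by apply: cmeas_sum => j; exact: cmeasZ.
apply/eqP; rewrite eq_le cnorm_ge0 andbT.
have := P_lin (u i) (Le i) LS => P0.
rewrite -[leRHS]adde0 -[X in (_ <= X + _)%E]P0 -IH.
have m1 : cmeas (fun z => u i * P (e i) z + P S z) by apply: cmeasD => //; exact: cmeasZ.
apply: le_trans (cnormD p_ge1 (cmeasB (P_meas Lie) m1) (cmeasB mPS mT)).
apply: le_cnorm => //.
- by apply: cmeasB; [exact: P_meas|apply: cmeas_sum => j; exact: cmeasZ].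
- by apply: cmeasD; apply: cmeasB => //; exact: P_meas.
by move=> z; rewrite big_cons opprD addrA !opprD !addrA subrK.
Qed.

Section simple_input.
Variables (I K : finType) (idx : circle R -> I).
Hypothesis midx : imeas idx.
Let e (i : I) (z : circle R) : R[i] := (idx z == i)%:R.
Let h i := P (e i).
Let w := weight idx.

Let index_sum (v : I -> R[i]) z : v (idx z) = \sum_i v i * e i z.
Proof.
rewrite (bigD1 (idx z))//= /e eqxx mulr1 big1 ?addr0// => i iz.
by rewrite eq_sym (negbTE iz) mulr0.
Qed.

Let me i : cmeas (e i).
Proof. exact: (cmeas_index midx (fun j => (j == i)%:R)). Qed.

Let cnorm_index (v : I -> R[i]) :
  cnorm p (fun z => v (idx z)) = ((\sum_i w i * cabs (v i) `^ p) `^ p^-1)%:E.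
Proof.
exact: (rnorm_index p_ge1 midx (fun i => cabs_ge0 (v i))).
Qed.

Let LpT_index (v : I -> R[i]) : LpT p (fun z => v (idx z)).
Proof.
by apply/LpTE; split; [exact: cmeas_index|rewrite cnorm_index ltry].
Qed.

Let Le i : LpT p (e i).
Proof. exact: (LpT_index (fun j => (j == i)%:R)). Qed.

Let Lh i : LpT p (h i). Proof. exact: P_Lp. Qed.

Let mh i : cmeas (h i). Proof. exact: LpT_cmeas. Qed.

(** The norm of an input does not control its coefficient on a cell of measure zero. Such a cell
    must therefore have a null image, and boundedness of [P] ensures it. *)
Let h_null i : w i = 0 -> cnorm p (h i) = 0%E.
Proof.
move=> wi; apply/eqP; rewrite eq_le cnorm_ge0 andbT.
apply: le_trans (P_bd (Le i)) _; rewrite (cnorm_index (fun j => (j == i)%:R)).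
rewrite (bigD1 i)//= wi mul0r add0r big1 ?powR0 ?mule0//; first by rewrite invr_eq0 gt_eqF.
by move=> j ji; rewrite (negbTE ji) cabs0 powR0 ?mulr0// gt_eqF.
Qed.

Let h_bound (v : I -> R[i]) :
  (cnorm p (fun z => \sum_i v i * h i z)%R <= C%:E * cnorm p (fun z => v (idx z)))%E.
Proof.
have vE : (fun z => v (idx z)) = (fun z => \sum_i v i * e i z).
  by apply/funext => z; exact: index_sum.
have P0 := P_sum (index_enum I) v Le.
rewrite -vE in P0; have LS := LpT_index v.
have mT : cmeas (fun z => \sum_i v i * h i z) by apply: cmeas_sum => i; exact: cmeasZ.
apply: le_trans (cnorm_approx p_ge1 mT (P_meas LS)) _.
by rewrite P0 adde0; exact: P_bd.
Qed.

Let mixed_index (T : finType) (idt : circle R -> T) (v : K -> T -> R[i]) : imeas idt ->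
  rnorm p (fun z => fls s (fun k => v k (idt z))) =
  (mixed p s (weight idt) v `^ p^-1)%:E.
Proof.
move=> mt; rewrite (rnorm_index p_ge1 mt (phi := fun i => fls s (v ^~ i))); last first.
  by move=> i; exact: fls_ge0.
by rewrite mixed_lsn.
Qed.

Let root_le (a b c : R) : 0 <= a -> 0 <= b -> 0 <= c ->
  a `^ p^-1 <= c * b `^ p^-1 -> a <= c `^ p * b.
Proof.
move=> a0 b0 c0 abc.
have := @ge0_ler_powR _ p (ltW p_gt0) _ _ _ _ abc.
rewrite powRM ?powR_ge0// -!powRrM mulVf ?gt_eqF// !powRr1//; apply; rewrite nnegrE ?mulr_ge0 ?powR_ge0//.
Qed.

Let le_root (a b c : R) : 0 <= a -> 0 <= b -> 0 <= c ->
  a <= c `^ p * b -> a `^ p^-1 <= c * b `^ p^-1.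
Proof.
move=> a0 b0 c0 abc.
have pi0 : 0 <= p^-1 by rewrite invr_ge0 ltW.
have := @ge0_ler_powR _ p^-1 pi0 _ _ _ _ abc.
by rewrite powRM ?powR_ge0// -powRrM divff ?gt_eqF// powRr1//; apply; rewrite nnegrE ?mulr_ge0 ?powR_ge0.
Qed.

(* The images P (e i) are rounded to finitely many values; the joint value idx' of
   the rounded images then indexes the rows of a matrix A, whose bound C' on
   scalar inputs exceeds C by the rounding error. *)
Lemma simple_extension (v : K -> I -> R[i]) :
  (rnorm p (fun z => fls s (fun k => \sum_i v k i * h i z)%R) <=
   C%:E * rnorm p (fun z => fls s (fun k => v k (idx z))))%E.
Proof.
rewrite [X in (_ <= _ * X)%E](mixed_index v midx) -EFinM.
have w0 i : 0 <= w i by exact: weight_ge0.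
have M0 : 0 <= mixed p s w v by exact: mixed_ge0.
set x := mixed p s (weight idx) v `^ p^-1.
have x0 : 0 <= x by exact: powR_ge0.
(* On a cell of positive weight, |u_i| is at most w_i^(-1/p) times the norm of u. Rounding every
   image within [d] thus costs at most [kap * d] in the operator bound, which gives the constant C'
   below. *)
pose kap := \sum_i w i `^ (- p^-1).
have kap0 : 0 <= kap by apply: sumr_ge0 => i _; exact: powR_ge0.
pose V := \sum_k \sum_i cabs (v k i).
have V0 : 0 <= V by do 2 apply: sumr_ge0 => ? _; exact: cabs_ge0.
apply/lee_addgt0Pr => eps eps0.
(* Two errors must fit into [eps]: [kap * d * x] from the enlarged constant, and [V * d] from
   replacing the images by their roundings. *)
pose d := eps / (kap * x + V + 1).
have den0 : 0 < kap * x + V + 1 by rewrite ltr_wpDl// addr_ge0// mulr_ge0.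
have d0 : 0 < d by rewrite divr_gt0.
have [m Hm] : exists m, forall i, (cnorm p (fun z => qdec R (qcode m (h i z)) - h i z)%R <= d%:E)%E.
  have : \forall m \near \oo, forall i, (cnorm p (fun z => qdec R (qcode m (h i z)) - h i z)%R <= d%:E)%E.
    apply: filter_forall => i.
    by have /cvge0P := cnorm_qdec_cvg p_ge1 (Lh i); apply => // m; exact: cnorm_ge0.
  by move=> [N _ HN]; exists N; exact: (HN N (leqnn N)).
pose h' i z := qdec R (qcode m (h i z)).
have mh' i : cmeas (h' i).
  exact: (cmeas_index (imeas_qcode (m := m) (mh i)) (@qdec R m)).
pose idx' z : {ffun I -> qidx m} := [ffun i => qcode m (h i z)].
have midx' : imeas idx' by apply: imeas_ffun => i; exact: imeas_qcode.
pose A (j : {ffun I -> qidx m}) i : R[i] := qdec R (j i).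
pose w' := weight idx'.
pose C' := C + kap * d.
have C'0 : 0 <= C' by rewrite addr_ge0// mulr_ge0// ltW.
have AE z i : A (idx' z) i = h' i z by rewrite /A ffunE.
(* Cells of weight zero escape the estimate by [kap]; their images are null, and rounding keeps them
   so. *)
have near_null i : w i = 0 -> cnorm p (fun z => h' i z - h i z) = 0%E.
  move=> wi; apply/eqP; rewrite eq_le cnorm_ge0 andbT.
  apply: le_trans (cnormB p_ge1 (mh' i) (mh i)) _; rewrite (h_null wi) adde0 -(h_null wi).
  by apply: le_cnorm => // z; exact: qdec_le.
have A_bound (u : I -> R[i]) :
    \sum_j w' j * cabs (\sum_i A j i * u i) `^ p <= C' `^ p * \sum_i w i * cabs (u i) `^ p.
  apply: root_le => //.
  - by apply: sumr_ge0 => j _; rewrite mulr_ge0 ?powR_ge0// weight_ge0.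
  - by apply: sumr_ge0 => j _; rewrite mulr_ge0 ?powR_ge0.
  set b := (\sum_i w i * cabs (u i) `^ p) `^ p^-1.
  have b0 : 0 <= b by exact: powR_ge0.
  rewrite -lee_fin -(rnorm_index p_ge1 midx' (fun j => cabs_ge0 _)).
  have -> : rnorm p (fun z => cabs (\sum_i A (idx' z) i * u i)) = cnorm p (fun z => \sum_i u i * h' i z).
    by congr rnorm; apply/funext => z; congr cabs; apply: eq_bigr => i _; rewrite AE mulrC.
  have mT : cmeas (fun z => \sum_i u i * h i z) by apply: cmeas_sum => i; exact: cmeasZ.
  have mT' : cmeas (fun z => \sum_i u i * h' i z) by apply: cmeas_sum => i; exact: cmeasZ.
  apply: le_trans (cnorm_approx p_ge1 mT' mT) _.
  rewrite cnormBC mulrDl EFinD leeD//; first by rewrite EFinM -cnorm_index h_bound.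
  have -> : (fun z => \sum_i u i * h' i z - \sum_i u i * h i z) =
     (fun z => \sum_i u i * (h' i z - h i z)).
    by apply/funext => z; rewrite -sumrB; apply: eq_bigr => i _; rewrite mulrBr.
  have mhh i : cmeas (fun z => h' i z - h i z) by exact: cmeasB.
  apply: le_trans (cnorm_sum p_ge1 _ (fun i => cmeasZ (u i) (mhh i))) _.
  rewrite -mulrA mulr_suml -sumEFin; apply: lee_sum => i _.
  rewrite cnormZ//; have [wi|wi] := eqVneq (w i) 0.
    rewrite near_null// mule0 lee_fin; apply: mulr_ge0; first exact: powR_ge0.
    by apply: mulr_ge0 => //; exact: ltW.
  apply: le_trans (lee_wpmul2l _ (Hm i)) _; first by rewrite lee_fin cabs_ge0.
  rewrite -EFinM lee_fin [leRHS]mulrCA [leLHS]mulrC ler_wpM2l ?(ltW d0)//.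
  have wgt : 0 < w i by rewrite lt_neqAle eq_sym wi w0.
  apply: le_weight_root => //; first exact: cabs_ge0.
  rewrite (bigD1 i)//= lerDl; apply: sumr_ge0 => j _.
  by rewrite mulr_ge0 ?powR_ge0.
have w'0 j : 0 <= w' j by exact: weight_ge0.
have bound := @matrix_extension R I _ K p s C' w w' A hps w0 w'0 A_bound v.
have fls' : (rnorm p (fun z => fls s (fun k => \sum_i v k i * h' i z)%R) <= (C' * x)%:E)%E.
  have -> : (fun z => fls s (fun k => \sum_i v k i * h' i z)) =
     (fun z => fls s (fun k => mx_act A v k (idx' z))).
    apply/funext => z; congr fls; apply/funext => k; apply: eq_bigr => i _.
    by rewrite AE mulrC.
  rewrite (mixed_index (mx_act A v) midx') lee_fin le_root// ?mixed_ge0//.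
have mvh k : cmeas (fun z => \sum_i v k i * h i z) by apply: cmeas_sum => i; exact: cmeasZ.
have mvh' k : cmeas (fun z => \sum_i v k i * h' i z) by apply: cmeas_sum => i; exact: cmeasZ.
apply: le_trans (rnorm_fls_triangle p_ge1 s_gt1 mvh mvh') _.
apply: (@le_trans _ _ ((C' * x)%:E + (V * d)%:E)%E).
  apply: leeD => //; rewrite mulr_suml -sumEFin; apply: lee_sum => k _.
  rewrite cnormBC.
  have -> : (fun z => \sum_i v k i * h' i z - \sum_i v k i * h i z) =
     (fun z => \sum_i v k i * (h' i z - h i z)).
    by apply/funext => z; rewrite -sumrB; apply: eq_bigr => i _; rewrite mulrBr.
  have mhh i : cmeas (fun z => h' i z - h i z) by exact: cmeasB.
  apply: le_trans (cnorm_sum p_ge1 _ (fun i => cmeasZ (v k i) (mhh i))) _.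
  rewrite mulr_suml -sumEFin; apply: lee_sum => i _.
  by rewrite cnormZ// EFinM; apply: lee_wpmul2l (Hm i); rewrite lee_fin cabs_ge0.
rewrite -!EFinD lee_fin /C' mulrDl -addrA lerD2l.
have -> : kap * d * x + V * d = (kap * x + V) * d by ring.
rewrite /d mulrA ler_pdivrMr// [leLHS]mulrC ler_wpM2l ?(ltW eps0)//.
by rewrite lerDl.
Qed.

End simple_input.
End vector_extension.

(** * From simple inputs to finite families and to sequences *)

Section sequence_extension.
Variables (R : realType) (p s C : R).
Hypothesis hps : (2 <= s /\ s <= p) \/ (1 < p /\ p <= s /\ s <= 2).
Hypothesis C_ge0 : 0 <= C.
Variable P : (circle R -> R[i]) -> circle R -> R[i].
Hypothesis P_Lp : forall f, LpT p f -> LpT p (P f).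
Hypothesis P_bd : forall f, LpT p f -> (cnorm p (P f) <= C%:E * cnorm p f)%E.
Hypothesis P_lin : forall a f g, LpT p f -> LpT p g ->
  cnorm p (fun z => P (fun z => a * f z + g z) z - (a * P f z + P g z)) = 0%E.
Local Notation mu := (@lebesgue_measure R).
Local Notation arc := (`[0, 2 * pi]%classic : set R).

Let p_gt1 : 1 < p. Proof. by have [] := exponents_gt1 hps. Qed.
Let s_gt1 : 1 < s. Proof. by have [] := exponents_gt1 hps. Qed.
Let p_ge1 : 1 <= p. Proof. exact: ltW. Qed.
Let p_gt0 : 0 < p. Proof. exact: lt_trans p_gt1. Qed.

Let quantization_cvg f : LpT p f ->
  cnorm p (fun z => f z - qdec R (qcode m (f z))) @[m --> \oo] --> 0%E.
Proof.
by move=> Lf; under eq_fun do rewrite cnormBC; exact: cnorm_qdec_cvg.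
Qed.

(** The inputs are rounded jointly, so that they become simple over one common index. [P] of a
    rounded input is, up to a null function, the combination [g k] of images of indicators, and it
    lies within [C * d] of [P (f k)]. *)
Lemma finite_extension (K : finType) (f : K -> circle R -> R[i]) :
  (forall k, LpT p (f k)) ->
  (rnorm p (fun z => fls s (fun k => P (f k) z)) <=
   C%:E * rnorm p (fun z => fls s (f ^~ z)))%E.
Proof.
move=> Lf; have mf k := LpT_cmeas (Lf k).
apply/lee_addgt0Pr => eps eps0.
pose d := eps / (#|K|%:R * C + 1).
have den0 : 0 < #|K|%:R * C + 1 by rewrite ltr_wpDl// mulr_ge0.
have d0 : 0 < d by rewrite divr_gt0.
have [m Hm] : exists m, forall k, (cnorm p (fun z => f k z - qdec R (qcode m (f k z)))%R <= d%:E)%E.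
  have : \forall m \near \oo, forall k, (cnorm p (fun z => f k z - qdec R (qcode m (f k z)))%R <= d%:E)%E.
    apply: filter_forall => k.
    by have /cvge0P := quantization_cvg (Lf k); apply => // m; exact: cnorm_ge0.
  by move=> [N _ HN]; exists N; exact: (HN N (leqnn N)).
pose idx z : {ffun K -> qidx m} := [ffun k => qcode m (f k z)].
have midx : imeas idx by apply: imeas_ffun => k; exact: imeas_qcode.
pose v k (c : {ffun K -> qidx m}) : R[i] := qdec R (c k).
have vE k z : v k (idx z) = qdec R (qcode m (f k z)) by rewrite /v ffunE.
have simple := simple_extension hps C_ge0 P_Lp P_bd P_lin midx v.
set e := (fun (c : {ffun K -> qidx m}) (z : circle R) => (idx z == c)%:R : R[i]) in simple.
have me c : cmeas (e c) by exact: (cmeas_index midx (fun j => (j == c)%:R)).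
have Le c : LpT p (e c).
  apply: (@LpT_bounded R p p_ge1 _ 1) => // z; rewrite /e.
  by case: eqP => _; rewrite ?cabs1 ?cabs0.
pose g k z : R[i] := \sum_c v k c * P (e c) z.
have mPe c : cmeas (P (e c)) by apply: LpT_cmeas; exact: P_Lp (Le c).
have mg k : cmeas (g k) by apply: cmeas_sum => c; exact: cmeasZ.
have Pf k : cmeas (P (f k)) by apply: LpT_cmeas; exact: P_Lp (Lf k).
pose q k z : R[i] := qdec R (qcode m (f k z)).
have mq k : cmeas (q k).
  exact: (cmeas_index (imeas_qcode (m := m) (mf k)) (@qdec R m)).
have qE k : q k = fun z => \sum_c v k c * e c z.
  apply/funext => z; rewrite /q -vE (bigD1 (idx z))//= /e eqxx mulr1.
  by rewrite big1 ?addr0// => c cz; rewrite eq_sym (negbTE cz) mulr0.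
have q_le k z : cabs (q k z) <= cabs (f k z) by exact: qdec_le.
have Lq k : LpT p (q k) by exact: LpT_le (mq k) (Lf k) (q_le k).
apply: le_trans (rnorm_fls_triangle p_ge1 s_gt1 Pf mg) _.
apply: leeD.
  (* Rounding decreases moduli, so the right-hand side acquires no error term. *)
  apply: le_trans simple _; apply: lee_wpmul2l; first by rewrite lee_fin.
  apply: (rnorm_fls_le p_ge1 s_gt1 (x := fun k z => v k (idx z))) => //.
    by move=> k; exact: (cmeas_index midx (v k)).
  by move=> k z; rewrite vE; exact: q_le.
apply: (@le_trans _ _ (\sum_(k : K) (C * d)%:E)%E).
  apply: lee_sum => k _.
  have Pq : cmeas (P (q k)) by apply: LpT_cmeas; exact: P_Lp (Lq k).
  apply: le_trans (cnorm_triangle p_ge1 (Pf k) Pq (mg k)) _.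
  have -> : cnorm p (fun z => P (q k) z - g k z) = 0%E.
    by rewrite qE; exact: (P_sum hps P_Lp P_bd P_lin).
  rewrite adde0; apply: le_trans (P_sub hps P_Lp P_bd P_lin (Lf k) (Lq k)) _.
  by rewrite EFinM; apply: lee_wpmul2l (Hm k); rewrite lee_fin.
rewrite sumEFin lee_fin sumr_const -mulr_natl /d mulrA mulrA.
rewrite ler_pdivrMr// [leLHS]mulrC ler_wpM2l ?(ltW eps0)//.
by rewrite lerDl.
Qed.

Section monotone.
Variable F : nat -> circle R -> R[i].
Hypothesis mF : forall k, cmeas (F k).

Let partial n z : \bar R := (\sum_(0 <= k < n) (cabs (F k z) `^ s)%:E)%E.

Let partial_ge0 n z : (0 <= partial n z)%E.
Proof. by apply: sume_ge0 => k _; rewrite lee_fin powR_ge0. Qed.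

Let partial_nd z : {homo partial ^~ z : n m / (n <= m)%N >-> (n <= m)%E}.
Proof.
by move=> n m nm; apply: lee_sum_nneg_natr => // k _ _; rewrite lee_fin powR_ge0.
Qed.

Let partial_fls n z : (partial n z `^ s^-1)%E = (fls s (fun k : 'I_n => F k z))%:E.
Proof. by rewrite /partial big_mkord sumEFin poweR_EFin. Qed.

Lemma lsnorm_fls n z : ((fls s (fun k : 'I_n => F k z))%:E <= lsnorm s F z)%E.
Proof.
rewrite -partial_fls; apply: poweR_le => //; first by rewrite invr_ge0 ltW// (lt_trans _ s_gt1).
by apply: nneseries_lim_ge => k _ _; rewrite lee_fin powR_ge0.
Qed.

Lemma lsnorm_ge0 z : (0 <= lsnorm s F z)%E. Proof. exact: poweR_ge0. Qed.

Lemma emeas_lsnorm : emeas (lsnorm s F).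
Proof.
apply: (@measurableT_comp _ _ _ _ _ _ (fun x : \bar R => x `^ s^-1)%E).
  exact: measurable_poweR.
apply: ge0_emeasurable_sum => [k t _ _|k _]; first by rewrite lee_fin powR_ge0.
by apply/measurable_EFinP; exact: (rmeas_cabs_powR s (mF k)).
Qed.

(** Monotone convergence, applied to the p-th powers of the truncated l^s norms. *)
Lemma normT_lsnorm_le (B : \bar R) :
  (forall n, (rnorm p (fun z => fls s (fun k : 'I_n => F k z)) <= B)%E) ->
  (normT p (lsnorm s F) <= B)%E.
Proof.
move=> HB.
have B0 : (0 <= B)%E by apply: le_trans (HB 0%N); exact: rnorm_ge0.
have s0 : 0 < s by exact: lt_trans s_gt1.
have sp0 : 0 <= p / s by rewrite divr_ge0 ?ltW.
have sp1 : 0 <= s / p by rewrite divr_ge0 ?ltW.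
suff : ((\int[mu]_(t in arc) (`|lsnorm s F (expi t)| `^ p)) <= B `^ p)%E.
  move=> H; rewrite normTE//.
  apply: le_trans (poweR_le _ _ H) _; first by rewrite invr_ge0 ltW.
    by apply: integral_ge0 => t _; exact: poweR_ge0.
  by rewrite -poweRrM divff ?gt_eqF// poweRe1.
(* The power p/s passes to the increasing limit: one inequality is monotonicity, the other follows
   from the inverse power s/p. *)
have lim_pow z : (`|lsnorm s F z| `^ p)%E = limn (fun n => partial n z `^ (p / s))%E.
  rewrite gee0_abs ?lsnorm_ge0// /lsnorm -poweRrM [s^-1 * p]mulrC.
  have nd n m : (n <= m)%N -> (partial n z `^ (p / s) <= partial m z `^ (p / s))%E.
    by move=> nm; apply: poweR_le => //; exact: partial_nd.
  apply/eqP; rewrite eq_le; apply/andP; split; last first.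
    apply: lime_le; first by apply: ereal_nondecreasing_is_cvgn => n m; exact: nd.
    apply: nearW => n; apply: poweR_le => //.
    by apply: nneseries_lim_ge => k _ _; rewrite lee_fin powR_ge0.
  set L := limn (fun n => partial n z `^ (p / s))%E.
  have Ln n : (partial n z `^ (p / s) <= L)%E.
    have -> : L = ereal_sup (range (fun n => partial n z `^ (p / s))%E).
      by apply/cvg_lim => //; apply: ereal_nondecreasing_cvgn => i j; exact: nd.
    by apply: ereal_sup_ubound; exists n.
  have L0 : (0 <= L)%E by apply: le_trans (Ln 0%N); exact: poweR_ge0.
  have ps1 : (p / s) * (s / p) = 1 by field; rewrite !gt_eqF.
  have : (\sum_(0 <= k <oo) (cabs (F k z) `^ s)%:E <= L `^ (s / p))%E.
    apply: lime_le; first by apply: is_cvg_nneseries => k _ _; rewrite lee_fin powR_ge0.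
    apply: nearW => n; have := poweR_le sp1 (poweR_ge0 _ _) (Ln n).
    by rewrite -poweRrM ps1 poweRe1 ?partial_ge0.
  move=> /(poweR_le sp0); rewrite -poweRrM [s / p * _]mulrC ps1 poweRe1//; apply.
  by apply: nneseries_ge0 => k _ _; rewrite lee_fin powR_ge0.
under eq_integral do rewrite lim_pow.
have mpart n : measurable_fun arc (fun t => partial n (expi t) `^ (p / s))%E.
  apply: measurable_funTS; apply: (@measurableT_comp _ _ _ _ _ _ (fun x : \bar R => x `^ (p / s))%E).
    exact: measurable_poweR.
  apply: emeasurable_sum => k.
  by apply/measurable_EFinP; exact: (rmeas_cabs_powR s (mF k)).
rewrite (monotone_convergence mu (@arc_meas R) mpart)//; last 2 first.
- by move=> n t _; exact: poweR_ge0.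
- by move=> t _ n m nm; apply: poweR_le => //; exact: partial_nd.
apply: lime_le.
  apply: ereal_nondecreasing_is_cvgn => n m nm.
  apply: (ge0_le_integral mu (@arc_meas R) _ (mpart n) (mpart m)) => t _; first exact: poweR_ge0.
  by apply: poweR_le => //; exact: partial_nd.
apply: nearW => n.
have -> : (\int[mu]_(t in arc) (partial n (expi t) `^ (p / s)) =
    rnorm p (fun z => fls s (fun k : 'I_n => F k z)) `^ p)%E.
  rewrite rnorm_powE//; apply: eq_integral => t _.
  rewrite -poweR_EFin ger0_norm ?fls_ge0// -partial_fls -poweRrM; congr (_ `^ _)%E.
  by rewrite mulrC.
by apply: poweR_le => //; [exact: ltW|exact: rnorm_ge0].
Qed.

End monotone.

Theorem sequence_extension (f : nat -> circle R -> R[i]) : (forall k, LpT p (f k)) ->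
  (normT p (lsnorm s (fun k => P (f k))) <= C%:E * normT p (lsnorm s f))%E.
Proof.
move=> Lf; apply: normT_lsnorm_le => [k|n]; first by apply: LpT_cmeas; exact: P_Lp (Lf k).
apply: le_trans (finite_extension (f := fun k : 'I_n => f k) _) _; first by move=> k.
apply: lee_wpmul2l; first by rewrite lee_fin.
have mf k := LpT_cmeas (Lf k).
apply: (normT_le p_ge1).
- apply: rmeas_emeas; exact: (rmeas_fls s (x := fun k : 'I_n => f k)).
- exact: emeas_lsnorm.
move=> z; rewrite [leRHS]gee0_abs ?lsnorm_ge0// gee0_abs ?lee_fin ?fls_ge0//.
exact: lsnorm_fls.
Qed.

End sequence_extension.

Lemma cabs_dist (R : realType) (x y z : R[i]) :
  `|cabs (x - z) - cabs (x - y)| <= cabs (y - z).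
Proof.
have h1 : cabs (x - z) <= cabs (x - y) + cabs (y - z).
  by have -> : x - z = (x - y) + (y - z); [ring|exact: cabsD].
have h2 : cabs (x - y) <= cabs (x - z) + cabs (y - z).
  rewrite -[cabs (y - z)]cabsN.
  by have -> : x - y = (x - z) + - (y - z); [ring|exact: cabsD].
rewrite ler_norml; move: h1 h2.
move: (cabs (x - z)) (cabs (x - y)) (cabs (y - z)) => a b c h1 h2.
by apply/andP; split; lra.
Qed.

Lemma powR_continuous_gt0 (R : realType) (c p : R) : 0 < c ->
  {for c, continuous (fun x : R => x `^ p)}.
Proof.
move=> c0; apply: differentiable_continuous; apply/derivable1_diffP.
by apply: derivable_powR; rewrite in_itv/= andbT.
Qed.

(** * Completeness of L^p *)

Section completeness.
Variables (R : realType) (p : R).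
Hypothesis p_gt1 : 1 < p.
Local Notation mu := (@lebesgue_measure R).
Local Notation arc := (`[0, 2 * pi]%classic : set R).
Implicit Types (f g : circle R -> R[i]).

Let p_ge1 : 1 <= p. Proof. exact: ltW. Qed.
Let p_gt0 : 0 < p. Proof. exact: lt_trans p_gt1. Qed.

(** Hoelder's inequality against the constant 1, whose dual norm is finite because the arc has
    finite length. *)
Lemma L1_le_cnorm : exists2 k : R, 0 <= k & forall f, cmeas f ->
  (\int[mu]_(t in arc) (cabs (f (expi t)))%:E <= k%:E * cnorm p f)%E.
Proof.
pose q := p / (p - 1).
have q0 : 0 < q by rewrite divr_gt0 ?subr_gt0.
have pq : p^-1 + q^-1 = 1.
  by rewrite invf_div -[X in X + _]mul1r -mulrDl [1 + _]addrC subrK divff// gt_eqF.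
exists (fine (rnorm q (fun _ : circle R => 1))).
  by rewrite fine_ge0// rnorm_ge0.
move=> f mf; have q1 : 1 <= q by rewrite ler_pdivlMr ?subr_gt0// mul1r gerBl.
have rfin : rnorm q (fun _ : circle R => 1) \is a fin_num.
  by rewrite ge0_fin_numE ?rnorm_ge0// (rnorm_cst q1).
rewrite fineK// muleC /cnorm !rnormE.
have m1 : rmeas (fun _ : circle R => 1 : R) by exact: measurable_cst.
have := hoelder mu (measurable_arc (rmeas_cabs mf)) (measurable_arc m1) p_gt0 q0 pq.
apply: le_trans; rewrite Lnorm1 le_eqVlt; apply/orP; left; apply/eqP.
rewrite [LHS]integral_mkcond.
apply: eq_integral => t _; rewrite /patch/=; case: ifP => _.
  by rewrite mulr1 ger0_norm// cabs_ge0.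
by rewrite mul0r normr0.
Qed.

Definition cauchy_cnorm (u : nat -> circle R -> R[i]) := forall e : R, 0 < e ->
  exists N : nat, forall n m, (N <= n)%N -> (N <= m)%N ->
  (cnorm p (fun z => u n z - u m z)%R <= e%:E)%E.

Section limit.
Variable v : nat -> circle R -> R[i].
Hypothesis Lv : forall n, LpT p (v n).
Hypothesis v_fast : forall n, (cnorm p (fun z => v n.+1 z - v n z)%R <= ((1 / 2) ^+ n)%:E)%E.

Let mv n : cmeas (v n). Proof. exact: LpT_cmeas. Qed.

Let mvd n : cmeas (fun z => v n.+1 z - v n z). Proof. exact: cmeasB. Qed.

Let d n z := cabs (v n.+1 z - v n z).

(** The L^1 norms of the differences are dominated by a geometric series, so the sum of the
    differences is integrable and hence finite almost everywhere. *)
Let d_summable : {ae mu, forall t, arc t -> (\sum_(0 <= n <oo) (d n (expi t))%:E < +oo)%E}.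
Proof.
have md n : measurable_fun arc (fun t => (d n (expi t))%:E).
  by apply: measurable_funTS; apply: rmeas_emeas; exact: (rmeas_cabs (mvd n)).
have d0 n t : (0 <= (d n (expi t))%:E)%E by rewrite lee_fin cabs_ge0.
have [k k0 L1] := L1_le_cnorm.
have int_lty : (\int[mu]_(t in arc) \sum_(0 <= n <oo) (d n (expi t))%:E < +oo)%E.
  rewrite (integral_nneseries mu (@arc_meas R) md (fun n t _ => d0 n t)).
  apply: (@le_lt_trans _ _ (\sum_(0 <= n <oo) (k * (1 / 2) ^+ n)%:E)%E).
    apply: lee_nneseries => n _; first by move=> _; exact: integral_ge0.
    by apply: le_trans (L1 _ (mvd n)) _; rewrite EFinM lee_wpmul2l// lee_fin.
  have : eseries (fun n => (k * (1 / 2) ^+ n)%:E) n @[n --> \oo] --> (k * (1 - 1 / 2)^-1)%:E.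
    apply: cvg_EFin; first by apply: nearW => n; rewrite /eseries/= sumEFin.
    have -> : fine \o eseries (fun n => (k * (1 / 2) ^+ n)%:E) = series (geometric k (1 / 2)).
      by apply/funext => n /=; rewrite /eseries/= sumEFin.
    by apply: cvg_geometric_series; rewrite ger0_norm//; lra.
  by move/cvg_lim => -> //; rewrite ltry.
have : mu.-integrable arc (fun t : R => \sum_(0 <= n <oo) (d n (expi t))%:E)%E.
  apply/integrableP; split.
    exact: (@ge0_emeasurable_sum _ _ _ _ (fun n t => (d n (expi t))%:E) xpredT
      (fun n t _ _ => d0 n t) (fun n _ => md n)).
  under eq_integral => t _ do rewrite gee0_abs ?nneseries_ge0//.
  exact: int_lty.
move=> i1; have H1 := integrable_ae (mu := mu) (@arc_meas R) i1.
apply: (@filterS _ _ (ae_filter_ringOfSetsType mu) _ _ _ H1) => t H at_.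
by have := H at_; rewrite ge0_fin_numE// nneseries_ge0.
Qed.

Let summable_cvg (x : nat -> R) z : (forall n, `|x n.+1 - x n| <= d n z) ->
  (\sum_(0 <= n <oo) (d n z)%:E < +oo)%E -> cvgn x.
Proof.
move=> xd dlt.
have d0 n : 0 <= d n z by exact: cabs_ge0.
have dc : cvgn (series (d ^~ z)).
  apply: nondecreasing_is_cvgn.
    by apply: nondecreasing_series => n _ _; exact: d0.
  exists (fine (\sum_(0 <= n <oo) (d n z)%:E)) => _ [n _ <-].
  rewrite -lee_fin fineK; last by rewrite ge0_fin_numE// nneseries_ge0// => i _ _; rewrite lee_fin.
  rewrite /series/= -sumEFin; apply: nneseries_lim_ge => i _ _; by rewrite lee_fin.
have : cvgn (series (fun n => x n.+1 - x n)).
  apply: normed_cvg; apply: series_le_cvg dc => //.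
  - by move=> n; exact: normr_ge0.
have -> : series (fun n => x n.+1 - x n) = fun n => x n - x 0%N.
  by apply/funext => n; rewrite /series/= telescope_sumr.
move=> H; have -> : x = (fun n => (x n - x 0%N) + x 0%N) by apply/funext => n; rewrite subrK.
by apply: is_cvgD => //; exact: is_cvg_cst.
Qed.

(** The upper limit of each coordinate is defined and measurable everywhere; it is the limit at
    almost every point. *)
Definition limit_fun z : R[i] :=
  (fine (limn_esup (fun n => (complex.Re (v n z))%:E)))
  +i* (fine (limn_esup (fun n => (complex.Im (v n z))%:E))).

Let mlimit : cmeas limit_fun.
Proof.
have mfine (x : nat -> circle R -> R) : (forall n, rmeas (x n)) ->
    rmeas (fun z => fine (limn_esup (fun n => (x n z)%:E))).
  move=> mx; apply: (@measurableT_comp _ _ _ _ _ _ (@fine R)); first exact: fine_measurable.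
  by apply: measurable_fun_limn_esup => n; exact: rmeas_emeas.
by split; apply: mfine => n; have [mvr mvi] := mv n.
Qed.

Let fine_limn_esup (x : nat -> R) : cvgn x -> x n @[n --> \oo] --> fine (limn_esup (fun n => (x n)%:E)).
Proof.
move=> /cvg_ex[l xl]; have xE : (x n)%:E @[n --> \oo] --> l%:E.
  by apply: cvg_EFin => //; exact: nearW.
by have [_ ->] := cvg_limn_einf_sup xE.
Qed.

Let ae_limit : {ae mu, forall t, arc t ->
  cabs (v n (expi t) - limit_fun (expi t)) @[n --> \oo] --> 0}.
Proof.
apply: (@filterS _ _ (ae_filter_ringOfSetsType mu) _ _ _ d_summable) => t H at_; have {}H := H at_.
have c1 : cvgn (fun n => complex.Re (v n (expi t))).
  by apply: summable_cvg H => n; rewrite -raddfB; exact: Re_le_cabs.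
have c2 : cvgn (fun n => complex.Im (v n (expi t))).
  by apply: summable_cvg H => n; rewrite -raddfB; exact: Im_le_cabs.
have := fine_limn_esup c1; have := fine_limn_esup c2.
set a := fine _; set b := fine _ => ca cb.
have H1 : `|complex.Re (v n (expi t)) - b| + `|complex.Im (v n (expi t)) - a| @[n --> \oo] --> 0.
  have -> : 0 = `|b - b| + `|a - a| by rewrite !subrr !normr0 addr0.
  apply: cvgD; apply: cvg_norm; apply: cvgB; [exact: cb|exact: cvg_cst|exact: ca|exact: cvg_cst].
apply: (squeeze_cvgr _ (cvg_cst 0) H1); apply: nearW => n.
by rewrite cabs_ge0/= (le_trans (cabs_le_ReIm _))// !raddfB.
Qed.

(** Fatou's lemma along the sequence [v], which converges almost everywhere. *)
Lemma cnorm_limit_le f (e : R) : cmeas f -> 0 <= e ->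
  (\forall n \near \oo, (cnorm p (fun z => f z - v n z)%R <= e%:E)%E) ->
  (cnorm p (fun z => f z - limit_fun z)%R <= e%:E)%E.
Proof.
move=> mf e0 fe.
have mfv n : cmeas (fun z => f z - v n z) by exact: cmeasB.
have mfl : cmeas (fun z => f z - limit_fun z) by exact: cmeasB.
pose F n t := (cabs (f (expi t) - v n (expi t)) `^ p)%:E : \bar R.
have mF n : measurable_fun arc (F n).
  by apply: measurable_funTS; apply/measurable_EFinP; exact: (rmeas_cabs_powR p (mfv n)).
have F0 n t : (0 <= F n t)%E by rewrite lee_fin powR_ge0.
have fat := fatou mu (@arc_meas R) mF (fun n t _ => F0 n t).
have powE h : (cnorm p h `^ p = \int[mu]_(t in arc) (cabs (h (expi t)) `^ p)%:E)%E.
  rewrite /cnorm (rnorm_powE p_ge1); apply: eq_integral => t _.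
  by rewrite (ger0_norm (cabs_ge0 _)).
have le1 : (\int[mu]_(t in arc) (cabs (f (expi t) - limit_fun (expi t)) `^ p)%:E <=
    \int[mu]_(t in arc) limn_einf (F ^~ t))%E.
  apply: ae_ge0_le_integral.
  - exact: arc_meas.
  - by move=> t _; rewrite lee_fin powR_ge0.
  - by apply: measurable_funTS; apply/measurable_EFinP; exact: (rmeas_cabs_powR p mfl).
  - move=> t _; rewrite limn_einf_lim; apply: lime_ge; first exact: is_cvg_einfs.
    by apply: nearW => n; apply: le_ereal_inf_tmp => _ [m _ <-].
  - have mNF n : measurable_fun arc (fun t => - F n t)%E.
      by apply: (@measurableT_comp _ _ _ _ _ _ (@oppe R)); [exact: oppe_measurable|exact: mF].
    rewrite /limn_einf; apply: measurableT_comp => //.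
    by apply: measurable_fun_limn_esup => n; exact: mNF.
  apply: (@filterS _ _ (ae_filter_ringOfSetsType mu) _ _ _ ae_limit) => t H at_; have {}H := H at_.
  pose c := cabs (f (expi t) - limit_fun (expi t)); rewrite -/c.
  (* Continuity of the power is used at positive points; for c = 0 the lower bound is 0. *)
  have [->|c_neq0] := eqVneq c 0.
    rewrite powR0 ?gt_eqF// limn_einf_lim; apply: lime_ge; first exact: is_cvg_einfs.
    by apply: nearW => n; apply: le_ereal_inf_tmp => _ [m _ <-].
  have c0 : 0 < c by rewrite lt_neqAle eq_sym c_neq0 cabs_ge0.
  have fvc : cabs (f (expi t) - v n (expi t)) @[n --> \oo] --> c.
    apply/cvgrPdist_le => ep ep0; move/cvgrPdist_le : H => /(_ _ ep0).
    apply: filterS => n; rewrite sub0r normrN ger0_norm ?cabs_ge0//; apply: le_trans.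
    exact: cabs_dist.
  have : F n t @[n --> \oo] --> (c `^ p)%:E.
    apply: cvg_EFin; first exact: nearW.
    exact: (cvg_comp _ _ fvc (powR_continuous_gt0 c0)).
  by move=> /cvg_limn_einf_sup[-> _].
have le2 : (limn_einf (fun n => \int[mu]_(t in arc) F n t) <= (e `^ p)%:E)%E.
  rewrite limn_einf_lim; apply: lime_le; first exact: is_cvg_einfs.
  apply: filterS fe => n fen; apply: (@le_trans _ _ (\int[mu]_(t in arc) F n t)%E).
    by apply: ereal_inf_lbound; exists n => //=.
  by rewrite -(powE (fun z => f z - v n z)) -poweR_EFin poweR_le ?cnorm_ge0// ltW.
have le3 := le_trans le1 (le_trans fat le2).
move: le3; rewrite -(powE (fun z => f z - limit_fun z)) => le3.
have pi0 : 0 <= p^-1 by rewrite invr_ge0 ltW.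
have := poweR_le pi0 (poweR_ge0 _ _) le3.
by rewrite poweR_EFin -poweRrM -powRrM divff ?gt_eqF// powRr1// poweRe1// cnorm_ge0.
Qed.

Lemma cmeas_limit : cmeas limit_fun. Proof. exact: mlimit. Qed.

End limit.

Theorem cnorm_complete u : (forall n, LpT p (u n)) -> cauchy_cnorm u ->
  exists2 g, LpT p g & cnorm p (fun z => u n z - g z) @[n --> \oo] --> 0%E.
Proof.
move=> Lu cu; have half0 n : 0 < ((1 / 2) ^+ n : R) by rewrite exprn_gt0//; lra.
pose N j := projT1 (cid (cu _ (half0 j))).
have NP j n m : (N j <= n)%N -> (N j <= m)%N ->
    (cnorm p (fun z => u n z - u m z)%R <= ((1 / 2) ^+ j)%:E)%E.
  exact: (projT2 (cid (cu _ (half0 j)))).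
(* Taking the maximum of the thresholds up to j puts both [M j] and [M j.+1] beyond [N j], so the
   subsequence has steps of norm at most 2^(-j). *)
pose M j := (\max_(i < j.+1) N i)%N.
have NM i j : (i <= j)%N -> (N i <= M j)%N.
  by move=> ij; rewrite /M (leq_bigmax (F := fun i : 'I_j.+1 => N i) (Ordinal (ij : (i < j.+1)%N))).
pose v j := u (M j).
have Lv j : LpT p (v j) by exact: Lu.
have vf j : (cnorm p (fun z => v j.+1 z - v j z)%R <= ((1 / 2) ^+ j)%:E)%E.
  by apply: NP; apply: NM.
have mg : cmeas (limit_fun v) by exact: cmeas_limit.
have near_le j n : (N j <= n)%N ->
    (cnorm p (fun z => u n z - limit_fun v z)%R <= ((1 / 2) ^+ j)%:E)%E.
  move=> Njn; apply: (cnorm_limit_le Lv vf); [exact: LpT_cmeas|exact: ltW|].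
  by exists j => // k /= jk; apply: NP => //; exact: NM.
exists (limit_fun v).
  apply/LpTE; split => //; have mu0 := LpT_cmeas (Lu (N 0%N)).
  apply: (@le_lt_trans _ _ (cnorm p (u (N 0%N)) +
     cnorm p (fun z => u (N 0%N) z - limit_fun v z)%R)%E).
    apply: le_trans (cnormB p_ge1 mu0 (cmeasB mu0 mg)); apply: le_cnorm => //.
      by apply: cmeasB => //; exact: cmeasB.
    by move=> z; rewrite opprB addrC subrK.
  rewrite lte_add_pinfty//; first exact: LpT_lty.
  exact: le_lt_trans (near_le 0%N _ (leqnn _)) (ltry _).
apply/cvge0P => [n|e e0]; first exact: cnorm_ge0.
have [j je] : exists j, ((1 / 2) ^+ j : R) <= e.
  have : (1 / 2 : R) ^+ n @[n --> \oo] --> 0 by apply: cvg_expr; rewrite ger0_norm; lra.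
  move=> /cvgrPdist_le /(_ _ e0) [j _ /(_ j (leqnn _))].
  by rewrite sub0r normrN ger0_norm ?exprn_ge0//; exists j.
exists (N j) => // n /= Nn; apply: le_trans (near_le _ _ Nn) _.
by rewrite lee_fin.
Qed.

End completeness.

(** * Density of trigonometric polynomials *)

Section circle_argument.
Variable R : realType.
Implicit Types (t : R) (z : circle R).

Lemma expi_valN t : expi_val (- t) = (expi_val t)^-1.
Proof.
have tt : expi_val (- t) * expi_val t = 1 by rewrite -expi_valD addNr expi_val0.
have e0 : expi_val t != 0 by rewrite -cabs_eq0 cabs_expi oner_neq0.
by rewrite -[LHS](mulfK e0) tt mul1r.
Qed.

Lemma expi_valX t (m : int) : expi_val t ^ m = expi_val (m%:~R * t).
Proof.
have nat_case (n : nat) : expi_val t ^+ n = expi_val (n%:R * t).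
  elim: n => [|n IHn]; first by rewrite expr0 mul0r expi_val0.
  by rewrite exprS IHn -expi_valD -natr1 mulrDl mul1r addrC.
case: m => n; first by rewrite -exprnP nat_case.
by rewrite NegzE -exprnN nat_case -expi_valN mulrNz mulNr.
Qed.

Lemma expi_val_periodic t (m : int) : expi_val (t + m%:~R * (2 * pi)) = expi_val t.
Proof.
rewrite expi_valD -expi_valX (_ : expi_val (2 * pi) = 1) ?exp1rz ?mulr1//.
by rewrite /expi_val mulr_natl cos2pi sin2pi.
Qed.

Lemma cabs_circle z : cabs (sval z) = 1.
Proof.
by case: z => z /= /eqP; rewrite normc_def => /(congr1 (@complex.Re R)) /= <-; rewrite cabsE.
Qed.

Lemma circle_neq0 z : sval z != 0.
Proof. by rewrite -cabs_eq0 cabs_circle oner_neq0. Qed.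

(** The argument in [0, 2 pi[; it lets sets of the real line be pulled back to the circle. *)
Definition carg z : R :=
  let: x +i* y := sval z in if 0 <= y then acos x else 2 * pi - acos x.

Let coordP z : -1 <= complex.Re (sval z) <= 1 /\
  Num.sqrt (1 - complex.Re (sval z) ^+ 2) = `|complex.Im (sval z)|.
Proof.
have := sqr_cabs (sval z); rewrite cabs_circle expr1n => E.
split; last by rewrite E addrAC subrr add0r sqrtr_sqr.
rewrite -ler_norml -(@ler_pXn2r _ 2)// ?nnegrE// expr1n real_normK ?num_real// E.
by rewrite lerDl sqr_ge0.
Qed.

Lemma carg_ge0 z : 0 <= carg z.
Proof.
rewrite /carg; case: (sval z) (coordP z) => x y /= [x1 _]; case: ifP => _; first exact: acos_ge0.
by rewrite subr_ge0 (le_trans (acos_lepi x1))// ler_peMl ?pi_ge0// ler1n.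
Qed.

Lemma carg_lt z : carg z < 2 * pi.
Proof.
have pi0 : 0 < pi :> R := pi_gt0 R.
rewrite /carg; case: (sval z) (coordP z) => x y /= [x1 sE]; case: ifPn => y0.
  by apply: le_lt_trans (acos_lepi x1) _; rewrite ltr_pMl// ltr1n.
rewrite gtrBl acos_gt0//; have /andP[-> x1'] := x1; rewrite lt_neqAle x1' andbT.
apply/eqP => xE; move: sE; rewrite xE expr1n subrr sqrtr0 => /esym/eqP.
by rewrite normr_eq0 => /eqP yE; move: y0; rewrite yE lexx.
Qed.

Lemma cargK z : expi (carg z) = z.
Proof.
apply: val_inj => /=; rewrite /carg.
case: (sval z) (coordP z) => x y /= [x1 sE].
have cE : cos (acos x) = x by rewrite acosK// in_itv.
have siE : sin (acos x) = `|y| by rewrite sin_acos.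
case: ifPn => y0; first by rewrite /expi_val cE siE ger0_norm.
rewrite addrC -[2 * pi]mul1r (expi_val_periodic _ 1) /expi_val cosN sinN cE siE.
by rewrite ler0_norm ?opprK// ltW// ltNge.
Qed.

Lemma expi_inj t u : 0 <= t < 2 * pi -> 0 <= u < 2 * pi -> expi t = expi u -> t = u.
Proof.
wlog : t u / t <= u => [H t0 u0 tu|].
  by have [/H|/ltW /H] := leP t u; [exact|move=> /(_ u0 t0 (esym tu))].
rewrite le_eqVlt => /predU1P[//|tu] /andP[t0 _] /andP[_ u2] /(congr1 val)/= [ct st].
have : cos (u - t) = 1 by rewrite cosB ct st -!expr2 cos2Dsin2.
have -> : u - t = ((u - t) / 2) *+ 2 by rewrite -mulr_natr divfK.
rewrite cos_mulr2n; have : 0 < sin ((u - t) / 2).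
  apply: sin_gt0_pi; move: (pi) t0 u2 tu => P t0 u2 tu; apply/andP; split; lra.
have := cos2Dsin2 ((u - t) / 2); move: (cos _) (sin _) => c s h s0 h2.
by exfalso; nra.
Qed.

(** This explicit lift yields measurability, the floor being monotone. *)
Lemma carg_expi t : carg (expi t) = t - 2 * pi * (Num.floor (t / (2 * pi)))%:~R.
Proof.
have pi0 : 0 < 2 * pi :> R by rewrite mulr_gt0 ?pi_gt0.
apply: expi_inj; first by rewrite carg_ge0 carg_lt.
  have /andP[] := floor_itv (t / (2 * pi)); rewrite ler_pdivlMr// ltr_pdivrMr// intrD -[1%:~R]/(1 : R).
  by set k := (Num.floor (_ / _))%:~R; move: k (2 * pi) => k c f1 f2; apply/andP; split; lra.
rewrite cargK; apply: val_inj => /=.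
by rewrite -mulrN mulrC -intrN expi_val_periodic.
Qed.

Lemma carg_id t : 0 <= t < 2 * pi -> carg (expi t) = t.
Proof. by move=> t0; apply: expi_inj; rewrite ?carg_ge0 ?carg_lt ?cargK. Qed.

Lemma rmeas_carg : rmeas carg.
Proof.
rewrite /rmeas; under eq_fun do rewrite carg_expi.
apply: measurable_funB => //; apply: measurable_funM => //.
apply: nondecreasing_measurable => // x y xy; rewrite ler_int; apply: le_floor.
by rewrite ler_pM2r// invr_gt0 mulr_gt0 ?pi_gt0.
Qed.

End circle_argument.

Section trigonometric_polynomials.
Variables (R : realType) (p : R).
Hypothesis p_ge1 : 1 <= p.
Local Notation mu := (@lebesgue_measure R).
Local Notation arc := (`[0, 2 * pi]%classic : set R).
Implicit Types (f g : circle R -> R[i]) (c : seq (R[i] * int)).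

(** A list of coefficients and exponents in which exponents may repeat: a sum is a concatenation,
    and the analytic part is a filter on the exponents. *)
Definition trigp c (z : circle R) : R[i] := \sum_(x <- c) x.1 * sval z ^ x.2.

Definition is_trig g := exists c, g = trigp c.

Lemma is_trig_exp (m : int) : is_trig (fun z => sval z ^ m).
Proof. by exists [:: (1, m)]; apply/funext => z; rewrite /trigp big_seq1 mul1r. Qed.

Lemma is_trig_cst (a : R[i]) : is_trig (fun=> a).
Proof. by exists [:: (a, 0)]; apply/funext => z; rewrite /trigp big_seq1 expr0z mulr1. Qed.

Lemma is_trigD f g : is_trig f -> is_trig g -> is_trig (fun z => f z + g z).
Proof. by move=> [c ->] [d ->]; exists (c ++ d); apply/funext => z; rewrite /trigp big_cat. Qed.

Lemma is_trigM f g : is_trig f -> is_trig g -> is_trig (fun z => f z * g z).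
Proof.
move=> [c ->] [d ->].
exists [seq (x.1 * y.1, x.2 + y.2) | x <- c, y <- d]; apply/funext => z.
rewrite /trigp big_allpairs_dep/= big_distrlr/=; apply: eq_bigr => x _.
apply: eq_bigr => y _; rewrite expfzDr ?circle_neq0//.
by rewrite mulrACA.
Qed.

Lemma is_trigX f n : is_trig f -> is_trig (fun z => f z ^+ n).
Proof.
move=> tf; elim: n => [|n IHn]; first exact: is_trig_cst.
by under eq_fun do rewrite exprS; exact: is_trigM.
Qed.

Lemma is_trig_sum (I : Type) (s : seq I) (F : I -> circle R -> R[i]) :
  (forall i, is_trig (F i)) -> is_trig (fun z => \sum_(i <- s) F i z).
Proof.
move=> tF; elim: s => [|i s IHs].
  by under eq_fun do rewrite big_nil; exact: is_trig_cst.
by under eq_fun do rewrite big_cons; exact: is_trigD.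
Qed.

Lemma cmeas_exp (m : int) : cmeas (fun z : circle R => sval z ^ m).
Proof.
split; rewrite /rmeas /=; under eq_fun do rewrite expi_valX /=.
- apply: (@measurableT_comp _ _ _ _ _ _ (@cos R)).
    by apply: continuous_measurable_fun; exact: continuous_cos.
  by apply: measurable_funM => //; exact: measurable_cst.
- apply: (@measurableT_comp _ _ _ _ _ _ (@sin R)).
    by apply: continuous_measurable_fun; exact: continuous_sin.
  by apply: measurable_funM => //; exact: measurable_cst.
Qed.

Lemma cabs_exp (m : int) (z : circle R) : cabs (sval z ^ m) = 1.
Proof. by rewrite -(cargK z)/= expi_valX cabs_expi. Qed.

Lemma is_trig_LpT g : is_trig g -> LpT p g.
Proof.
move=> [c ->]; apply: LpT_sum => // x; apply: LpTZ => //.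
by apply: (LpT_bounded p_ge1 (M := 1)); [exact: cmeas_exp|move=> z; rewrite cabs_exp].
Qed.

Lemma is_trig_cmeas g : is_trig g -> cmeas g.
Proof. by move=> /is_trig_LpT; exact: LpT_cmeas. Qed.

Definition trig_approx f := forall e : R, 0 < e ->
  exists2 g, is_trig g & (cnorm p (fun z => f z - g z)%R <= e%:E)%E.

Lemma trig_approx_trig f : is_trig f -> trig_approx f.
Proof.
move=> tf e e0; exists f => //; under eq_fun do rewrite subrr.
by rewrite cnorm0// lee_fin ltW.
Qed.

Lemma trig_approxD f g : cmeas f -> cmeas g -> trig_approx f -> trig_approx g ->
  trig_approx (fun z => f z + g z).
Proof.
move=> mf mg af ag e e0; have e2 : 0 < e / 2 by rewrite divr_gt0.
have [f' tf' ff'] := af _ e2; have [g' tg' gg'] := ag _ e2.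
have mf' := is_trig_cmeas tf'; have mg' := is_trig_cmeas tg'.
exists (fun z => f' z + g' z); first exact: is_trigD.
under eq_fun do rewrite opprD addrACA.
apply: le_trans (cnormD p_ge1 (cmeasB mf mf') (cmeasB mg mg')) _.
by rewrite [e]splitr EFinD leeD.
Qed.

Lemma trig_approxZ (a : R[i]) f : cmeas f -> trig_approx f -> trig_approx (fun z => a * f z).
Proof.
move=> mf af e e0; have a0 := cabs_ge0 a.
have a1 : 0 < cabs a + 1 by rewrite ltr_wpDl.
have [f' tf' ff'] := af _ (divr_gt0 e0 a1).
exists (fun z => a * f' z); first by apply: is_trigM => //; exact: is_trig_cst.
under eq_fun do rewrite -mulrBr.
rewrite (cnormZ p_ge1 a (cmeasB mf (is_trig_cmeas tf'))).
apply: (@le_trans _ _ ((cabs a)%:E * (e / (cabs a + 1))%:E)%E).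
  by apply: lee_wpmul2l; rewrite ?lee_fin.
rewrite -EFinM lee_fin mulrCA ler_piMr ?(ltW e0)//.
by rewrite ler_pdivrMr// mul1r lerDl.
Qed.

Lemma trig_approx_sum (I : Type) (s : seq I) (F : I -> circle R -> R[i]) :
  (forall i, cmeas (F i)) -> (forall i, trig_approx (F i)) -> trig_approx (fun z => \sum_(i <- s) F i z).
Proof.
move=> mF aF; elim: s => [|i s IHs].
  by under eq_fun do rewrite big_nil; apply: trig_approx_trig; exact: is_trig_cst.
by under eq_fun do rewrite big_cons; apply: trig_approxD => //; exact: cmeas_sum.
Qed.

Lemma trig_approx_lim f (u : (circle R -> R[i])^nat) : cmeas f -> (forall n, cmeas (u n)) ->
  (forall n, trig_approx (u n)) -> cnorm p (fun z => f z - u n z) @[n --> \oo] --> 0%E -> trig_approx f.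
Proof.
move=> mf mu_ au /cvge0P uf e e0; have e2 : 0 < e / 2 by rewrite divr_gt0.
have [n _ /(_ n (leqnn _)) /= fun_] := uf (fun n => cnorm_ge0 _ _) _ e2.
have [g tg gg] := au n _ e2; have mg := is_trig_cmeas tg.
exists g => //; apply: le_trans (cnorm_triangle p_ge1 mf (mu_ n) mg) _.
by rewrite [e]splitr EFinD leeD.
Qed.

(* The powers (1 - y^n)^(2^n) tend to 1 for y < 1/2 and to 0 for y > 1/2; composed
   with the trigonometric polynomial ray they approach the indicator of an arc. *)
Lemma step_bound (y : R) n : 0 <= y <= 1 ->
  [/\ 0 <= (1 - y ^+ n) ^+ (2 ^ n) <= 1,
      1 - (2 * y) ^+ n <= (1 - y ^+ n) ^+ (2 ^ n) &
      (1 - y ^+ n) ^+ (2 ^ n) * (2 * y) ^+ n <= 1].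
Proof.
move=> /andP[y0 y1]; have q0 : 0 <= y ^+ n by rewrite exprn_ge0.
have q1 : y ^+ n <= 1 by rewrite exprn_ile1.
have -> : (2 * y) ^+ n = (2 ^ n)%:R * y ^+ n by rewrite exprMn natrX.
move: (y ^+ n) (2 ^ n)%N q0 q1 => q N q0 q1.
have b0 : 0 <= (1 - q) ^+ N by rewrite exprn_ge0// subr_ge0.
have b1 : (1 - q) ^+ N <= 1 by rewrite exprn_ile1 ?subr_ge0// gerBl.
have c1 : 1 - N%:R * q <= (1 - q) ^+ N.
  elim: N {b0 b1} => [|N IHN]; first by rewrite mul0r subr0 expr0.
  rewrite exprS -natr1; have N0 : 0 <= N%:R :> R by [].
  by move: (_ ^+ N) (N%:R) N0 IHN => a b N0 IHN; nra.
have c2 : 1 + N%:R * q <= (1 + q) ^+ N.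
  elim: N {b0 b1 c1} => [|N IHN]; first by rewrite mul0r addr0 expr0.
  rewrite exprS -natr1; have N0 : 0 <= N%:R :> R by [].
  by move: (_ ^+ N) (N%:R) N0 IHN => a b N0 IHN; nra.
split => //; first by rewrite b0.
(* The product is (1 - q^2)^N, and by Bernoulli (1 + q)^N is at least 1 + N q, hence at least N
   q. *)
have c3 : (1 - q) ^+ N * (1 + q) ^+ N <= 1.
  rewrite -exprMn exprn_ile1//; nra.
apply: le_trans c3; apply: ler_wpM2l => //; apply: le_trans c2; by rewrite lerDr.
Qed.

Lemma step_cvg (y : R) : 0 <= y <= 1 -> y != 1 / 2 ->
  (1 - y ^+ n) ^+ (2 ^ n) @[n --> \oo] --> ((y < 1 / 2)%R%:R : R).
Proof.
move=> y01 y2; have [y0 y1] := andP y01.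
have [yl|yl] := ltP y (1 / 2); rewrite ?mulr1n ?mulr0n.
  have r : `|2 * y| < 1 by rewrite ger0_norm; lra.
  have rc := cvg_expr r; have : 1 - (2 * y) ^+ n @[n --> \oo] --> (1 : R).
    rewrite -[X in _ --> X]subr0; apply: cvgB => //; exact: cvg_cst.
  move=> H; apply: (squeeze_cvgr _ H (cvg_cst (1 : R))); apply: nearW => n.
  by have [/andP[_ ->] -> _] := step_bound n y01.
have yg : 1 / 2 < y by rewrite lt_neqAle eq_sym y2.
have r : `|(2 * y)^-1| < 1.
  by rewrite ger0_norm ?invr_ge0 ?invf_lt1; lra.
apply: (squeeze_cvgr _ (cvg_cst (0 : R)) (cvg_expr r)); apply: nearW => n.
have [/andP[-> _] _ h] := step_bound n y01; rewrite /= exprVn -[leRHS]mul1r ler_pdivlMr//.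
by rewrite exprn_gt0; lra.
Qed.

(** For 0 < x < 2 pi this is below 1/2 exactly where the argument lies strictly between 0 and x,
    since then it is closer than x/2 to the midpoint x/2. Dividing by 4 keeps the values in
    [0, 1]. *)
Let ray (x : R) z : R := 1 / 2 + (cos (x / 2) - cos (carg z - x / 2)) / 4.

Let ray01 x z : 0 <= ray x z <= 1.
Proof.
have := cos_geN1 (x / 2); have := cos_le1 (x / 2).
have := cos_geN1 (carg z - x / 2); have := cos_le1 (carg z - x / 2).
rewrite /ray; move: (cos (x / 2)) (cos _) => a b h1 h2 h3 h4.
by apply/andP; split; lra.
Qed.

Let ray_trig x : is_trig (fun z => (ray x z)%:C).
Proof.
have -> : (fun z => (ray x z)%:C) = fun z : circle R =>
    (1 / 2 + cos (x / 2) / 4)%:C +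
    (- (1 / 8))%:C * (expi_val (- (x / 2)) * sval z ^ 1 + expi_val (x / 2) * sval z ^ (-1)).
  apply/funext => z; rewrite -[in RHS](cargK z) /= !expi_valX mulN1r.
  rewrite -[1%:~R]/(1 : R) [1 * carg z]mul1r -!expi_valD.
  rewrite -[x / 2 - carg z]opprB [- (x / 2) + _]addrC.
  rewrite /ray /expi_val cosN sinN; apply/eqP; rewrite eq_complex /=.
  by apply/andP; split; apply/eqP; field.
apply: is_trigD; first exact: is_trig_cst.
apply: is_trigM; first exact: is_trig_cst.
by apply: is_trigD; apply: is_trigM; (try exact: is_trig_cst); exact: is_trig_exp.
Qed.

Let ray_lt x t : 0 < x < 2 * pi -> 0 <= t < 2 * pi -> t != 0 -> t != x ->
  ray x (expi t) != 1 / 2 /\ (ray x (expi t) < 1 / 2) = (t < x).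
Proof.
move=> /andP[x0 x2] t02 tn0 tx; rewrite /ray carg_id//; have /andP[t0 t2] := t02.
have {}t0 : 0 < t by rewrite lt_neqAle eq_sym tn0.
have cos_half (a b : R) : (1 / 2 + (a - b) / 4 < 1 / 2) = (a < b).
  by apply/idP/idP; lra.
have cos_half' (a b : R) : a != b -> 1 / 2 + (a - b) / 4 != 1 / 2.
  by apply: contraNN => /eqP h; apply/eqP; lra.
rewrite cos_half; suff : (cos (x / 2) < cos (t - x / 2)) = (t < x) /\ cos (x / 2) != cos (t - x / 2).
  by move=> [-> /cos_half' ->].
have [tx'|xt] := ltP t x.
  suff : cos (x / 2) < cos (t - x / 2) by move=> h; split => //; rewrite lt_eqF.
  have -> : cos (t - x / 2) = cos `|t - x / 2|.
    by have [h|h] := leP 0 (t - x / 2); [rewrite ger0_norm|rewrite ler0_norm ?cosN// ltW].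
  rewrite ltr_cos ?in_itv/= ?normr_ge0/=.
  - by rewrite ltr_norml; apply/andP; split; lra.
  - by rewrite ler_norml; move: (pi) x2 t2 => P x2 t2; apply/andP; split; lra.
  - by apply/andP; split; [lra|move: (pi) x2 => P x2; lra].
have {}xt : x < t by rewrite lt_neqAle eq_sym tx.
suff h : cos (t - x / 2) < cos (x / 2) by split; [apply/negbTE; rewrite -leNgt ltW|rewrite gt_eqF].
have xpi : x / 2 \in `[0, pi] by rewrite in_itv/=; apply/andP; split; move: (pi) x2 => P x2; lra.
have [tpi|tpi] := leP (t - x / 2) pi.
  rewrite ltr_cos//; first by lra.
  by rewrite in_itv/= tpi andbT; lra.
(* Reflection brings the angle back into [0, pi], where the cosine is decreasing. *)
have -> : cos (t - x / 2) = cos (2 * pi - (t - x / 2)).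
  by rewrite -[LHS]cosN -[LHS]cosD2pi; congr cos; rewrite -mulr_natl; ring.
rewrite ltr_cos//.
  by move: (pi) x2 t2 => P x2 t2; lra.
by rewrite in_itv/=; move: (pi) tpi x2 t2 => P tpi x2 t2; apply/andP; split; lra.
Qed.

Lemma trig_approx_ray (x : R) : trig_approx (fun z => (\1_(`]-oo, x[%classic : set R) (carg z))%:C).
Proof.
have [x0|x0] := leP x 0.
  have -> : (fun z => (\1_(`]-oo, x[%classic : set R) (carg z))%:C) = fun=> 0 : R[i].
    apply/funext => z; rewrite indicE memNset//= in_itv/=.
    by apply/negP; rewrite -leNgt (le_trans x0)// carg_ge0.
  by apply: trig_approx_trig; exact: is_trig_cst.
have [x2|x2] := leP (2 * pi) x.
  have -> : (fun z => (\1_(`]-oo, x[%classic : set R) (carg z))%:C) = fun=> 1 : R[i].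
    apply/funext => z; rewrite indicE mem_set//= in_itv/=.
    by rewrite (lt_le_trans (carg_lt z)).
  by apply: trig_approx_trig; exact: is_trig_cst.
have x02 : 0 < x < 2 * pi by rewrite x0.
pose u n z := (1 - ray x z ^+ n) ^+ (2 ^ n).
have tu n : is_trig (fun z => (u n z)%:C).
  have -> : (fun z => (u n z)%:C) = fun z => (1 + (-1) * (ray x z)%:C ^+ n) ^+ (2 ^ n).
    by apply/funext => z; rewrite /u rmorphXn rmorphB rmorphXn mulN1r.
  apply: is_trigX; apply: is_trigD; first exact: is_trig_cst.
  by apply: is_trigM; [exact: is_trig_cst|apply: is_trigX; exact: ray_trig].
have mI : rmeas (fun z => \1_(`]-oo, x[%classic : set R) (carg z)).
  have mi : measurable_fun setT (\1_(`]-oo, x[%classic : set R) : R -> R).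
    by apply: measurable_indic; exact: measurable_itv.
  exact: (measurableT_comp mi (@rmeas_carg R)).
have cI : cmeas (fun z => (\1_(`]-oo, x[%classic : set R) (carg z))%:C).
  by split => //=; exact: measurable_cst.
apply: (trig_approx_lim cI (fun n => is_trig_cmeas (tu n)) (fun n => trig_approx_trig (tu n))).
apply: (rnorm_cvg0 p_ge1 (g := fun=> 2)).
- by move=> n; apply: rmeas_cabs; apply: cmeasB => //; exact: is_trig_cmeas.
- exact: measurable_cst.
- exact: rnorm_cst.
- move=> n z; rewrite -raddfB cabs_real normr_id [leRHS]ger0_norm//.
  have [/andP[u0 u1] _ _] := step_bound n (ray01 x z).
  rewrite /u; apply: le_trans (ler_normB _ _) _; rewrite [X in _ + X]ger0_norm//.
  rewrite (_ : 2 = 1 + 1)// lerD// ger0_norm ?indicE//; by case: (_ \in _).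
(* Excluded are 0 and x, where [ray] equals 1/2, and 2 pi, whose argument is 0. *)
- have n0 : mu.-negligible ([set 0; x] `|` [set 2 * pi] : set R).
    exists ([set 0; x] `|` [set 2 * pi]); split => //.
      by do 2?apply: measurableU; exact: measurable_set1.
    apply: countable_lebesgue_measure0; apply: finite_set_countable.
    by rewrite !finite_setU; split; [split|]; exact: finite_set1.
  apply: negligibleS n0 => t /= /not_implyP[at_ H]; apply: contrapT => /not_orP[/not_orP[t0 tx] t2].
  apply: H; move/eqP: t0 => t0; move/eqP: tx => tx; move/eqP: t2 => t2.
  move: at_; rewrite /= in_itv/= => /andP[t0' t2'].
  have t02 : 0 <= t < 2 * pi by rewrite t0' lt_neqAle t2.
  have [r2 rE] := ray_lt x02 t02 t0 tx.
  have uc := step_cvg (ray01 x (expi t)) r2; rewrite rE in uc.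
  have -> : (fun n => cabs ((\1_(`]-oo, x[%classic : set R) (carg (expi t)))%:C - (u n (expi t))%:C)) =
      fun n => `|u n (expi t) - ((t < x)%R%:R)|.
    apply/funext => n; rewrite -raddfB cabs_real distrC carg_id// indicE.
    by congr (`|_ - _|); congr (_%:R); congr nat_of_bool; apply/idP/idP; rewrite inE/= in_itv.
  rewrite -(normr0 R) -(subrr (((t < x)%R%:R) : R)); apply: cvg_norm.
  by apply: cvgB; [exact: uc|exact: cvg_cst].
Qed.


Let cind (B : set R) (z : circle R) : R[i] := (\1_B (carg z))%:C.

Let rmeas_ind B : measurable B -> rmeas (fun z => \1_B (carg z) : R).
Proof.
move=> mB; have mi : measurable_fun setT (\1_B : R -> R) by exact: measurable_indic.
exact: (measurableT_comp mi (@rmeas_carg R)).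
Qed.

Let cmeas_ind B : measurable B -> cmeas (cind B).
Proof. by move=> mB; split; [exact: rmeas_ind|exact: measurable_cst]. Qed.

(** The sets whose indicator can be approximated form a Dynkin system containing the half-lines,
    which are stable under intersection and generate the Borel sets. *)
Lemma trig_approx_indic (B : set R) : measurable B -> trig_approx (cind B).
Proof.
move=> mB; have GE := RGenInftyO.measurableE R.
have sB : <<s (@RGenInftyO.G R) >> B by rewrite -[<<s _>>]/((@RGenInftyO.G R).-sigma.-measurable) -GE.
move: B sB {mB}; apply: (dynkin_induction (G := @RGenInftyO.G R)).
- exact: GE.
- move=> _ _ [x ->] [y ->]; exists (Num.min x y); apply/seteqP; split => t /=.
    by rewrite !in_itv/= lt_min => -[-> ->].
  by rewrite !in_itv/= lt_min => /andP.
- have -> : cind setT = fun=> 1 by apply/funext => z; rewrite /cind indicT.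
  by apply: trig_approx_trig; exact: is_trig_cst.
- by move=> _ [x ->]; exact: trig_approx_ray.
- move=> B mB aB; have -> : cind (~` B) = fun z => 1 + (-1) * cind B z.
    apply/funext => z; rewrite /cind !indicE in_setC; case: (_ \in B) => /=.
      by rewrite mulr1 subrr.
    by rewrite mulr0 addr0.
  apply: trig_approxD; [exact: cmeas_cst|exact/cmeasZ/cmeas_ind|apply: trig_approx_trig; exact: is_trig_cst|].
  by apply: trig_approxZ => //; exact: cmeas_ind.
(* The indicator of a disjoint union is the pointwise limit of the partial sums of indicators, with
   errors bounded by 1. *)
move=> F mF tF aF; have mU : measurable (\bigcup_n F n) by exact: bigcup_measurable.
pose s n z := \sum_(0 <= i < n) \1_(F i) (carg z) : R.
pose u n z := \sum_(0 <= i < n) cind (F i) z.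
have mu_ n : cmeas (u n) by apply: cmeas_sum => i; exact: cmeas_ind.
have usE n z : cabs (cind (\bigcup_k F k) z - u n z) = `|\1_(\bigcup_k F k) (carg z) - s n z|.
  by rewrite /u /cind -rmorph_sum -raddfB cabs_real.
have i0 i z : (0 <= (\1_(F i) (carg z) : R)%:E)%E by rewrite lee_fin.
have s_ge0 n z : 0 <= s n z by apply: sumr_ge0 => i _; rewrite -lee_fin.
have s_le n z : s n z <= \1_(\bigcup_k F k) (carg z).
  by rewrite -lee_fin indic_bigcup// /s -sumEFin; apply: nneseries_lim_ge.
apply: (trig_approx_lim (cmeas_ind mU) mu_ (fun n => trig_approx_sum _ (fun i => cmeas_ind (mF i)) aF)).
apply: (rnorm_cvg0 p_ge1 (g := fun=> 1)).
- by move=> n; apply: rmeas_cabs; apply: cmeasB => //; exact: cmeas_ind.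
- exact: measurable_cst.
- exact: rnorm_cst.
- move=> n z; rewrite usE normr_id normr1 ger0_norm ?subr_ge0//.
  by rewrite lerBlDr (le_trans (_ : _ <= 1))// ?lerDl// indicE; case: (_ \in _).
apply: aeW => t _; under eq_fun do rewrite usE.
have sc : s n (expi t) @[n --> \oo] --> (\1_(\bigcup_k F k) (carg (expi t)) : R).
  have H : (s n (expi t))%:E @[n --> \oo] --> (\1_(\bigcup_k F k) (carg (expi t)) : R)%:E.
    rewrite indic_bigcup//; under eq_fun do rewrite /s -sumEFin.
    by apply: is_cvg_nneseries => i _ _; exact: i0.
  exact: (fine_cvg H).
rewrite -(normr0 R) -(subrr (\1_(\bigcup_k F k) (carg (expi t)) : R)); apply: cvg_norm.
by apply: cvgB; [exact: cvg_cst|exact: sc].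
Qed.

Lemma trig_approx_index (I : finType) (idx : circle R -> I) (phi : I -> R[i]) :
  imeas idx -> trig_approx (fun z => phi (idx z)).
Proof.
move=> mi; have -> : (fun z => phi (idx z)) =
    fun z => \sum_(i : I) phi i * cind [set t | idx (expi t) = i] z.
  apply/funext => z; rewrite (bigD1 (idx z))//= /cind indicE mem_set ?mulr1/= ?cargK//.
  rewrite big1 ?addr0// => i iz; rewrite indicE memNset ?mulr0//= cargK => zi.
  by move: iz; rewrite zi eqxx.
apply: trig_approx_sum => i; first exact/cmeasZ/cmeas_ind.
by apply: trig_approxZ; [exact: cmeas_ind|exact: trig_approx_indic].
Qed.

Theorem trig_approx_LpT f : LpT p f -> trig_approx f.
Proof.
move=> Lf; have mf := LpT_cmeas Lf.
have mq m : cmeas (fun z => qdec R (qcode m (f z))).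
  exact: (cmeas_index (imeas_qcode (m := m) mf) (@qdec R m)).
apply: (trig_approx_lim mf mq).
  by move=> m; apply: (trig_approx_index (@qdec R m)); exact: imeas_qcode.
by under eq_fun do rewrite cnormBC; exact: cnorm_qdec_cvg.
Qed.

End trigonometric_polynomials.

(** * Fourier partial sums *)

Section fourier_coefficients.
Variables (R : realType) (p : R).
Hypothesis p_gt1 : 1 < p.
Local Notation mu := (@lebesgue_measure R).
Local Notation arc := (`[0, 2 * pi]%classic : set R).
Implicit Types (f g : circle R -> R[i]).

Let p_ge1 : 1 <= p. Proof. exact: ltW. Qed.

Definition cmean f : R[i] := ((2 * pi)^-1)%:C * cintegral arc (fun t => f (expi t)).

Lemma fourier_coefE f (n : int) : fourier_coef f n = cmean (fun z => f z * sval z ^ (- n)).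
Proof.
rewrite /fourier_coef /cmean; congr (_ * cintegral _ _).
by apply/funext => t; rewrite /= expi_valX mulrNz mulNr.
Qed.

Lemma cmeas_mul_exp f (m : int) : cmeas f -> cmeas (fun z => f z * sval z ^ m).
Proof. by move=> mf; apply: cmeasM => //; exact: cmeas_exp. Qed.

Lemma cnorm_mul_exp f (m : int) : cnorm p (fun z => f z * sval z ^ m) = cnorm p f.
Proof.
rewrite /cnorm; congr (rnorm _ _); apply/funext => z.
by rewrite cabsM cabs_exp mulr1.
Qed.

Lemma LpT_mul_exp f (m : int) : LpT p f -> LpT p (fun z => f z * sval z ^ m).
Proof.
move=> /LpTE[mf fy]; apply/LpTE; split; first exact: cmeas_mul_exp.
by rewrite cnorm_mul_exp.
Qed.

Let L1_lty f : LpT p f -> (\int[mu]_(t in arc) (cabs (f (expi t)))%:E < +oo)%E.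
Proof.
move=> Lf; have [k k0 L1] := L1_le_cnorm p_gt1.
apply: le_lt_trans (L1 _ (LpT_cmeas Lf)) _.
by apply: lte_mul_pinfty; rewrite ?lee_fin ?LpT_lty.
Qed.

Let int_dominated (u : circle R -> R) f : rmeas u -> LpT p f ->
  (forall z, `|u z| <= cabs (f z)) -> mu.-integrable arc (EFin \o (u \o @expi R)).
Proof.
move=> mu_ Lf uf; apply/integrableP; split.
  by apply: measurable_funTS; apply/measurable_EFinP.
apply: le_lt_trans (L1_lty Lf); apply: ge0_le_integral.
- exact: arc_meas.
- by move=> t _; exact: abse_ge0.
- apply: measurableT_comp => //; apply: measurable_funTS; exact/measurable_EFinP.
- apply: measurable_funTS; exact: (rmeas_emeas (rmeas_cabs (LpT_cmeas Lf))).
- by move=> t _; rewrite /= lee_fin; exact: uf.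
Qed.

Lemma integrable_Re f : LpT p f -> mu.-integrable arc (EFin \o (fun t => complex.Re (f (expi t)))).
Proof.
move=> Lf; apply: (int_dominated (u := fun z => complex.Re (f z)) _ Lf).
  by have [] := LpT_cmeas Lf.
by move=> z; exact: Re_le_cabs.
Qed.

Lemma integrable_Im f : LpT p f -> mu.-integrable arc (EFin \o (fun t => complex.Im (f (expi t)))).
Proof.
move=> Lf; apply: (int_dominated (u := fun z => complex.Im (f z)) _ Lf).
  by have [] := LpT_cmeas Lf.
by move=> z; exact: Im_le_cabs.
Qed.

Lemma cmeanD f g : LpT p f -> LpT p g -> cmean (fun z => f z + g z) = cmean f + cmean g.
Proof.
move=> Lf Lg; rewrite /cmean -mulrDr; congr (_ * _); rewrite /cintegral.
rewrite (_ : (fun t => complex.Re (f (expi t) + g (expi t))) =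
   fun t => complex.Re (f (expi t)) + complex.Re (g (expi t))); last first.
  by apply/funext => t; rewrite raddfD.
rewrite (_ : (fun t => complex.Im (f (expi t) + g (expi t))) =
   fun t => complex.Im (f (expi t)) + complex.Im (g (expi t))); last first.
  by apply/funext => t; rewrite raddfD.
by rewrite !RintegralD//; (try exact: arc_meas); (try exact: integrable_Re); exact: integrable_Im.
Qed.

Lemma cmeanZ (a : R[i]) f : LpT p f -> cmean (fun z => a * f z) = a * cmean f.
Proof.
move=> Lf; rewrite /cmean mulrCA; congr (_ * _); rewrite /cintegral.
have iR := integrable_Re Lf; have iI := integrable_Im Lf; have mA := @arc_meas R.
case: a => a b.
have Z (c : R) (u : R -> R) : mu.-integrable arc (EFin \o u) ->
    mu.-integrable arc (EFin \o (fun t => c * u t)).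
  by move=> iu; have := integrableZl (mu := mu) mA c iu.
rewrite (_ : (fun t => complex.Re ((a +i* b) * f (expi t))) =
   fun t => a * complex.Re (f (expi t)) - b * complex.Im (f (expi t))); last first.
  by apply/funext => t; case: (f _).
rewrite (_ : (fun t => complex.Im ((a +i* b) * f (expi t))) =
   fun t => a * complex.Im (f (expi t)) + b * complex.Re (f (expi t))); last first.
  by apply/funext => t; case: (f _).
rewrite (RintegralB (mu := mu) mA (Z a _ iR) (Z b _ iI)) (RintegralD (mu := mu) mA (Z a _ iI) (Z b _ iR)).
by rewrite !RintegralZl.
Qed.

Lemma cmean_le : exists2 K : R, 0 <= K & forall f, LpT p f ->
  ((cabs (cmean f))%:E <= K%:E * cnorm p f)%E.
Proof.
have [k k0 L1] := L1_le_cnorm p_gt1; have mA := @arc_meas R.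
have c0 : 0 <= (2 * pi)^-1 :> R by rewrite invr_ge0 mulr_ge0 ?pi_ge0.
exists ((2 * pi)^-1 * (k + k)); first by rewrite mulr_ge0// addr_ge0.
move=> f Lf; rewrite /cmean cabsM cabs_real (ger0_norm c0).
have L1f := L1 _ (LpT_cmeas Lf).
have bnd (u : circle R -> R) : rmeas u -> (forall z, `|u z| <= cabs (f z)) ->
    ((`|\int[mu]_(t in arc) u (expi t)|)%:E <= k%:E * cnorm p f)%E.
  move=> mu_ uf; have iu := int_dominated mu_ Lf uf.
  rewrite (EFin_normr_Rintegral (mu := mu) mA iu); apply: le_trans L1f.
  apply: (le_trans (le_abse_integral mu mA (measurable_int mu iu))).
  apply: ge0_le_integral => //.
  - by apply: measurableT_comp => //; exact: measurable_int iu.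
  - apply: measurable_funTS; exact: (rmeas_emeas (rmeas_cabs (LpT_cmeas Lf))).
  - by move=> t _; rewrite /= lee_fin; exact: uf.
have [mR mI] := LpT_cmeas Lf.
have bR := bnd (fun z => complex.Re (f z)) mR (fun z => Re_le_cabs _).
have bI := bnd (fun z => complex.Im (f z)) mI (fun z => Im_le_cabs _).
rewrite !EFinM -muleA; apply: lee_wpmul2l; first by rewrite lee_fin.
apply: (@le_trans _ _ (`|\int[mu]_(t in arc) complex.Re (f (expi t))|%:E +
   `|\int[mu]_(t in arc) complex.Im (f (expi t))|%:E)%E).
  by rewrite -EFinD lee_fin; exact: (cabs_le_ReIm (cintegral arc (fun t => f (expi t)))).
by rewrite EFinD ge0_muleDl ?lee_fin// leeD.
Qed.

(** F(k t)/k is a primitive of the integrand and takes the same value at both ends of the period. *)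
Let int_trig0 (F G : R -> R) (k : int) : k != 0 -> continuous G ->
  (forall t : R, is_derive t 1 F (G t)) -> F 0 = F (2 * pi * k%:~R) ->
  \int[mu]_(t in arc) G (k%:~R * t) = 0.
Proof.
move=> k0 cG dF FE; have k0' : k%:~R != 0 :> R by rewrite intr_eq0.
pose H (t : R) := k%:~R^-1 * F (k%:~R * t).
have dH (t : R) : is_derive t 1 H (G (k%:~R * t)).
  have d1 : is_derive t 1 (fun t => k%:~R * t) k%:~R.
    by apply: is_derive_eq; rewrite /GRing.scale/=; ring.
  have d2 := @is_derive1_comp _ F _ _ _ _ (dF (k%:~R * t)) d1.
  apply: (is_derive_eq (is_deriveZ (k%:~R^-1) d2)).
  by rewrite /GRing.scale/= mulrC mulfK.
have cH t : {for t, continuous H}.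
  apply: differentiable_continuous; apply/derivable1_diffP.
  exact: (@ex_derive _ _ _ _ _ _ _ (dH t)).
rewrite /Rintegral (@continuous_FTC2 _ _ H).
- by rewrite /H mulr0 FE [k%:~R * _]mulrC subee.
- by rewrite mulr_gt0 ?pi_gt0.
- apply: continuous_subspaceT => t.
  by apply: continuous_comp; [apply: mulrl_continuous|exact: cG].
- split => [t _||].
  + exact: (@ex_derive _ _ _ _ _ _ _ (dH t)).
  + by apply: cvg_at_right_filter; exact: cH.
  + by apply: cvg_at_left_filter; exact: cH.
- by move=> t _; rewrite derive1E; exact: (@derive_val _ _ _ _ _ _ _ (dH t)).
Qed.

Lemma cmean_exp (m : int) : cmean (fun z : circle R => sval z ^ m) = (m == 0)%R%:R.
Proof.
rewrite /cmean /cintegral.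
rewrite (_ : (fun t => complex.Re (sval (expi t) ^ m)) = fun t : R => cos (m%:~R * t)); last first.
  by apply/funext => t; rewrite /= expi_valX.
rewrite (_ : (fun t => complex.Im (sval (expi t) ^ m)) = fun t : R => sin (m%:~R * t)); last first.
  by apply/funext => t; rewrite /= expi_valX.
have [->|m0] := eqVneq m 0.
  under eq_Rintegral do rewrite mul0r cos0.
  under [in X in _ +i* X]eq_Rintegral do rewrite mul0r sin0.
  rewrite !Rintegral_cst; (try exact: arc_meas).
  have -> : fine (mu arc) = 2 * pi by have -> := @mu_arc R.
  by rewrite mul0r mul1r -rmorphM mulVf// mulf_neq0// gt_eqF// pi_gt0.
have e2 (t : R) := expi_val_periodic t m.
have dN (t : R) : is_derive t 1 (fun t : R => - cos t) (sin t).
  by apply: is_derive_eq; rewrite opprK.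
have [ec es] := e2 0; rewrite add0r mulrC in ec es.
have -> := int_trig0 m0 (@continuous_cos R) (@is_derive_sin R) (esym es).
have -> := int_trig0 m0 (@continuous_sin R) dN (esym (congr1 -%R ec)).
by rewrite mulr0.
Qed.

End fourier_coefficients.

(** * Partial sums of Fourier series and their limits *)

Section partial_sums.
Variables (R : realType) (p : R).
Hypothesis p_gt1 : 1 < p.
Implicit Types (f g : circle R -> R[i]) (c : seq (R[i] * int)).

Let p_ge1 : 1 <= p. Proof. exact: ltW. Qed.

Local Notation S := (@analytic_partial_sum R).

Lemma fourier_coef_lin (a : R[i]) f g n : LpT p f -> LpT p g ->
  fourier_coef (fun z => a * f z + g z) n = a * fourier_coef f n + fourier_coef g n.
Proof.
move=> Lf Lg; rewrite !fourier_coefE.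
have Lf' := LpT_mul_exp (- n) Lf; have Lg' := LpT_mul_exp (- n) Lg.
rewrite -(cmeanZ p_gt1 a Lf') -(cmeanD p_gt1 (LpTZ p_ge1 a Lf') Lg').
by congr cmean; apply/funext => z; rewrite mulrDl mulrA.
Qed.

Lemma fourier_coef0 n : fourier_coef (fun=> 0 : R[i]) n = 0.
Proof.
rewrite fourier_coefE -[RHS](mul0r (cmean (fun=> 0 : R[i]))).
rewrite -(cmeanZ p_gt1 0 (LpT0 p_ge1)).
by congr cmean; apply/funext => z; rewrite !mul0r.
Qed.

Lemma fourier_coef_exp (m n : int) : fourier_coef (fun z : circle R => sval z ^ m) n = (m == n)%R%:R.
Proof.
rewrite fourier_coefE (_ : (fun z => _) = fun z : circle R => sval z ^ (m - n)).
  by rewrite cmean_exp subr_eq0.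
by apply/funext => z; rewrite expfzDr ?circle_neq0.
Qed.

Lemma partial_sum_lin (a : R[i]) f g N z : LpT p f -> LpT p g ->
  S (fun z => a * f z + g z) N z = a * S f N z + S g N z.
Proof.
move=> Lf Lg; rewrite /analytic_partial_sum big_distrr/= -big_split/=.
by apply: eq_bigr => n _; rewrite fourier_coef_lin// mulrDl mulrA.
Qed.

Lemma partial_sumB f g N z : LpT p f -> LpT p g ->
  S (fun z => f z - g z) N z = S f N z - S g N z.
Proof.
move=> Lf Lg; rewrite (_ : (fun z => f z - g z) = fun z => (-1) * g z + f z).
  by rewrite partial_sum_lin// mulN1r addrC.
by apply/funext => w; rewrite mulN1r addrC.
Qed.

Lemma partial_sum_trig f N : is_trig (S f N).
Proof.
apply: is_trig_sum => n; apply: is_trigM; first exact: is_trig_cst.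
exact: (is_trig_exp R n%:Z).
Qed.

Lemma partial_sum_LpT f N : LpT p (S f N).
Proof. by apply: (is_trig_LpT p_ge1); exact: partial_sum_trig. Qed.

(** A crude bound depending on [N]. It serves to extend the uniform bound from trigonometric
    polynomials to L^p by density. *)
Lemma partial_sum_le N : exists2 K : R, 0 <= K & forall f, LpT p f ->
  (cnorm p (S f N) <= K%:E * cnorm p f)%E.
Proof.
have [k k0 kP] := cmean_le p_gt1.
have Le (n : nat) : LpT p (fun z : circle R => sval z ^+ n).
  by apply: (is_trig_LpT p_ge1); exact: (is_trig_exp R n%:Z).
pose M := \sum_(0 <= n < N) fine (cnorm p (fun z : circle R => sval z ^+ n)).
have M0 : 0 <= M by apply: sumr_ge0 => n _; rewrite fine_ge0// cnorm_ge0.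
exists (k * M); first by rewrite mulr_ge0.
move=> f Lf; apply: le_trans (cnorm_sum p_ge1 _ _) _.
  by move=> n; apply: cmeasZ; apply: LpT_cmeas (Le n).
rewrite /M mulr_sumr -sumEFin ge0_sume_distrl; last first.
  by move=> n _; rewrite lee_fin mulr_ge0// fine_ge0// cnorm_ge0.
apply: lee_sum => n _; rewrite (cnormZ p_ge1 _ (LpT_cmeas (Le n))).
rewrite EFinM fineK; last exact: LpT_fin.
rewrite muleAC; apply: lee_wpmul2r; first exact: cnorm_ge0.
rewrite fourier_coefE; apply: le_trans (kP _ (LpT_mul_exp _ Lf)) _.
by rewrite cnorm_mul_exp.
Qed.

Lemma partial_sum_exp (m : int) N z :
  S (fun z => sval z ^ m) N z = if (0 <= m) && (m < N%:Z) then sval z ^ m else 0.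
Proof.
rewrite /analytic_partial_sum; under eq_bigr do rewrite fourier_coef_exp.
case: m => k; last by rewrite big1// => n _; rewrite mul0r.
rewrite lez_nat /= ltz_nat; case: ltnP => kN.
  rewrite big_mkord (bigD1 (Ordinal kN))//= eqxx mul1r big1 ?addr0// => n nk.
  by rewrite eqz_nat; case: eqP => [kn|_]; [move: nk; rewrite -val_eqE/= kn eqxx|rewrite mul0r].
rewrite big_mkord big1// => n _; rewrite eqz_nat; case: eqP => [kn|_]; last by rewrite mul0r.
by move: (ltn_ord n); rewrite -kn ltnNge kN.
Qed.

Lemma partial_sum_trigp c N :
  S (trigp c) N = trigp [seq x <- c | (0 <= x.2) && (x.2 < N%:Z)].
Proof.
have Lt d : LpT p (trigp d) by apply: (is_trig_LpT p_ge1); exists d.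
have Le m : LpT p (fun z : circle R => sval z ^ m).
  by apply: (is_trig_LpT p_ge1); exact: is_trig_exp.
apply/funext => z; elim: c => [|x c IHc].
  rewrite (_ : trigp [::] = fun=> 0); last by apply/funext => w; rewrite /trigp big_nil.
  by rewrite /analytic_partial_sum big1 /trigp ?big_nil// => n _; rewrite fourier_coef0 mul0r.
rewrite (_ : trigp (x :: c) = fun z => x.1 * sval z ^ x.2 + trigp c z); last first.
  by apply/funext => w; rewrite /trigp big_cons.
rewrite partial_sum_lin// IHc partial_sum_exp /=.
by case: ifP => _; rewrite /trigp ?big_cons// mulr0 add0r.
Qed.

(** Once [N] exceeds all exponents the partial sum no longer changes, so the analytic part of a
    trigonometric polynomial is explicit. *)
Lemma partial_sum_trigp_near c : exists N0 : nat, forall N, (N0 <= N)%N ->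
  S (trigp c) N = trigp [seq x <- c | 0 <= x.2].
Proof.
have [N0 HN] : exists N0 : nat, forall x, x \in c -> x.2 < N0%:Z.
  elim: c => [|x c [N0 IHc]]; first by exists 0%N.
  exists (maxn N0 `|x.2|.+1)%N => y; rewrite inE => /predU1P[->|/IHc yN].
    apply: le_lt_trans (lez_abs x.2) _.
    by rewrite ltz_nat leq_max ltnSn orbT.
  by apply: lt_le_trans yN _; rewrite lez_nat leq_maxl.
exists N0 => N NN; rewrite partial_sum_trigp; congr trigp.
apply: eq_in_filter => x xc; rewrite (lt_le_trans (HN _ xc)) ?andbT//.
Qed.

Lemma is_analytic_part_trigp c : is_analytic_part p (trigp c) (trigp [seq x <- c | 0 <= x.2]).
Proof.
split; first by apply: (is_trig_LpT p_ge1); eexists.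
have [N0 HN] := partial_sum_trigp_near c.
apply: cvg_near_cst; exists N0 => // N /= NN.
rewrite HN//; under eq_fun do rewrite subrr.
by rewrite -[RHS](cnorm0 p_ge1).
Qed.

Lemma is_analytic_part_unique f g h : is_analytic_part p f g -> is_analytic_part p f h ->
  cnorm p (fun z => g z - h z) = 0%E.
Proof.
move=> [Lg fg] [Lh fh]; apply/eqP; rewrite eq_le cnorm_ge0 andbT.
apply/lee_addgt0Pr => e e0; rewrite add0e; have e2 : 0 < e / 2 by rewrite divr_gt0.
have [N1 _ /(_ _ (leq_maxl N1 _)) H1] := (cvge0P (fun n => cnorm_ge0 p _)).1 fg _ e2.
have [N2 _ /(_ _ (leq_maxr _ N2)) H2] := (cvge0P (fun n => cnorm_ge0 p _)).1 fh _ e2.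
have mS := LpT_cmeas (partial_sum_LpT f (maxn N1 N2)).
apply: le_trans (cnorm_triangle p_ge1 (LpT_cmeas Lg) mS (LpT_cmeas Lh)) _.
rewrite [e]splitr EFinD; apply: leeD; last exact: H2.
by rewrite cnormBC; exact: H1.
Qed.

Lemma is_analytic_part_lin (a : R[i]) f g f' g' : LpT p f -> LpT p g ->
  is_analytic_part p f f' -> is_analytic_part p g g' ->
  is_analytic_part p (fun z => a * f z + g z) (fun z => a * f' z + g' z).
Proof.
move=> Lf Lg [Lf' ff'] [Lg' gg']; split; first by apply: LpTD => //; exact: LpTZ.
apply/(cvge0P (fun n => cnorm_ge0 p _)) => e e0.
have a1 : 0 < cabs a + 1 by rewrite ltr_wpDl// cabs_ge0.
have H1 := (cvge0P (fun n => cnorm_ge0 p _)).1 ff' _ (divr_gt0 (divr_gt0 e0 (@ltr0Sn R 1)) a1).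
have H2 := (cvge0P (fun n => cnorm_ge0 p _)).1 gg' _ (divr_gt0 e0 (@ltr0Sn R 1)).
near=> N.
have mf : cmeas (fun z => S f N z - f' z).
  exact: (LpT_cmeas (LpTB p_ge1 (partial_sum_LpT f N) Lf')).
have mg : cmeas (fun z => S g N z - g' z).
  exact: (LpT_cmeas (LpTB p_ge1 (partial_sum_LpT g N) Lg')).
rewrite -/(cnorm p (fun z => _)).
rewrite (_ : (fun z => _) = fun z => a * (S f N z - f' z) + (S g N z - g' z)); last first.
  by apply/funext => z; rewrite partial_sum_lin// opprD addrACA mulrBr.
apply: le_trans (cnormD p_ge1 (cmeasZ a mf) mg) _.
rewrite (cnormZ p_ge1 a mf) [e]splitr EFinD; apply: leeD; last by near: N; exact: H2.
apply: (@le_trans _ _ ((cabs a)%:E * (e / 2 / (cabs a + 1))%:E)%E).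
  by apply: lee_wpmul2l; [rewrite lee_fin cabs_ge0|near: N; exact: H1].
rewrite -EFinM lee_fin mulrCA ler_piMr ?divr_ge0 ?(ltW e0)//.
by rewrite ler_pdivrMr// mul1r lerDl.
Unshelve. all: by end_near. Qed.

(** All Fourier coefficients of a null function vanish. No bound on the projection enters, so this
    is available even when no constant is admissible. *)
Lemma is_analytic_part_null f : LpT p f -> cnorm p f = 0%E -> is_analytic_part p f (fun=> 0).
Proof.
move=> Lf f0; split; first exact: LpT0.
apply: cvg_near_cst; apply: nearW => N; rewrite -[RHS](cnorm0 p_ge1).
congr (rnorm p _); apply/funext => z; rewrite subr0; congr cabs.
rewrite /analytic_partial_sum big1// => n _.
suff -> : fourier_coef f n = 0 by rewrite mul0r.
have [k k0 kP] := cmean_le p_gt1; apply/eqP; rewrite -cabs_eq0 eq_le cabs_ge0 andbT.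
rewrite -lee_fin fourier_coefE; apply: le_trans (kP _ (LpT_mul_exp _ Lf)) _.
by rewrite cnorm_mul_exp f0 mule0.
Qed.

End partial_sums.

(** * The Riesz projection *)

Section analytic_part_exists.
Variables (R : realType) (p C : R).
Hypothesis p_gt1 : 1 < p.
Hypothesis C_ge0 : 0 <= C.
Hypothesis trig_bounded : forall c : seq (R[i] * int),
  (cnorm p (trigp [seq x <- c | (0 <= x.2)%R]) <= C%:E * cnorm p (trigp c))%E.
Implicit Types (f g : circle R -> R[i]) (c : seq (R[i] * int)).

Let p_ge1 : 1 <= p. Proof. exact: ltW. Qed.

Local Notation S := (@analytic_partial_sum R).

Let partial_sum_shift c N z : S (trigp c) N z =
  trigp [seq x <- c | 0 <= x.2] z -
  sval z ^ N%:Z * trigp [seq x <- [seq (x.1, x.2 - N%:Z) | x <- c] | 0 <= x.2] z.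
Proof.
rewrite (partial_sum_trigp p_gt1) /trigp !big_filter big_map big_distrr/=.
rewrite [X in _ = X - _](bigID (fun x => x.2 < N%:Z))/=.
rewrite [X in _ - X](_ : _ = \sum_(x <- c | (0 <= x.2) && ~~ (x.2 < N%:Z)) x.1 * sval z ^ x.2).
  by rewrite addrK.
apply: eq_big => [x|x _] /=.
  by rewrite subr_ge0 -leNgt; case: (leP N%:Z) => [Nx|]; rewrite ?andbF// (le_trans _ Nx).
by rewrite mulrCA -expfzDr ?circle_neq0// subrKC.
Qed.

Let partial_sum_trig_le c N :
  (cnorm p (S (trigp c) N) <= (C + C)%:E * cnorm p (trigp c))%E.
Proof.
pose d := [seq (x.1, x.2 - N%:Z) | x <- c].
have mt e : cmeas (trigp e : circle R -> R[i]) by apply: (is_trig_cmeas p_ge1); exists e.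
have dE : cnorm p (trigp d) = cnorm p (trigp c).
  rewrite -[RHS](cnorm_mul_exp p _ (- N%:Z)); congr (cnorm p _); apply/funext => z.
  rewrite /trigp big_map big_distrl/=; apply: eq_bigr => x _.
  by rewrite -mulrA -expfzDr// circle_neq0.
rewrite (_ : S (trigp c) N = fun z => trigp [seq x <- c | 0 <= x.2] z -
    trigp [seq x <- d | 0 <= x.2] z * sval z ^ N%:Z); last first.
  by apply/funext => z; rewrite partial_sum_shift mulrC.
apply: le_trans (cnormB p_ge1 (mt _) (cmeas_mul_exp _ (mt _))) _.
rewrite cnorm_mul_exp EFinD ge0_muleDl ?lee_fin//.
by apply: leeD; [exact: trig_bounded|rewrite -dE; exact: trig_bounded].
Qed.

(** In S f = S g + S (f - g) with a trigonometric g, the first term has the uniform bound, and the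
    crude constant [K] multiplies a norm chosen small in terms of [K]. *)
Let partial_sum_bounded f N : LpT p f -> (cnorm p (S f N) <= (C + C)%:E * cnorm p f)%E.
Proof.
move=> Lf; apply/lee_addgt0Pr => e e0; have [K K0 KP] := partial_sum_le p_gt1 N.
have D0 : 0 < C + C + K + 1 by rewrite ltr_wpDl// !addr_ge0.
have [g tg fg] := trig_approx_LpT p_ge1 Lf (divr_gt0 e0 D0).
have Lg := is_trig_LpT p_ge1 tg.
have mS h M : cmeas (S h M) by exact: (LpT_cmeas (partial_sum_LpT p_gt1 h M)).
have mf := LpT_cmeas Lf; have mg := LpT_cmeas Lg.
have -> : S f N = fun z => S g N z + S (fun z => f z - g z) N z.
  by apply/funext => z; rewrite (partial_sumB p_gt1)// subrKC.
apply: le_trans (cnormD p_ge1 (mS _ _) (mS _ _)) _.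
have gle : (cnorm p g <= cnorm p f + (e / (C + C + K + 1))%:E)%E.
  apply: le_trans (cnorm_approx p_ge1 mg mf) _; exact: leeD2l.
apply: (@le_trans _ _ ((C + C)%:E * (cnorm p f + (e / (C + C + K + 1))%:E) +
    K%:E * (e / (C + C + K + 1))%:E)%E).
  apply: leeD.
    case: tg => c gE; rewrite gE; apply: le_trans (partial_sum_trig_le _ _) _.
    by rewrite -gE; apply: lee_wpmul2l => //; rewrite lee_fin addr_ge0.
  apply: le_trans (KP _ (LpTB p_ge1 Lf Lg)) _.
  by apply: lee_wpmul2l => //; rewrite lee_fin.
rewrite ge0_muleDr ?cnorm_ge0 ?lee_fin ?divr_ge0 ?(ltW e0) ?(ltW D0)//.
rewrite -addeA leeD2l// -!EFinM -EFinD lee_fin -mulrDl mulrCA ler_piMr ?(ltW e0)//.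
by rewrite ler_pdivrMr// mul1r lerDl.
Qed.

Theorem analytic_part_exists f : LpT p f -> exists g, is_analytic_part p f g.
Proof.
move=> Lf; have mS h M : cmeas (S h M) by exact: (LpT_cmeas (partial_sum_LpT p_gt1 h M)).
have [|g Lg Sg] := cnorm_complete p_gt1 (fun N => partial_sum_LpT p_gt1 f N); last by exists g.
move=> e e0; have D0 : 0 < C + C + (C + C) + 1 by rewrite ltr_wpDl// !addr_ge0.
have [g tg fg] := trig_approx_LpT p_ge1 Lf (divr_gt0 e0 D0).
have Lg := is_trig_LpT p_ge1 tg; have [c gE] := tg.
have [N0 N0P] := partial_sum_trigp_near p_gt1 c.
exists N0 => n m nN mN.
(* Beyond [N0] the partial sums of [g] coincide, so only those of [f - g] contribute to the
   difference. *)
have -> : (fun z => S f n z - S f m z) =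
    fun z => S (fun z => f z - g z) n z - S (fun z => f z - g z) m z.
  apply/funext => z; rewrite !(partial_sumB p_gt1)// gE (N0P n)// (N0P m)//.
  by rewrite opprB subrKA.
apply: le_trans (cnormB p_ge1 (mS _ _) (mS _ _)) _.
have H k : (cnorm p (S (fun z => f z - g z)%R k) <= (C + C)%:E * (e / (C + C + (C + C) + 1))%:E)%E.
  apply: le_trans (partial_sum_bounded _ (LpTB p_ge1 Lf Lg)) _.
  by apply: lee_wpmul2l => //; rewrite lee_fin addr_ge0.
apply: le_trans (leeD (H n) (H m)) _.
rewrite -EFinM -EFinD lee_fin -mulrDl mulrCA ler_piMr ?(ltW e0)//.
by rewrite ler_pdivrMr// mul1r lerDl.
Qed.

End analytic_part_exists.

Section riesz_projection.
Variables (R : realType) (p s : R).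
Hypothesis p_gt1 : 1 < p.
Hypothesis s_gt1 : 1 < s.
Implicit Types (f g : circle R -> R[i]) (c : seq (R[i] * int)).

Let p_ge1 : 1 <= p. Proof. exact: ltW. Qed.
Let s_gt0 : 0 < s. Proof. exact: lt_trans s_gt1. Qed.

Let pair (f : circle R -> R[i]) (z : circle R) : R :=
  (cabs (Pplus p f z) `^ s + cabs (Pminus p f z) `^ s) `^ s^-1.

Definition admissible (C : R) := forall f, LpT p f ->
  (normT p (fun z => (pair f z)%:E) <= C%:E * normT p (fun z => (cabs (f z))%:E))%E.

Lemma PplusP f g : is_analytic_part p f g -> is_analytic_part p f (Pplus p f).
Proof. by move=> fg; apply: (@xgetPex _ (fun=> 0) [set g | is_analytic_part p f g]); exists g. Qed.

Lemma riesz_projection_null f : LpT p f -> cnorm p f = 0%E ->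
  [/\ cmeas (Pplus p f), cnorm p (Pplus p f) = 0%E,
      cmeas (Pminus p f) & cnorm p (Pminus p f) = 0%E].
Proof.
move=> Lf f0; have f00 := is_analytic_part_null p_gt1 Lf f0; have fP := PplusP f00.
have P0 : cnorm p (Pplus p f) = 0%E.
  have := is_analytic_part_unique p_gt1 fP f00.
  by under eq_fun do rewrite subr0.
have mP : cmeas (Pplus p f) by case: fP => /LpT_cmeas.
have mf := LpT_cmeas Lf; have mM : cmeas (Pminus p f) by exact: cmeasB.
split => //; apply/eqP; rewrite eq_le cnorm_ge0 andbT.
by apply: le_trans (cnormB p_ge1 mf mP) _; rewrite f0 P0 adde0.
Qed.

Let le_root (a b : R) : 0 <= a -> 0 <= b -> a <= (a `^ s + b `^ s) `^ s^-1.
Proof.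
move=> a0 b0; rewrite -[leLHS]powRr1// -(divff (lt0r_neq0 s_gt0)) powRrM.
by apply: ge0_ler_powR; rewrite ?invr_ge0 ?nnegrE ?addr_ge0 ?powR_ge0 ?lerDl ?powR_ge0// ltW.
Qed.

Section admissible.
Variable C : R.
Hypothesis C_adm : admissible C.

(** The existence of an analytic part is assumed here because its proof in general rests on this
    estimate for trigonometric polynomials. *)
Let admissible_le_aux f g : LpT p f -> is_analytic_part p f g ->
  (cnorm p (Pplus p f) <= C%:E * cnorm p f)%E /\ (cnorm p (Pminus p f) <= C%:E * cnorm p f)%E.
Proof.
move=> Lf /PplusP [LP _]; have mP := LpT_cmeas LP.
have mM : cmeas (Pminus p f) by exact: (cmeasB (LpT_cmeas Lf) mP).
have mpair : rmeas (pair f).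
  by apply: rmeas_powR; apply: measurable_funD; exact: rmeas_cabs_powR.
have H h : cmeas h -> (forall z, cabs (h z) <= pair f z) -> (cnorm p h <= C%:E * cnorm p f)%E.
  move=> mh hp; apply: le_trans (C_adm Lf); apply: (rnorm_le p_ge1 (rmeas_cabs mh) mpair) => z.
  exact: (ler_norm2 (cabs_ge0 _) (hp z)).
split; apply: H => // z; first exact: (le_root (cabs_ge0 _) (cabs_ge0 _)).
rewrite /pair addrC; exact: (le_root (cabs_ge0 _) (cabs_ge0 _)).
Qed.

(** The chosen representative and the explicit analytic part differ by a null function, so the
    estimate carries over. *)
Let trig_bounded c :
  (cnorm p (trigp [seq x <- c | (0 <= x.2)%R]) <= C%:E * cnorm p (trigp c))%E.
Proof.
have aT := is_analytic_part_trigp p_gt1 c; have aP := PplusP aT.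
have Lc : LpT p (trigp c : circle R -> R[i]) by apply: (is_trig_LpT p_ge1); exists c.
have [H _] := admissible_le_aux Lc aT; apply: le_trans H.
have := cnorm_approx p_ge1 (LpT_cmeas aT.1) (LpT_cmeas aP.1).
by rewrite (is_analytic_part_unique p_gt1 aP aT) adde0.
Qed.

(** The constant function 1 is its own analytic part and has positive finite norm. *)
Lemma admissible_ge1 : 1 <= C.
Proof.
pose c := [:: (1 : R[i], 0 : int)].
have cE : cnorm p (trigp c) = ((2 * pi) `^ p^-1)%:E.
  rewrite /cnorm (rnorm_root p_ge1).
  rewrite (_ : (fun t => _) = (fun=> 1%:E)); last first.
    by apply/funext => t; rewrite /trigp big_seq1 expr0z mulr1 cabs1 normr1 powR1.
  rewrite integral_cst ?mul1e; last exact: arc_meas.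
  by rewrite -poweR_EFin; congr (_ `^ _)%E; exact: mu_arc.
have c0 : 0 < (2 * pi) `^ p^-1 by rewrite powR_gt0// mulr_gt0 ?pi_gt0.
have := trig_bounded c; rewrite {1}/c /= cE -EFinM lee_fin.
by rewrite -{1}[_ `^ _]mul1r ler_pM2r.
Qed.

Let C_ge0 : 0 <= C. Proof. exact: le_trans admissible_ge1. Qed.

Lemma PplusP_admissible f : LpT p f -> is_analytic_part p f (Pplus p f).
Proof.
move=> Lf; have [g] := analytic_part_exists p_gt1 C_ge0 trig_bounded Lf.
exact: PplusP.
Qed.

Lemma Pplus_Lp f : LpT p f -> LpT p (Pplus p f).
Proof. by move=> /PplusP_admissible[]. Qed.

Lemma Pminus_Lp f : LpT p f -> LpT p (Pminus p f).
Proof. by move=> Lf; apply: LpTB => //; exact: Pplus_Lp. Qed.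

Lemma Pplus_le f : LpT p f -> (cnorm p (Pplus p f) <= C%:E * cnorm p f)%E.
Proof. by move=> Lf; have [] := admissible_le_aux Lf (PplusP_admissible Lf). Qed.

Lemma Pminus_le f : LpT p f -> (cnorm p (Pminus p f) <= C%:E * cnorm p f)%E.
Proof. by move=> Lf; have [] := admissible_le_aux Lf (PplusP_admissible Lf). Qed.

Lemma Pplus_lin (a : R[i]) f g : LpT p f -> LpT p g ->
  cnorm p (fun z => Pplus p (fun z => a * f z + g z) z - (a * Pplus p f z + Pplus p g z)) = 0%E.
Proof.
move=> Lf Lg; have L : LpT p (fun z => a * f z + g z) by apply: LpTD => //; exact: LpTZ.
apply: (is_analytic_part_unique p_gt1 (PplusP_admissible L)).
by apply: is_analytic_part_lin => //; exact: PplusP_admissible.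
Qed.

Lemma Pminus_lin (a : R[i]) f g : LpT p f -> LpT p g ->
  cnorm p (fun z => Pminus p (fun z => a * f z + g z) z - (a * Pminus p f z + Pminus p g z)) = 0%E.
Proof.
move=> Lf Lg; rewrite -(Pplus_lin a Lf Lg) -[RHS]cnormN; congr (cnorm p _).
apply/funext => z; rewrite /Pminus.
move: (Pplus p (fun z => a * f z + g z) z) (Pplus p f z) (Pplus p g z) (f z) (g z) => x y w u v.
by ring.
Qed.

End admissible.
End riesz_projection.

(* Without admissible constants opt_const is +oo, and the convention
   +oo * 0 = 0 leaves the case where all f k vanish almost everywhere. *)
Lemma lsnorm_le_opt_const (R : realType) (p s : R)
    (hps : (2 <= s /\ s <= p) \/ (1 < p /\ p <= s /\ s <= 2))
    (P : (circle R -> R[i]) -> circle R -> R[i])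
    (f : nat -> circle R -> R[i]) : (forall k, LpT p (f k)) ->
  (forall C, admissible p s C ->
    normT p (lsnorm s (fun k => P (f k))) <= C%:E * normT p (lsnorm s f))%E ->
  (forall g, LpT p g -> cnorm p g = 0%E -> cmeas (P g) /\ cnorm p (P g) = 0%E) ->
  (normT p (lsnorm s (fun k => P (f k))) <= opt_const s p * normT p (lsnorm s f))%E.
Proof.
move=> Lf P_adm P_null.
have [p_gt1 s_gt1] := exponents_gt1 hps.
have p_ge1 := ltW p_gt1; have mf k := LpT_cmeas (Lf k).
set L := normT p (lsnorm s (fun k => P (f k))); set N := normT p (lsnorm s f).
have N0 : (0 <= N)%E by exact: Lnorm_ge0.
have opt1 : (1%:E <= opt_const s p)%E.
  by apply: le_ereal_inf_tmp => _ [C C_adm <-]; rewrite lee_fin; exact: (admissible_ge1 p_gt1 s_gt1 C_adm).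
have [N_eq0|N_neq0] := eqVneq N 0%E.
  (* The l^s norm dominates each |f_k|, so all [f k] are null, and so are their images. *)
  have P0 k : cmeas (P (f k)) /\ cnorm p (P (f k)) = 0%E.
    apply: P_null (Lf k) _.
    apply/eqP; rewrite eq_le cnorm_ge0 andbT -N_eq0.
      apply: (normT_le p_ge1); first exact: (rmeas_emeas (rmeas_cabs (mf k))).
        exact: (emeas_lsnorm s mf).
      move=> z; rewrite gee0_abs ?lee_fin ?cabs_ge0// gee0_abs; last exact: poweR_ge0.
      apply: le_trans (lsnorm_fls hps f k.+1 z).
      by rewrite lee_fin; exact: (le_fls s_gt1 (fun i : 'I_k.+1 => f i z) ord_max).
  rewrite N_eq0 mule0; apply: (normT_lsnorm_le hps (fun k => (P0 k).1)) => n.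
  apply: le_trans (rnorm_fls_le_sum p_ge1 s_gt1 (fun k : 'I_n => (P0 k).1)) _.
  by rewrite big1// => k _; exact: (P0 k).2.
have LN C : admissible p s C -> (L <= C%:E * N)%E by exact: P_adm.
(* If [N] is infinite the right-hand side is +oo, because [opt_const] is at least 1. *)
move: N0 N_neq0 LN; move: L N => L [N|_ _ _|//]; last first.
  by rewrite gt0_muley ?leey// (lt_le_trans _ opt1)// lte_fin.
rewrite lee_fin eqe => N0 N_neq0 LN.
have N_gt0 : 0 < N by rewrite lt_neqAle eq_sym N_neq0.
(* Dividing by the positive finite [N] leaves a lower bound for every admissible constant, hence for
   the infimum; with no admissible constant this holds vacuously. *)
rewrite muleC -lee_pdivrMl//; apply: le_ereal_inf_tmp => _ [C C_adm <-].
by rewrite lee_pdivrMl// muleC; exact: LN.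
Qed.

Theorem corollary1p3 (R : realType) (p s : R)
    (hps : (2 <= s /\ s <= p) \/ (1 < p /\ p <= s /\ s <= 2))
    (f : nat -> circle R -> complex R) (hf : forall k, LpT p (f k)) :
  (normT p (lsnorm s (fun k => Pplus p (f k)))
     <= opt_const s p * normT p (lsnorm s f))%E /\
  (normT p (lsnorm s (fun k => Pminus p (f k)))
     <= opt_const s p * normT p (lsnorm s f))%E.
Proof.
have [p_gt1 s_gt1] := exponents_gt1 hps.
split; apply: (lsnorm_le_opt_const hps) => // [C C_adm|g Lg g0].
- apply: (sequence_extension hps) => //.
  + exact: le_trans (admissible_ge1 p_gt1 s_gt1 C_adm).
  + by move=> g; exact: Pplus_Lp C_adm g.
  + by move=> g; exact: Pplus_le C_adm g.
  + by move=> a g h; exact: Pplus_lin C_adm a g h.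
- by have [] := riesz_projection_null p_gt1 Lg g0.
- apply: (sequence_extension hps) => //.
  + exact: le_trans (admissible_ge1 p_gt1 s_gt1 C_adm).
  + by move=> g; exact: Pminus_Lp C_adm g.
  + by move=> g; exact: Pminus_le C_adm g.
  + by move=> a g h; exact: Pminus_lin C_adm a g h.
- by have [] := riesz_projection_null p_gt1 Lg g0.
Qed.
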